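(* Let $1\le j\le k-1$ be integers. There exists a constant $c=c(k,j)>0$ such that the following holds. Let $0\le p_1=p_1(n),\,p_2=p_2(n)\le 1$ and let $H\sim H_k(n,p_1,p_2)$. (i) If $p_1p_2\le \frac{1}{c\,n^{2k-2j-1}\log n}$, then with high probability $H$ does not $j$-percolate. (ii) If $p_1p_2\ge \frac{c}{n^{2k-2j-1}\log n}$ and $\min\{p_1,p_2\}\ge \frac{c\log n}{n^{k-j}}$, then with high probability $H$ $j$-percolates.
   Context: For a set $V$, $V^{(i)}$ denotes the set of $i$-element subsets of $V$. A double $k$-graph $(V,E_1,E_2)$ consists of a vertex set $V$, a set $E_1\subseteq V^{(k)}$ of red edges and a set $E_2\subseteq V^{(k)}$ of blue edges (a $k$-set may be both red and blue). The random binomial double $k$-graph $H_k(n,p_1,p_2)$ has vertex set $[n]=\{1,\dots,n\}$, and each $k$-set is a red edge with probability $p_1$ and a blue edge with probability $p_2$, all these events being independent. $j$-jigsaw percolation of a collection $\mathcal{J}\subseteq V^{(j)}$ on $(V,E_1,E_2)$: start at time $0$ with the partition of $\mathcal{J}$ into singletons (the classes are called clusters). Given the partition at time $t$, form an auxiliary graph on the clusters in which two distinct clusters $C,C'$ are adjacent iff there exist $J_1,J_2\in C$, $J_1',J_2'\in C'$, a red edge $e_1\in E_1$ with $J_1\cup J_1'\subseteq e_1$ and a blue edge $e_2\in E_2$ with $J_2\cup J_2'\subseteq e_2$. If this auxiliary graph has no edges, the process stops. Otherwise the partition at time $t+1$ is obtained by taking, for each connected component of the auxiliary graph, the union of the clusters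 in it; if this new partition has a single class the process stops, otherwise continue. $\mathcal{J}$ percolates on $(V,E_1,E_2)$ if the process stops with a single cluster. The double $k$-graph $j$-percolates if $\mathcal{J}=V^{(j)}$ percolates on it. ''With high probability'' means with probability tending to $1$ as $n\to\infty$. *)

(* Defs.v *)
From HB Require Import structures.
From mathcomp Require Import all_boot all_order all_algebra.
From mathcomp Require Import all_classical all_reals all_analysis.

Set Implicit Arguments.
Unset Strict Implicit.
Unset Printing Implicit Defensive.

Import Order.TTheory GRing.Theory Num.Theory.
Import numFieldNormedType.Exports.

Local Open Scope ring_scope.

(* V^(i), for V the set of all elements of the finite type T. *)
Definition subsets_of_card (T : finType) (i : nat) : {set {set T}} :=
  [set A : {set T} | #|A| == i].

(* A double k-graph on T is a pair (E_1, E_2) of subsets of V^(k);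
   red edges first, blue edges second. *)
Definition double_graph (T : finType) : Type := ({set {set T}} * {set {set T}})%type.

Definition double_kgraphs (T : finType) (k : nat) : {set double_graph T} :=
  [set H : double_graph T | (H.1 \subset subsets_of_card T k)
                         && (H.2 \subset subsets_of_card T k)].

Definition linked (T : finType) (E : {set {set T}}) (C C' : {set {set T}}) : bool :=
  [exists J in C, exists J' in C', exists e in E, J :|: J' \subset e].

Definition cluster_adj (T : finType) (H : double_graph T)
    (P : {set {set {set T}}}) : rel {set {set T}} :=
  fun C C' => [&& C \in P, C' \in P, C != C', linked H.1 C C' & linked H.2 C C'].

Definition jigsaw_step (T : finType) (H : double_graph T)
    (P : {set {set {set T}}}) : {set {set {set T}}} :=
  [set finset.cover [set C' in P | connect (cluster_adj H P) C C'] | C in P].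

(* A partition whose auxiliary graph has no edges is a fixed point of
   [jigsaw_step], so the sequence is constant once the process has stopped. *)
Definition jigsaw_clusters (T : finType) (H : double_graph T)
    (J : {set {set T}}) (t : nat) : {set {set {set T}}} :=
  iter t (jigsaw_step H) [set [set A] | A in J].

(* This includes the case of a single cluster, as adjacent clusters are
   distinct. *)
Definition jigsaw_stopped (T : finType) (H : double_graph T)
    (P : {set {set {set T}}}) : bool :=
  [forall C, forall C', ~~ cluster_adj H P C C'].

Definition percolates (T : finType) (H : double_graph T) (J : {set {set T}}) : Prop :=
  exists t : nat, jigsaw_stopped H (jigsaw_clusters H J t)
               /\ #|jigsaw_clusters H J t| = 1%N.

Definition j_percolates (T : finType) (j : nat) (H : double_graph T) : Prop :=
  percolates H (subsets_of_card T j).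

Definition binomial_weight (R : realType) (n k : nat) (p : R)
    (E : {set {set 'I_n}}) : R :=
  \prod_(e in subsets_of_card 'I_n k) (if e \in E then p else 1 - p).

(* Pr[A] for H ~ H_k(n, p1, p2); the vertex set [n] is 'I_n. *)
Definition Pr_H (R : realType) (k n : nat) (p1 p2 : R)
    (A : double_graph 'I_n -> Prop) : R :=
  \sum_(H in double_kgraphs 'I_n k | `[< A H >])
    binomial_weight k p1 H.1 * binomial_weight k p2 H.2.

(* Main.v *)
Require Import Defs.
From HB Require Import structures.
From mathcomp Require Import all_boot all_order all_algebra.
From mathcomp Require Import all_classical all_reals all_analysis.
From mathcomp Require Import lra ring zify.
From mathcomp Require Import fintype finset.

(** Subcritical part. If one colour has fewer than [delta n^j] edges, too few
    [j]-sets are covered. Otherwise, by the Aizenman-Lebowitz argument,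
    percolation produces a family [C] of about [log n] [j]-sets that is connected
    in both colours. A minimal red skeleton of [r] edges is a connected set of
    [k]-sets, of which there are at most [n^k (const n^(k-j))^r], and then the [s]
    blue edges each contain two members of [C], which leaves
    [(const log n n^(k-j-1))^s] choices; for [r <= s] the expected number of such
    pairs is at most [n^k (const log n n^(2k-2j-1) p1 p2)^r], and [r] is of order
    [log n].

    Supercritical part. For a fixed [(j-1)]-set [I] look at the [j]-sets [x |: I].
    A cluster of [i] of them absorbs a fresh [w |: I] with probability about
    [i^2 n^(2k-2j-2) p1 p2]. Scanning [n/4] fresh vertices, a cluster grown from one
    vertex reaches size [L], a small multiple of [log n], with probability at least
    [32^-L >= n^(-1/4)], so one of the many vertex-disjoint trials succeeds; scanning
    another [n/4] vertices takes the cluster from size [L] to size [n/64], after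
    which it absorbs any two given vertices. All failure probabilities are
    [O(n^-(j+2))], so a union bound over [I] and two vertices shows that any two
    [j]-sets differing in one vertex end up in the same cluster. *)

Set Implicit Arguments.
Unset Strict Implicit.
Unset Printing Implicit Defensive.

Import Order.TTheory GRing.Theory Num.Theory.
Import numFieldNormedType.Exports.

Local Open Scope ring_scope.

(** * Product measures on subsets of a finite type *)

(** The logarithm in the threshold has one source on both sides. Choosing about [L] edges among the
    [L ^ 2 n ^ (k - j - 1)] that contain two members of a family of size [L] leaves a factor [L],
    not [L ^ 2], per edge. Conversely the [L] levels of a trial share the fresh vertices, so a level
    gets about [n / L] of them and again one factor [L] is lost. With [L] of order [log n] a nucleus
    has polynomially small probability, which the number of starting points can compensate.

    The subcritical count has one weak point: lowering the exponent [s] to [r] in the factor of the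
    larger skeleton needs the base of that factor to be at most 1. The bound on [p1 * p2] gives this
    only if the other colour is not too rare, hence the separate treatment of a rare colour.

    The supercritical exploration is adaptive. Conditional probabilities are avoided: a history is
    an event that ignores all coordinates not yet revealed, and each test multiplies its probability
    by independence. Different pairs of vertices own disjoint coordinates because the edges examined
    meet the list of working vertices in exactly two points. *)

Section ProductMeasure.

Variables (R : realFieldType) (X : finType) (p : X -> R).

Definition wt (w : {set X}) : R :=
  \prod_x (if x \in w then p x else 1 - p x).

Definition Pr (A : pred {set X}) : R := \sum_(w | A w) wt w.

(** Measurability with respect to the coordinates outside [Q]. Naming the coordinates left out makes
    it easy to shrink [Q] as more of them are revealed. *)
Definition ignores (Q : pred X) (A : pred {set X}) : Prop :=
  forall w w' : {set X}, (forall x, ~~ Q x -> (x \in w) = (x \in w')) -> A w = A w'.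

Lemma eq_Pr (A B : pred {set X}) : A =1 B -> Pr A = Pr B.
Proof. by move=> AB; apply: eq_bigl. Qed.

Lemma sum_prod_set (F G : X -> R) :
  \sum_(w : {set X}) \prod_x (if x \in w then F x else G x) =
  \prod_x (F x + G x).
Proof. by rewrite bigA_distr; apply: eq_bigl. Qed.

Lemma PrT : Pr predT = 1.
Proof.
rewrite /Pr /wt sum_prod_set.
by rewrite big1 // => x _; rewrite addrC subrK.
Qed.

Lemma Pr_cylinder (S S' : {set X}) : [disjoint S & S'] ->
  Pr (fun w => (S \subset w) && [disjoint S' & w]) =
  (\prod_(x in S) p x) * \prod_(x in S') (1 - p x).
Proof.
move=> dSS'.
(* Zeroing the factor of presence on [S'] and that of absence on [S] kills exactly the terms outside
   the cylinder, and the sum over all [w] factors. *)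
pose F x := if x \in S' then 0 else p x.
pose G x := if x \in S then 0 else 1 - p x.
transitivity (\sum_(w : {set X}) \prod_x (if x \in w then F x else G x)).
  rewrite /Pr [RHS](bigID (fun w : {set X} => (S \subset w) && [disjoint S' & w])) /=.
  rewrite [X in _ = _ + X]big1 ?addr0.
    apply: eq_bigr => w /andP[Sw S'w]; apply: eq_bigr => x _.
    rewrite /F /G; case: ifPn => xw.
      case: ifPn => // xS'; move: S'w => /pred0P/(_ x) /=.
      by rewrite xS' xw.
    by case: ifPn => // xS; rewrite (subsetP Sw) in xw.
  move=> w; rewrite negb_and => /orP[/subsetPn[x xS xw]|].
    by rewrite (bigD1 x) //= (negbTE xw) /G xS mul0r.
  rewrite -setI_eq0 => /set0Pn[x /setIP[xS' xw]].
  by rewrite (bigD1 x) //= xw /F xS' mul0r.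
rewrite sum_prod_set (bigID (mem S)) /=; congr (_ * _).
  apply: eq_bigr => x xS; rewrite /F /G xS addr0.
  by have := disjointFr dSS' xS => ->.
rewrite (bigID (mem S')) /= [X in _ * X]big1 ?mulr1; last first.
  by move=> x /andP[/negbTE xS /negbTE xS']; rewrite /F /G xS xS' addrC subrK.
rewrite (eq_bigl (fun x => x \in S')); last first.
  move=> x /=; case: (boolP (x \in S')) => xS'; rewrite ?andbF // andbT.
  by rewrite (disjointFl dSS' xS').
apply: eq_bigr => x xS'; rewrite /F /G xS' add0r.
by rewrite (disjointFl dSS' xS').
Qed.

Lemma Pr_subset (S : {set X}) : Pr (fun w => S \subset w) = \prod_(x in S) p x.
Proof.
have := @Pr_cylinder S set0; rewrite big_set0 mulr1 => <-; last first.
  by rewrite disjoint_sym -setI_eq0 set0I.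
by apply: eq_Pr => w; rewrite -setI_eq0 set0I eqxx andbT.
Qed.

Lemma Pr_disjoint (S : {set X}) :
  Pr (fun w => [disjoint S & w]) = \prod_(x in S) (1 - p x).
Proof.
have := @Pr_cylinder set0 S; rewrite big_set0 mul1r => <-; last first.
  by rewrite -setI_eq0 set0I.
by apply: eq_Pr => w; rewrite sub0set.
Qed.

(* Swapping the coordinates in [Q] between two independent samples preserves
   the joint weight. *)
Lemma Pr_indep (Q : pred X) (A B : pred {set X}) :
  ignores Q A -> ignores (predC Q) B ->
  Pr (fun w => A w && B w) = Pr A * Pr B.
Proof.
move=> iA iB.
pose sw (w w' : {set X}) := [set x | if Q x then x \in w' else x \in w].
pose f (u : {set X} * {set X}) := (sw u.1 u.2, sw u.2 u.1).
have fK : involutive f.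
  move=> [w w']; rewrite /f /sw /=; congr (_, _); apply/setP=> x;
    by rewrite !inE; case: (Q x).
transitivity (\sum_(u : {set X} * {set X} | A u.1 && B u.1) wt u.1 * wt u.2).
  rewrite (eq_bigl (fun u => [pred w | A w && B w] u.1 && predT u.2)); last first.
    by move=> u /=; rewrite andbT.
  rewrite -(pair_big [pred w | A w && B w] predT (fun w w' => wt w * wt w')) /=.
  rewrite /Pr; apply: eq_bigr => w _; rewrite -mulr_sumr.
  by move: PrT; rewrite /Pr => ->; rewrite mulr1.
rewrite (reindex_inj (inv_inj fK)) /= /Pr big_distrl /=.
under [RHS]eq_bigr do rewrite big_distrr.
rewrite [RHS](pair_big A B (fun w w' => wt w * wt w')) /=.
apply: eq_big.
  move=> [w w'] /=; congr (_ && _); [apply: iA|apply: iB] => x.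
    by rewrite inE; move=> /negbTE->.
  by move=> /=; rewrite negbK inE => ->.
move=> [w w'] _ /=; rewrite /wt -!big_split /=; apply: eq_bigr => x _.
by rewrite !inE; case: (Q x) => //; rewrite mulrC.
Qed.

Lemma Pr_split (A B : pred {set X}) :
  Pr A = Pr (fun w => A w && B w) + Pr (fun w => A w && ~~ B w).
Proof. by rewrite /Pr (bigID B). Qed.

Lemma PrC (A : pred {set X}) : Pr (fun w => ~~ A w) = 1 - Pr A.
Proof. by rewrite -PrT (Pr_split predT A) [X in _ = X - _]addrC addrK. Qed.

Hypothesis p01 : forall x, 0 <= p x <= 1.

Lemma wt_ge0 w : 0 <= wt w.
Proof.
apply: prodr_ge0 => x _; have /andP[p0 p1] := p01 x.
by case: ifP => _ //; rewrite subr_ge0.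
Qed.

Lemma Pr_ge0 A : 0 <= Pr A.
Proof. by apply: sumr_ge0 => w _; apply: wt_ge0. Qed.

Lemma le_Pr (A B : pred {set X}) : (forall w, A w -> B w) -> Pr A <= Pr B.
Proof.
move=> AB; rewrite (Pr_split B A) (@eq_Pr (fun w => B w && A w) A).
  by rewrite lerDl Pr_ge0.
by move=> w /=; case: (boolP (A w)) => [/AB->|]; rewrite ?andbF.
Qed.

Lemma Pr_le1 A : Pr A <= 1.
Proof. by rewrite -PrT; apply: le_Pr. Qed.

Lemma Pr_bigU (I : finType) (P : pred I) (A : I -> pred {set X}) :
  Pr (fun w => [exists i, P i && A i w]) <= \sum_(i | P i) Pr (A i).
Proof.
rewrite /Pr (exchange_big_dep predT) //= big_mkcond /=.
apply: ler_sum => w _; case: ifP => [/existsP[i /andP[Pi Ai]]|_].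
  rewrite (bigD1 i) ?Pi //= lerDl.
  by apply: sumr_ge0 => ? _; apply: wt_ge0.
by apply: sumr_ge0 => ? _; apply: wt_ge0.
Qed.

Lemma PrU (A B : pred {set X}) : Pr (fun w => A w || B w) <= Pr A + Pr B.
Proof.
rewrite (Pr_split _ A); apply: lerD; apply: le_Pr => w.
  by case/andP.
by case/andP=> /orP[->|].
Qed.

End ProductMeasure.

(** * Connected sets and the jigsaw process *)

Lemma leq_card_bigcup (I Y : finType) (P : pred I) (F : I -> {set Y}) :
  (#|\bigcup_(x | P x) F x| <= \sum_(x | P x) #|F x|)%N.
Proof.
elim/big_rec2: _ => [|x m A Px IH]; first by rewrite cards0.
by apply: leq_trans (leq_card_setU _ _) _; rewrite leq_add2l.
Qed.

Definition gconn (Y : finType) (g : rel Y) (S : {set Y}) : bool :=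
  [forall x in S, forall y in S,
     connect (fun a b => [&& a \in S, b \in S & g a b]) x y].

Section ConnectedSets.

Variables (Y : finType) (g : rel Y).

Lemma gconnP (S : {set Y}) :
  reflect (forall x y, x \in S -> y \in S ->
             connect (fun a b => [&& a \in S, b \in S & g a b]) x y)
          (gconn g S).
Proof.
apply: (iffP forall_inP) => [h x y xS yS|h x xS].
  by have /forall_inP := h x xS; apply.
by apply/forall_inP => y yS; apply: h.
Qed.

Lemma connect_crossing (r : rel Y) (D : pred Y) (x y : Y) :
  connect r x y -> D x -> ~~ D y -> exists a b, [/\ D a, ~~ D b & r a b].
Proof.
case/connectP => s + ->; elim: s x => [|z s IH] x /=.
  by move=> _ Dx; rewrite Dx.
case/andP=> rxz pz Dx Dl; case: (boolP (D z)) => Dz; first exact: IH Dl.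
by exists x, z.
Qed.

Lemma connect_closed (r : rel Y) (D : pred Y) (x y : Y) :
  (forall a b, D a -> r a b -> D b) -> connect r x y -> D x -> D y.
Proof.
move=> cl cxy Dx; apply/negPn/negP => Dy.
have [a [b [Da Db rab]]] := connect_crossing cxy Dx Dy.
by rewrite (cl a b) in Db.
Qed.

Lemma gconn_sub (S S' : {set Y}) x y : S \subset S' ->
  connect (fun a b => [&& a \in S, b \in S & g a b]) x y ->
  connect (fun a b => [&& a \in S', b \in S' & g a b]) x y.
Proof.
move=> /subsetP SS'; apply: connect_sub => a b /and3P[aS bS gab].
by apply: connect1; rewrite !SS'.
Qed.

Lemma gconn1 x : gconn g [set x].
Proof. by apply/gconnP => a b /set1P-> /set1P->; apply: connect0. Qed.

Lemma gconnU (S S' : {set Y}) x y : symmetric g -> gconn g S -> gconn g S' ->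
  x \in S -> y \in S' -> g x y -> gconn g (S :|: S').
Proof.
move=> gs /gconnP cS /gconnP cS' xS yS' gxy.
set r := fun a b => [&& a \in S :|: S', b \in S :|: S' & g a b].
have rs : symmetric r.
  by move=> a b; rewrite /r gs andbA [(a \in _) && _]andbC -andbA.
have toy a : a \in S :|: S' -> connect r a y.
  case/setUP => aS; last by apply: (gconn_sub (subsetUr S S')); apply: cS'.
  apply: (@connect_trans _ _ x); first exact/(gconn_sub (subsetUl S S'))/cS.
  by apply: connect1; rewrite /r !inE xS yS' gxy orbT.
apply/gconnP => a b aS bS; apply: (connect_trans (toy a aS)).
by rewrite (sym_connect_sym rs) toy.
Qed.

(* Percolation trick: keep each vertex with probability [q = 1/(2D)]. The events
   that the component of [y0] is exactly [S] are disjoint, and each of them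
   has probability at least [(q / 2) ^ r]. *)
Lemma card_gconn_le (y0 : Y) (D r : nat) : (0 < D)%N ->
  (forall x, #|[set y | g x y]| <= D)%N ->
  (#|[set S : {set Y} | [&& y0 \in S, gconn g S & #|S| == r]]| <= (4 * D) ^ r)%N.
Proof.
move=> D0 deg; set An := [set S | _].
have [F _] : exists F : realFieldType, True by exists rat.
pose q : F := (2 * D)%:R^-1.
have D0' : 0 < (2 * D)%:R :> F by rewrite ltr0n muln_gt0.
have q0 : 0 < q by rewrite invr_gt0.
have q12 : q * D%:R = 1 / 2%:R.
  by rewrite /q natrM; field; rewrite pnatr_eq0 -lt0n D0.
have q1 : q <= 1 / 2%:R.
  by rewrite -q12 -[X in X <= _]mulr1 ler_pM2l // ler1n.
pose pq := fun _ : Y => q.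
have p01 : forall x, 0 <= pq x <= 1 by move=> x; rewrite /pq; lra.
pose N (S : {set Y}) := [set y | [exists x in S, g x y]].
pose A (S w : {set Y}) := (S \subset w) && [disjoint N S :\: S & w].
(* If [S] left [S'], a path from [y0] inside [S] would enter the outer boundary of [S'], which [w]
   avoids although it contains [S]. *)
have uniqA w S S' : S \in An -> S' \in An -> A S w -> A S' w -> S \subset S'.
  rewrite !inE => /and3P[y0S /gconnP cS _] /and3P[y0S' _ _].
  move=> /andP[Sw _] /andP[_ dS'].
  apply/subsetP => y yS.
  apply: (connect_closed _ (cS _ _ y0S yS) y0S') => a b aS' /and3P[aS bS gab].
  apply/negPn/negP => bS'.
  have bN : b \in N S' :\: S' by rewrite !inE bS' /=; apply/exists_inP; exists a.
  by have := disjointFr dS' bN; rewrite (subsetP Sw).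
have sum1 : \sum_(S in An) Pr pq (A S) <= 1.
  rewrite -(PrT pq) /Pr (exchange_big_dep predT) //=.
  apply: ler_sum => w _.
  case: (pickP [pred S | (S \in An) && A S w]) => [S /= /andP[SAn AS]|no].
    rewrite (bigD1 S) /=; last by rewrite SAn.
    rewrite big1 ?addr0 // => S' /andP[/andP[S'An AS'] /negP[]].
    rewrite eqEsubset; apply/andP.
    by split; [apply: (uniqA w S' S)|apply: (uniqA w S S')].
  by rewrite big_pred0 ?wt_ge0 // => S; have := no S.
have bern m : 1 - m%:R * q <= (1 - q) ^+ m.
  elim: m => [|m IH]; first by rewrite mul0r subr0 expr0.
  rewrite exprS -natr1.
  apply: le_trans (_ : (1 - q) * (1 - m%:R * q) <= _); last first.
    by apply: ler_wpM2l => //; lra.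
  rewrite -subr_ge0.
  rewrite [X in 0 <= X](_ : _ = m%:R * q * q); last by ring.
  by rewrite !mulr_ge0 // ltW.
have lowA S : S \in An -> (4 * D)%:R ^- r <= Pr pq (A S).
  rewrite inE => /and3P[_ _ /eqP cS].
  rewrite /A Pr_cylinder; last first.
    by rewrite -setI_eq0 setIDA setIC setDIl setDv setI0.
  rewrite /pq !prodr_const cS.
  have NS : (#|N S :\: S| <= r * D)%N.
    apply: (leq_trans (subset_leq_card (subsetDl _ _))).
    have -> : N S = \bigcup_(x in S) [set y | g x y].
      apply/setP => y; rewrite inE; apply/exists_inP/bigcupP.
        by case=> x xS gxy; exists x; rewrite ?inE.
      by case=> x xS; rewrite inE => gxy; exists x.
    rewrite -cS -sum_nat_const.
    apply: (leq_trans (leq_card_bigcup _ _)); exact: leq_sum.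
  apply: le_trans (_ : q ^+ r * (1 - q) ^+ (r * D) <= _); last first.
    apply: ler_wpM2l; first by rewrite exprn_ge0 ?ltW.
    by apply: ler_wiXn2l => //; lra.
  rewrite [(r * D)%N]mulnC exprM -exprMn -exprVn; apply: lerXn2r.
  - by rewrite nnegrE invr_ge0.
  - rewrite nnegrE mulr_ge0 ?ltW // exprn_gt0 //; lra.
  have := bern D; rewrite mulrC q12 => bD.
  apply: le_trans (_ : q * (1 - 1 / 2%:R) <= _); last first.
    by apply: ler_wpM2l bD; apply: ltW.
  rewrite /q !natrM le_eqVlt; apply/orP; left; apply/eqP.
  by field; rewrite pnatr_eq0 -lt0n D0.
have : \sum_(S in An) (4 * D)%:R ^- r <= 1 :> F.
  by apply: le_trans sum1; apply: ler_sum.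
rewrite sumr_const -[X in X <= _]mulr_natl ler_pdivrMr ?mul1r ?exprn_gt0 ?ltr0n ?muln_gt0 //.
by rewrite -natrX ler_nat.
Qed.

End ConnectedSets.

Section Jigsaw.

Variables (T : finType) (H : double_graph T) (J : {set {set T}}).
Implicit Types (P Q : {set {set {set T}}}) (C D : {set {set T}}).

Definition corel (E : {set {set T}}) : rel {set T} :=
  fun a b => [exists e in E, a :|: b \subset e].

Lemma corel_sym E : symmetric (corel E).
Proof. by move=> a b; rewrite /corel; under eq_existsb do rewrite setUC. Qed.

Lemma linkedP E C C' :
  reflect (exists a b, [/\ a \in C, b \in C' & corel E a b]) (linked E C C').
Proof.
apply: (iffP exists_inP) => [[a aC /exists_inP[b bC' ab]]|[a [b [aC bC' ab]]]].
  by exists a, b.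
by exists a => //; apply/exists_inP; exists b.
Qed.

Lemma linked_sym (E : {set {set T}}) : symmetric (linked E).
Proof.
move=> C C'; apply/linkedP/linkedP => -[a [b [aC bC ab]]];
  by exists b, a; split=> //; rewrite corel_sym.
Qed.

Lemma linkedS E C C' D D' : C \subset D -> C' \subset D' ->
  linked E C C' -> linked E D D'.
Proof.
move=> /subsetP CD /subsetP CD' /linkedP[a [b [aC bC ab]]].
by apply/linkedP; exists a, b; split=> //; [apply: CD|apply: CD'].
Qed.

Lemma cluster_adj_sym P : symmetric (cluster_adj H P).
Proof.
move=> C C'; rewrite /cluster_adj linked_sym [linked H.2 _ _]linked_sym eq_sym.
by rewrite andbCA.
Qed.

Lemma partition_block (P : {set {set {set T}}}) D x : partition P D -> x \in D ->
  exists2 C, C \in P & x \in C.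
Proof.
move=> /and3P[/eqP cP _ _] xD; exists (pblock P x).
  by rewrite pblock_mem // cP.
by rewrite mem_pblock cP.
Qed.

Lemma partition_eq (P : {set {set {set T}}}) D C C' x : partition P D ->
  C \in P -> C' \in P -> x \in C -> x \in C' -> C = C'.
Proof.
move=> /and3P[_ tP _] CP C'P xC xC'.
by rewrite -(def_pblock tP CP xC) (def_pblock tP C'P xC').
Qed.

Lemma partition_sub (P : {set {set {set T}}}) D C : partition P D -> C \in P ->
  C \subset D.
Proof. by move=> /and3P[/eqP <- _ _] CP; apply: (bigcup_sup C). Qed.

Lemma jigsaw_step_partition P D : partition P D -> partition (jigsaw_step H P) D.
Proof.
move=> pP.
have sym := sym_connect_sym (cluster_adj_sym P).
pose comp C := cover [set C' in P | connect (cluster_adj H P) C C'].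
have memc C x : reflect (exists2 C', (C' \in P) && connect (cluster_adj H P) C C' & x \in C')
                        (x \in comp C).
  apply: (iffP bigcupP) => -[C' C'P xC']; exists C' => //.
    by move: C'P; rewrite inE.
  by rewrite inE.
apply/and3P; split.
- rewrite eqEsubset; apply/andP; split; apply/subsetP => x.
    case/bigcupP => _ /imsetP[C CP ->] /memc[C' /andP[C'P _] xC'].
    exact: (subsetP (partition_sub pP C'P)).
  move=> xD; have [C CP xC] := partition_block pP xD.
  apply/bigcupP; exists (comp C); first exact: imset_f.
  by apply/memc; exists C; rewrite ?CP ?connect0.
- apply/trivIsetP => _ _ /imsetP[C1 C1P ->] /imsetP[C2 C2P ->] /eqP neq.
  rewrite -setI_eq0; apply/eqP/setP => x; rewrite !inE.
  apply/negbTE/negP => /andP[/memc[C /andP[CP c1] xC] /memc[C' /andP[C'P c2] xC']].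
  have eC := partition_eq pP CP C'P xC xC'; subst C'; apply: neq.
  have c12 : connect (cluster_adj H P) C1 C2 by apply: (connect_trans c1); rewrite sym.
  congr (cover _); apply/setP => B; rewrite !inE; congr (_ && _).
  by rewrite (same_connect sym c12).
- apply/imsetP => -[C CP /esym/setP e0].
  have C0 : C != set0 by apply: contraTneq CP => ->; case/and3P: pP.
  case/set0Pn: C0 => x xC.
  have /memc : exists2 C', (C' \in P) && connect (cluster_adj H P) C C' & x \in C'.
    by exists C; rewrite ?CP ?connect0.
  by rewrite e0 inE.
Qed.

Lemma singletons_partition : partition [set [set A] | A in J] J.
Proof.
apply/and3P; split.
- rewrite eqEsubset; apply/andP; split; apply/subsetP => x.
    by case/bigcupP => _ /imsetP[A AJ ->] /set1P->.
  by move=> xJ; apply/bigcupP; exists [set x]; rewrite ?set11 ?imset_f.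
- apply/trivIsetP => _ _ /imsetP[A AJ ->] /imsetP[B BJ ->] neq.
  rewrite disjoints1 inE; apply: contraNneq neq => ->; exact: eqxx.
- by apply/imsetP => -[A _ /setP/(_ A)]; rewrite !inE eqxx.
Qed.

Lemma jigsaw_clusters_partition t : partition (jigsaw_clusters H J t) J.
Proof.
elim: t => [|t IH]; first exact: singletons_partition.
by rewrite /jigsaw_clusters iterS; apply: jigsaw_step_partition.
Qed.

(** Adjacent classes have the same component, so the map to components is not injective and every
    active step lowers the number of classes. *)
Lemma jigsaw_stops : exists t, jigsaw_stopped H (jigsaw_clusters H J t).
Proof.
rewrite /jigsaw_clusters; move: [set [set A] | A in J] => P.
have [m] := ubnP #|P|; elim: m P => // m IH P Pm.
case: (boolP (jigsaw_stopped H P)) => [st|]; first by exists 0%N.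
rewrite negb_forall => /existsP[C]; rewrite negb_forall => /existsP[C'].
rewrite negbK => adj.
suff lt : (#|jigsaw_step H P| < #|P|)%N.
  have [] := IH (jigsaw_step H P); first exact: leq_trans lt Pm.
  by move=> t st; exists t.+1; rewrite iterSr.
rewrite ltn_neqAle leq_imset_card andbT; apply/negP => /imset_injP inj.
have /and3P[CP C'P /andP[/negP[]]] := adj; apply/eqP; apply: inj => //.
congr (cover _); apply/setP => B; rewrite !inE; congr (_ && _).
by rewrite (same_connect (sym_connect_sym (cluster_adj_sym P)) (connect1 adj)).
Qed.

Lemma stopped_absorb P C x : partition P J -> jigsaw_stopped H P ->
  C \in P -> x \in J -> linked H.1 C [set x] -> linked H.2 C [set x] -> x \in C.
Proof.
move=> pP st CP xJ l1 l2; have [C' C'P xC'] := partition_block pP xJ.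
have sx : [set x] \subset C' by rewrite sub1set.
have /forallP/(_ C)/forallP/(_ C') := st.
rewrite /cluster_adj CP C'P (linkedS (subxx C) sx l1) (linkedS (subxx C) sx l2) /=.
by rewrite andbT negbK => /eqP->.
Qed.

(** Reduces percolation to a property of all stopped partitions, so that the supercritical part
    never follows the evolution in time. *)
Lemma percolatesI :
  (exists x, x \in J) ->
  (forall P C x, partition P J -> jigsaw_stopped H P -> C \in P -> x \in J -> x \in C) ->
  percolates H J.
Proof.
move=> [x xJ] all; have [t st] := jigsaw_stops; exists t; split=> //.
have pP := jigsaw_clusters_partition t.
have [C CP xC] := partition_block pP xJ.
suff -> : jigsaw_clusters H J t = [set C] by rewrite cards1.
apply/setP => C'; rewrite inE; apply/idP/eqP => [C'P|->//].
by apply: (partition_eq pP C'P CP _ xC); apply: (all _ _ _ pP).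
Qed.

(** Invariant: at every time each cluster lies inside a class of [Q], since a merger across two
    classes would make them adjacent. The final cluster [J] is then a class. *)
Lemma percolates_stopped Q : percolates H J -> partition Q J ->
  jigsaw_stopped H Q -> J \in Q.
Proof.
move=> [t [_ c1]] pQ stQ.
have pP := jigsaw_clusters_partition t.
have ref s : forall C, C \in jigsaw_clusters H J s -> exists2 A, A \in Q & C \subset A.
  elim: s => [|s IH] C.
    case/imsetP => x xJ ->; have [A AQ xA] := partition_block pQ xJ.
    by exists A; rewrite ?sub1set.
  rewrite /jigsaw_clusters iterS -/(jigsaw_clusters H J s).
  case/imsetP => C1 C1P ->; have [A AQ C1A] := IH _ C1P.
  exists A => //; apply/bigcupsP => C2; rewrite inE => /andP[_ c12].
  apply: (connect_closed (D := fun C => C \subset A) _ c12 C1A) => B B' BA.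
  move=> /and5P[BP B'P _ l1 l2].
  have [A' A'Q B'A'] := IH _ B'P.
  have /forallP/(_ A)/forallP/(_ A') := stQ.
  rewrite /cluster_adj AQ A'Q (linkedS BA B'A' l1) (linkedS BA B'A' l2) /=.
  by rewrite andbT negbK => /eqP->.
have /eqP/cards1P[C eC] := c1.
have CJ : C = J.
  by have /and3P[/eqP <- _ _] := pP; rewrite eC /cover big_set1.
have [|A AQ CA] := ref t C; first by rewrite eC set11.
suff <- : A = J by [].
by apply/eqP; rewrite eqEsubset (partition_sub pQ AQ) -CJ.
Qed.

Definition biconnected C := gconn (corel H.1) C && gconn (corel H.2) C.

Lemma biconnected_union C C' : biconnected C -> biconnected C' ->
  linked H.1 C C' -> linked H.2 C C' -> biconnected (C :|: C').
Proof.
move=> /andP[g1 g2] /andP[g1' g2'] /linkedP[a [b [aC bC' ab]]].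
move=> /linkedP[a' [b' [aC2 bC2 ab']]].
apply/andP; split; first exact: gconnU (@corel_sym _) g1 g1' aC bC' ab.
exact: gconnU (@corel_sym _) g2 g2' aC2 bC2 ab'.
Qed.

Lemma partition_merge (P : {set {set {set T}}}) D C C' : partition P D ->
  C \in P -> C' \in P -> C != C' ->
  partition ((C :|: C') |: (P :\ C :\ C')) D /\
  (#|(C :|: C') |: (P :\ C :\ C')| < #|P|)%N.
Proof.
move=> pP CP C'P neq; have /and3P[/eqP cP tP P0] := pP.
have /trivIsetP tI := tP.
split; last first.
  rewrite (cardsD1 C P) CP (cardsD1 C' (P :\ C)) in_setD1 eq_sym neq C'P /=.
  by rewrite add1n add1n ltnS cardsU1; case: (_ \notin _).
apply/and3P; split.
- rewrite -cP eqEsubset; apply/andP; split; apply/subsetP => x.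
    case/bigcupP => B /setU1P[->|/setD1P[_ /setD1P[_ BP]]] xB.
      by case/setUP: xB => xB; apply/bigcupP; [exists C|exists C'].
    by apply/bigcupP; exists B.
  case/bigcupP => B BP xB; apply/bigcupP.
  case: (eqVneq B C) => [e|nC]; first by exists (C :|: C'); rewrite ?setU11 // inE -e xB.
  case: (eqVneq B C') => [e|nC'].
    by exists (C :|: C'); rewrite ?setU11 // inE -e xB orbT.
  by exists B => //; rewrite !inE nC nC' BP orbT.
- have key B : B \in P :\ C :\ C' -> [disjoint C :|: C' & B].
    case/setD1P => BC' /setD1P[BC BP].
    rewrite -setI_eq0 setIUl setU_eq0 !setI_eq0.
    by rewrite !tI // eq_sym.
  apply/trivIsetP => A B /setU1P[->|AP] /setU1P[->|BP] // nAB.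
  + by rewrite eqxx in nAB.
  + exact: key.
  + by rewrite disjoint_sym; apply: key.
  + case/setD1P: AP => _ /setD1P[_ AP]; case/setD1P: BP => _ /setD1P[_ BP].
    exact: tI.
- rewrite !inE negb_or !negb_and P0 !orbT andbT eq_sym setU_eq0 negb_and.
  by apply/orP; left; apply: contraTneq CP => ->.
Qed.

(* The Aizenman-Lebowitz argument: a coarsest partition into small
   biconnected sets cannot be stable, so two of its classes merge into a set of
   size at least [L] and less than [2L]. *)
Lemma percolates_biconnected L : (1 < L)%N -> (L <= #|J|)%N -> percolates H J ->
  exists C, [/\ C \subset J, (L <= #|C|)%N, (#|C| < 2 * L)%N & biconnected C].
Proof.
move=> L1 LJ perc.
pose ok Q := partition Q J && [forall C in Q, biconnected C && (#|C| < L)%N].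
have ok0 : ok [set [set A] | A in J].
  rewrite /ok singletons_partition; apply/forall_inP => _ /imsetP[A AJ ->].
  by rewrite /biconnected !gconn1 cards1 L1.
pose Q := [arg min_(Q < [set [set A] | A in J] | ok Q) #|Q|].
have [okQ minQ] : ok Q /\ forall Q', ok Q' -> (#|Q| <= #|Q'|)%N.
  by rewrite /Q; case: arg_minnP.
have /andP[pQ /forall_inP goodQ] := okQ.
case: (boolP (jigsaw_stopped H Q)) => [st|].
  have JQ := percolates_stopped perc pQ st.
  by have /andP[_] := goodQ _ JQ; rewrite ltnNge LJ.
rewrite negb_forall => /existsP[C]; rewrite negb_forall => /existsP[C'].
rewrite negbK => /and5P[CQ C'Q neq l1 l2].
have /andP[gC CL] := goodQ _ CQ; have /andP[gC' C'L] := goodQ _ C'Q.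
have gU := biconnected_union gC gC' l1 l2.
exists (C :|: C'); split=> //.
- by rewrite subUset !(partition_sub pQ).
- rewrite leqNgt; apply/negP => UL.
  have [pM cM] := partition_merge pQ CQ C'Q neq.
  have := minQ ((C :|: C') |: (Q :\ C :\ C')); rewrite leqNgt cM => /(_ _)/negP; apply=> //.
  apply/andP; split=> //; apply/forall_inP => B /setU1P[->|]; first by rewrite gU UL.
  by case/setD1P => _ /setD1P[_ BQ]; apply: goodQ.
- apply: leq_ltn_trans (leq_card_setU C C') _.
  by rewrite mul2n -addnn -addSn leq_add // ltnW.
Qed.

(** Exploring [C] one element at a time costs at most one edge per new element. The new edge
    contains an element [a] already reached, which lies in an earlier edge as well, so [S] stays
    connected for [g]. *)
Lemma gconn_skeleton (E : {set {set T}}) (g : rel {set T}) C :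
  symmetric g ->
  (forall e e' x, e \in E -> e' \in E -> x \in C -> x \subset e -> x \subset e' -> g e e') ->
  gconn (corel E) C -> (1 < #|C|)%N ->
  exists S : {set {set T}},
    [/\ S \subset E, (#|S| < #|C|)%N, gconn g S,
      forall e, e \in S -> exists x y, [/\ x \in C, y \in C, x != y & x :|: y \subset e] &
      forall x, x \in C -> exists2 e, e \in S & x \subset e].
Proof.
move=> gs Hg /gconnP cC C1.
pose two (e : {set T}) := exists x y, [/\ x \in C, y \in C, x != y & x :|: y \subset e].
have /card_gt0P[x0 x0C] : (0 < #|C|)%N by apply: leq_trans C1.
(* The alternative [D = [set x]] covers the start, when no edge has been chosen; it is excluded at
   the end by [1 < #|C|]. *)
suff grow m : (0 < m <= #|C|)%N -> exists D S : {set {set T}},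
    [/\ D \subset C, #|D| = m, S \subset E, (#|S| < m)%N &
      [/\ gconn g S, forall e, e \in S -> two e &
      forall x, x \in D -> D = [set x] \/ exists2 e, e \in S & x \subset e]].
  have [|D [S [DC cD SE cS [gS tS cov]]]] := grow #|C|.
    by rewrite leqnn andbT; apply: leq_trans C1.
  have DCe : D = C by apply/eqP; rewrite eqEcard DC cD leqnn.
  subst D; exists S; split=> // x xC; case: (cov x xC) => // e.
  by rewrite e cards1 in C1.
elim: m => // m IH /andP[_ mC].
case: m IH mC => [_ _|m IH mC].
  exists [set x0], set0; rewrite sub1set x0C cards1 sub0set cards0; split=> //.
  split=> [|e|x /set1P->]; [|by rewrite inE|by left].
  by apply/gconnP => x y; rewrite inE.
have [|D [S [DC cD SE cS [gS tS cov]]]] := IH; first by rewrite /= ltnW.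
have /card_gt0P[d dD] : (0 < #|D|)%N by rewrite cD.
have /subsetPn[y yC yD] : ~~ (C \subset D).
  by apply/negP => /subset_leq_card; rewrite cD leqNgt mC.
have [a [b [aD bD /and3P[aC bC /exists_inP[e eE abe]]]]] :=
  connect_crossing (cC d y (subsetP DC d dD) yC) (D := mem D) dD yD.
have ae : a \subset e by apply: subset_trans abe; apply: subsetUl.
have be : b \subset e by apply: subset_trans abe; apply: subsetUr.
have ab : a != b by apply: contraTneq aD => ->.
exists (b |: D), (e |: S); split.
- by rewrite subUset sub1set bC DC.
- by rewrite cardsU1 bD cD.
- by rewrite subUset sub1set eE SE.
- by rewrite cardsU1 ltnS; case: (_ \notin _) => //; apply: ltnW.
split.
- case: (cov a aD) => [Da|[e' e'S ae']].
    have S0 : S = set0.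
      by apply/eqP; rewrite -cards_eq0; move: cS; rewrite -cD Da cards1; case: #|S|.
    by rewrite S0 setU0 gconn1.
  apply: (gconnU gs (gconn1 g e) gS (set11 e) e'S).
  by apply: (Hg _ _ a) => //; apply: (subsetP SE).
- by move=> f /setU1P[->|/tS //]; exists a, b.
- move=> x /setU1P[->|xD]; right; first by exists e; rewrite ?setU11.
  case: (cov x xD) => [Dx|[f fS xf]]; last by exists f; rewrite ?setU1r.
  exists e; first by rewrite setU11.
  by move: aD; rewrite Dx => /set1P <-.
Qed.

End Jigsaw.

(** * Counting edges and skeletons *)

Lemma bin_leq_exp n m : ('C(n, m) * m`! <= n ^ m)%N.
Proof.
rewrite bin_ffact; elim: m n => [|m IH] [|n] //; rewrite ffactSS expnS leq_mul2l /=.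
by apply: leq_trans (IH n) _; case: m {IH} => // m; rewrite leq_exp2r.
Qed.

Lemma ffact_geq_exp n m : ((n - m) ^ m <= n ^_ m)%N.
Proof.
elim: m => [|m IH] //; rewrite ffactnSr expnSr; apply: leq_mul; last by rewrite leq_sub2l.
case: m IH => // m IH; apply: leq_trans IH; rewrite leq_exp2r //; exact: leq_sub2l.
Qed.

(** A substitute for Stirling: [m ^ m] is at most the falling factorial of [2m] of length [m], which
    is ['C(2m, m) * m!], and ['C(2m, m) <= 4 ^ m]. *)
Lemma exp_leq_fact m : (m ^ m <= 4 ^ m * m`!)%N.
Proof.
have h1 : ('C(m + m, m) <= 4 ^ m)%N.
  apply: (@leq_trans (\sum_(i < (m + m).+1) 'C(m + m, i))%N).
    by rewrite (bigD1 (inord m)) //= inordK ?leq_addr // ltnS leq_addr.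
  have := expnDn 1 1 (m + m); under eq_bigr do rewrite !exp1n !muln1.
  by move=> <-; rewrite [(m + m)%N]addnn -mul2n expnM.
apply: leq_trans (_ : 'C(m + m, m) * m`! <= _)%N; last by rewrite leq_mul2r h1 orbT.
by rewrite bin_ffact -{1}(addnK m m) ffact_geq_exp.
Qed.

Lemma bin_geq_exp n m : (2 * m <= n)%N -> (n ^ m <= 'C(n, m) * (2 ^ m * m`!))%N.
Proof.
move=> mn; rewrite mulnCA bin_ffact.
apply: leq_trans (_ : 2 ^ m * (n - m) ^ m <= _)%N; last by rewrite leq_mul2l ffact_geq_exp orbT.
case: m mn => // m mn; rewrite -expnMn leq_exp2r //.
rewrite mulnBr leq_subRL ?leq_mul2l /=; lia.
Qed.

Section Counting.

Variables (n : nat).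
Local Notation T := 'I_n.
Hypothesis n0 : (0 < n)%N.

Lemma card_supersets (F : {set T}) k f : (f <= #|F|)%N ->
  (#|[set e : {set T} | (F \subset e) && (#|e| == k)]| <= n ^ (k - f))%N.
Proof.
move=> fF; case: (leqP #|F| k) => Fk; last first.
  rewrite (_ : [set _ | _] = set0) ?cards0 //.
  apply/setP => e; rewrite !inE; apply/negP => /andP[/subset_leq_card + /eqP ek].
  by rewrite ek leqNgt Fk.
apply: (@leq_trans (n ^ (k - #|F|))); last by rewrite leq_pexp2l // leq_sub2l.
apply: (@leq_trans #|[set F :|: A | A in [set A : {set T} | #|A| == k - #|F|]]|%N).
  apply: subset_leq_card; apply/subsetP => e; rewrite inE => /andP[Fe /eqP ek].
  apply/imsetP; exists (e :\: F).
    by rewrite inE cardsD (setIidPr Fe) ek.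
  by rewrite -{1}(setID e F) (setIidPr Fe).
apply: (leq_trans (leq_imset_card _ _)); rewrite card_draws card_ord.
apply: leq_trans (bin_leq_exp _ _); exact/leq_pmulr/fact_gt0.
Qed.

(** The sizes belong to the relation so that its degree is bounded at every vertex set, as
    [card_gconn_le] requires. *)
Definition jrel (k j : nat) : rel {set T} :=
  fun e e' => [&& #|e| == k, #|e'| == k & (j <= #|e :&: e'|)%N].

Lemma jrel_sym k j : symmetric (jrel k j).
Proof. by move=> e e'; rewrite /jrel setIC andbCA. Qed.

Lemma jrel_degree k j e :
  (#|[set e' | jrel k j e e']| <= 'C(k, j) * n ^ (k - j))%N.
Proof.
case: (eqVneq #|e| k) => ek; last first.
  by rewrite (_ : [set _ | _] = set0) ?cards0 //; apply/setP => e'; rewrite !inE /jrel (negbTE ek).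
apply: (@leq_trans #|\bigcup_(F in [set F : {set T} | (F \subset e) && (#|F| == j)])
                       [set e' : {set T} | (F \subset e') && (#|e'| == k)]|%N).
  apply: subset_leq_card; apply/subsetP => e'; rewrite inE /jrel => /and3P[_ e'k je].
  have [F] : exists F : {set T}, (F \subset e :&: e') && (#|F| == j).
    have : (0 < #|[set F : {set T} | F \subset e :&: e' & #|F| == j]|)%N.
      by rewrite cards_draws bin_gt0.
    by case/card_gt0P => F; rewrite inE; exists F.
  case/andP => /subsetIP[Fe Fe'] Fj; apply/bigcupP; exists F; first by rewrite inE Fe.
  by rewrite inE Fe'.
apply: (leq_trans (leq_card_bigcup _ _)).
apply: (@leq_trans (\sum_(F in [set F : {set T} | (F \subset e) && (#|F| == j)]) n ^ (k - j))%N).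
  by apply: leq_sum => F; rewrite inE => /andP[_ /eqP Fj]; apply: card_supersets; rewrite Fj.
by rewrite sum_nat_const cards_draws ek.
Qed.

Definition covered j (S : {set {set T}}) : {set {set T}} :=
  [set x : {set T} | (#|x| == j) && [exists e in S, x \subset e]].

Lemma card_covered k j (S : {set {set T}}) : (forall e, e \in S -> #|e| = k) ->
  (#|covered j S| <= #|S| * 'C(k, j))%N.
Proof.
move=> Sk.
apply: (@leq_trans #|\bigcup_(e in S) [set x : {set T} | (x \subset e) && (#|x| == j)]|%N).
  apply: subset_leq_card; apply/subsetP => x; rewrite inE => /andP[xj /exists_inP[e eS xe]].
  by apply/bigcupP; exists e => //; rewrite inE xe.
apply: (leq_trans (leq_card_bigcup _ _)); rewrite -sum_nat_const.
by apply: leq_sum => e eS; rewrite cards_draws Sk.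
Qed.

Definition pair_edges k (C : {set {set T}}) : {set {set T}} :=
  [set e : {set T} | (#|e| == k) &&
     [exists x in C, exists y in C, (x != y) && (x :|: y \subset e)]].

(** Two distinct [j]-sets have at least [j + 1] elements together, which leaves at most [k - j - 1]
    vertices of the edge free. *)
Lemma card_pair_edges k j (C : {set {set T}}) : (forall x, x \in C -> #|x| = j) ->
  (#|pair_edges k C| <= #|C| ^ 2 * n ^ (k - j.+1))%N.
Proof.
move=> Cj.
apply: (@leq_trans #|\bigcup_(u in [set u : {set T} * {set T} | [&& u.1 \in C, u.2 \in C & u.1 != u.2]])
                       [set e : {set T} | (u.1 :|: u.2 \subset e) && (#|e| == k)]|%N).
  apply: subset_leq_card; apply/subsetP => e; rewrite inE.
  move=> /andP[ek /exists_inP[x xC /exists_inP[y yC /andP[xy xye]]]].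
  by apply/bigcupP; exists (x, y); rewrite inE /= ?xC ?yC // xye.
apply: (leq_trans (leq_card_bigcup _ _)).
apply: (@leq_trans (\sum_(u in [set u : {set T} * {set T} | [&& u.1 \in C, u.2 \in C & u.1 != u.2]]) n ^ (k - j.+1))%N).
  apply: leq_sum => -[x y]; rewrite inE /= => /and3P[xC yC xy]; apply: card_supersets.
  rewrite ltnNge; apply: contra xy => le.
  have xE : x = x :|: y by apply/eqP; rewrite eqEcard subsetUl (Cj x xC).
  have yE : y = x :|: y by apply/eqP; rewrite eqEcard subsetUr (Cj y yC).
  by rewrite xE {2}yE.
rewrite sum_nat_const leq_mul2r -mulnn -cardsX; apply/orP; right.
by apply: subset_leq_card; apply/subsetP => -[x y]; rewrite !inE /= => /and3P[-> ->].
Qed.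

Lemma card_animals k j r : (j <= k)%N -> (0 < r)%N ->
  (#|[set S : {set {set T}} | [&& [forall e in S, #|e| == k], gconn (jrel k j) S & #|S| == r]]|
   <= n ^ k * (4 * ('C(k, j) * n ^ (k - j))) ^ r)%N.
Proof.
move=> jk r0.
pose An e0 := [set S : {set {set T}} | [&& e0 \in S, gconn (jrel k j) S & #|S| == r]].
apply: (@leq_trans #|\bigcup_(e0 in [set e : {set T} | #|e| == k]) An e0|%N).
  apply: subset_leq_card; apply/subsetP => S; rewrite inE => /and3P[/forall_inP Sk gS Sr].
  have /card_gt0P[e0 e0S] : (0 < #|S|)%N by rewrite (eqP Sr).
  by apply/bigcupP; exists e0; rewrite inE ?Sk // e0S gS.
apply: (leq_trans (leq_card_bigcup _ _)).
apply: (@leq_trans (\sum_(e0 in [set e : {set T} | #|e| == k]) (4 * ('C(k, j) * n ^ (k - j))) ^ r)%N).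
  apply: leq_sum => e0 _; apply: card_gconn_le; last by move=> e; apply: jrel_degree.
  by rewrite muln_gt0 bin_gt0 jk expn_gt0 n0.
rewrite sum_nat_const leq_mul2r card_draws card_ord; apply/orP; right.
apply: leq_trans (bin_leq_exp _ _); exact/leq_pmulr/fact_gt0.
Qed.

End Counting.

(** * The random double graph as a product measure *)

Section RandomGraph.

Variables (R : realType) (n k : nat) (p1 p2 : R).
Local Notation T := 'I_n.
Local Notation X := (bool * {set T})%type.

Definition graph_of (w : {set X}) : double_graph T :=
  ([set e | (true, e) \in w], [set e | (false, e) \in w]).

(** The coordinates are all coloured vertex sets; those of the wrong size get probability 0, which
    avoids a subtype of [k]-sets. *)
Definition edge_prob (x : X) : R :=
  if #|x.2| == k then (if x.1 then p1 else p2) else 0.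

Definition kset_coords (w : {set X}) : bool := [forall x in w, #|x.2| == k].

Lemma edge_prob01 : 0 <= p1 <= 1 -> 0 <= p2 <= 1 -> forall x, 0 <= edge_prob x <= 1.
Proof.
move=> h1 h2 [b e]; rewrite /edge_prob /=; case: eqP => _; last by rewrite lexx ler01.
by case: b.
Qed.

Lemma wt_kset_coords w : ~~ kset_coords w -> wt edge_prob w = 0.
Proof.
rewrite negb_forall => /existsP[x]; rewrite negb_imply => /andP[xw xk].
by rewrite /wt (bigD1 x) //= xw /edge_prob (negbTE xk) mul0r.
Qed.

Lemma Pr_kset_coords A : Pr edge_prob A = Pr edge_prob (fun w => A w && kset_coords w).
Proof.
rewrite (Pr_split _ A kset_coords) [X in _ + X]big1 ?addr0 // => w /andP[_].
exact: wt_kset_coords.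
Qed.

Lemma graph_of_kgraphs w : (graph_of w \in double_kgraphs T k) = kset_coords w.
Proof.
rewrite inE; apply/andP/forall_inP => [[/subsetP h1 /subsetP h2] [[] e] xw /=|h].
- by have := h1 e; rewrite !inE; apply.
- by have := h2 e; rewrite !inE; apply.
by split; apply/subsetP => e; rewrite !inE => /h.
Qed.

Lemma wt_graph_of w : kset_coords w ->
  wt edge_prob w = binomial_weight k p1 (graph_of w).1 * binomial_weight k p2 (graph_of w).2.
Proof.
move=> kw; rewrite /wt /binomial_weight.
rewrite (eq_bigr (fun x : X => (fun b e => if (b, e) \in w then edge_prob (b, e)
                                else 1 - edge_prob (b, e)) x.1 x.2)); last by case.
rewrite -(pair_bigA _ (fun b e => if (b, e) \in w then edge_prob (b, e)
                                else 1 - edge_prob (b, e))) /= big_bool /=.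
have key b : \prod_e (if (b, e) \in w then edge_prob (b, e) else 1 - edge_prob (b, e)) =
    \prod_(e in subsets_of_card T k)
       (if (b, e) \in w then (if b then p1 else p2) else 1 - (if b then p1 else p2)).
  rewrite [LHS](bigID (fun e => e \in subsets_of_card T k)) /= [X in _ * X]big1 ?mulr1.
    by apply: eq_bigr => e; rewrite inE /edge_prob /= => ->.
  move=> e; rewrite inE /edge_prob /= => ek; rewrite (negbTE ek) subr0.
  by case: ifP => // ew; have /forall_inP/(_ _ ew) := kw; rewrite (negbTE ek).
by rewrite !key; congr (_ * _); apply: eq_bigr => e _; rewrite inE.
Qed.

Lemma Pr_HE (A : double_graph T -> Prop) :
  Pr_H k p1 p2 A = Pr edge_prob (fun w => `[< A (graph_of w) >]).
Proof.
pose f (H : double_graph T) : {set X} :=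
  [set x : X | if x.1 then x.2 \in H.1 else x.2 \in H.2].
have fK : cancel f graph_of.
  by move=> [E1 E2]; congr (_, _); apply/setP => e; rewrite !inE.
have gK : cancel graph_of f by move=> w; apply/setP => -[[] e]; rewrite !inE.
rewrite Pr_kset_coords /Pr /Pr_H (reindex graph_of); last first.
  by apply: onW_bij; exists f.
apply: eq_big => [w|w]; first by rewrite graph_of_kgraphs andbC.
by rewrite graph_of_kgraphs => /andP[kw _]; rewrite wt_graph_of.
Qed.

End RandomGraph.

(** * Expected number of skeletons *)

Lemma Pr_many (R : realFieldType) (X : finType) (p : X -> R) (q : R) (B : {set X}) (m : nat) :
  (forall x, 0 <= p x <= 1) -> (forall x, x \in B -> p x <= q) ->
  Pr p (fun w => (m <= #|B :&: w|)%N) <= 'C(#|B|, m)%:R * q ^+ m.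
Proof.
move=> p01 pq.
apply: le_trans (_ : \sum_(S : {set X} | (S \subset B) && (#|S| == m)) q ^+ m <= _); last first.
  rewrite sumr_const -[X in X <= _]mulr_natl (eq_card (B := [set S : {set X} | S \subset B & #|S| == m])).
    by rewrite cards_draws.
  by move=> S; rewrite !inE.
apply: le_trans (_ : \sum_(S : {set X} | (S \subset B) && (#|S| == m))
                        Pr p (fun w => S \subset w) <= _); last first.
  apply: ler_sum => S /andP[/subsetP SB /eqP <-]; rewrite Pr_subset -prodr_const.
  by apply: ler_prod => x xS; have /andP[-> _] := p01 x; rewrite pq ?SB.
apply: le_trans (Pr_bigU p01 _ _); apply: le_Pr => // w mw; apply/existsP.
have : (0 < #|[set S : {set X} | S \subset B :&: w & #|S| == m]|)%N.
  by rewrite cards_draws bin_gt0.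
case/card_gt0P => S; rewrite inE => /andP[/subsetIP[SB Sw] Sm].
by exists S; rewrite SB Sm.
Qed.

(** The usual [(e N / m) ^ m] with 4 in place of [e]. *)
Lemma bin_le_pow (R : realFieldType) (N m : nat) : (0 < m)%N ->
  'C(N, m)%:R <= (4%:R * N%:R / m%:R) ^+ m :> R.
Proof.
move=> m0; rewrite expr_div_n ler_pdivlMr ?exprn_gt0 ?ltr0n //.
rewrite -natrX -!natrM -natrX ler_nat expnMn.
apply: leq_trans (_ : 'C(N, m) * (4 ^ m * m`!) <= _)%N.
  by rewrite leq_mul2l exp_leq_fact orbT.
by rewrite mulnCA leq_mul2l bin_leq_exp orbT.
Qed.

(** The exponent counts the free vertices of an edge through one given [j]-set, plus those of an
    edge through two given ones. *)
Lemma exponent_split k j : (j < k)%N -> (2 * k - 2 * j - 1)%N = ((k - j) + (k - j.+1))%N.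
Proof. lia. Qed.

Section LowerBound.

Variables (R : realType) (n k j : nat) (p1 p2 : R).
Local Notation T := 'I_n.
Local Notation X := (bool * {set T})%type.
Local Notation K := ('C(k, j)).
Local Notation ep := (@edge_prob R n k p1 p2).
Hypotheses (n0 : (0 < n)%N) (jk : (j < k)%N).
Hypotheses (p1_01 : 0 <= p1 <= 1) (p2_01 : 0 <= p2 <= 1).

Definition pcol (b : bool) : R := if b then p1 else p2.

Definition col (b : bool) (S : {set {set T}}) : {set X} := [set (b, e) | e in S].

Lemma mem_col b S b' e : ((b', e) \in col b S) = (b' == b) && (e \in S).
Proof.
apply/imsetP/andP => [[f fS [-> ->]]|[/eqP-> eS]]; first by rewrite eqxx.
by exists e.
Qed.

Lemma card_col b S : #|col b S| = #|S|.
Proof. by rewrite card_imset // => e e' []. Qed.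

Lemma pcol01 b : 0 <= pcol b <= 1.
Proof. by case: b. Qed.

Lemma prod_col b (S : {set {set T}}) : (forall e, e \in S -> #|e| = k) ->
  \prod_(x in col b S) ep x = pcol b ^+ #|S|.
Proof.
move=> Sk; rewrite -(card_col b) -prodr_const; apply: eq_bigr => -[b' e].
by rewrite mem_col => /andP[/eqP-> eS]; rewrite /edge_prob /= Sk // eqxx.
Qed.

Lemma Pr_two_colors b (S1 S2 : {set {set T}}) :
  (forall e, e \in S1 -> #|e| = k) -> (forall e, e \in S2 -> #|e| = k) ->
  Pr ep (fun w => (col b S1 \subset w) && (col (~~ b) S2 \subset w)) =
  pcol b ^+ #|S1| * pcol (~~ b) ^+ #|S2|.
Proof.
move=> S1k S2k.
rewrite (eq_Pr _ (B := fun w => col b S1 :|: col (~~ b) S2 \subset w)); last first.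
  by move=> w; rewrite subUset.
rewrite Pr_subset -(prod_col b S1k) -(prod_col (~~ b) S2k) -bigU /=.
  by apply: eq_bigl => x; rewrite !inE.
rewrite -setI_eq0; apply/eqP/setP => -[b' e]; rewrite !inE !mem_col.
by case: b b' => -[]; rewrite /= ?andbF.
Qed.

(* [S1] has the colour [b] of the smaller of the two skeletons of [C]. *)
Definition skeleton_event (b : bool) (l r s : nat) (w : {set X}) : bool :=
  [exists S1 : {set {set T}},
     [&& [forall e in S1, #|e| == k], gconn (jrel k j) S1 & #|S1| == r] &&
  [exists C : {set {set T}}, (C \subset covered j S1) && (#|C| == l) &&
  [exists S2 : {set {set T}}, (S2 \subset pair_edges k C) && (#|S2| == s) &&
     ((col b S1 \subset w) && (col (~~ b) S2 \subset w))]]].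

(** Nested union bounds: the factors count the connected sets [S1], the subsets [C] of the at most
    [r * K] sets covered by [S1], and the sets [S2]; the last factor is the probability of one such
    pair. *)
Lemma Pr_skeleton_event b l r s : (0 < r)%N ->
  Pr ep (skeleton_event b l r s) <=
  (n ^ k * (4 * (K * n ^ (k - j))) ^ r)%:R * (2 ^ (r * K))%:R *
  'C(l ^ 2 * n ^ (k - j.+1), s)%:R * (pcol b ^+ r * pcol (~~ b) ^+ s).
Proof.
move=> r0; have e01 := @edge_prob01 R n k p1 p2 p1_01 p2_01.
have sum_le (I : finType) (P : pred I) (F : I -> R) (m : nat) (q : R) :
    0 <= q -> (#|[set i | P i]| <= m)%N -> (forall i, P i -> F i <= q) ->
    \sum_(i | P i) F i <= m%:R * q.
  move=> q0 Pm Fq; apply: le_trans (_ : \sum_(i | P i) q <= _); first exact: ler_sum.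
  rewrite sumr_const -[X in X <= _]mulr_natl ler_wpM2r // ler_nat.
  by rewrite cardsE in Pm.
have q0 : 0 <= pcol b ^+ r * pcol (~~ b) ^+ s.
  by rewrite mulr_ge0 // exprn_ge0 //; case/andP: (pcol01 b); case/andP: (pcol01 (~~ b)).
apply: le_trans (Pr_bigU e01 _ _) _.
rewrite -!mulrA; apply: (sum_le _); first by do 2 apply: mulr_ge0 => //.
  by apply: card_animals => //; apply: ltnW.
move=> S1 /and3P[/forall_inP S1k _ /eqP S1r].
have S1k' e : e \in S1 -> #|e| = k by move=> /S1k/eqP.
apply: le_trans (Pr_bigU e01 _ _) _.
apply: (sum_le _); first by apply: mulr_ge0.
  apply: (@leq_trans #|powerset (covered j S1)|).
    by apply: subset_leq_card; apply/subsetP => C; rewrite !inE => /andP[].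
  by rewrite card_powerset leq_pexp2l // -S1r card_covered.
move=> C /andP[/subsetP CS /eqP Cl].
apply: le_trans (Pr_bigU e01 _ _) _.
apply: (sum_le _) => //.
  rewrite cards_draws leq_bin2l // -Cl; apply: card_pair_edges => //.
  by move=> x /CS; rewrite inE => /andP[/eqP].
move=> S2 /andP[/subsetP S2C /eqP S2s].
rewrite Pr_two_colors ?S1r ?S2s //.
by move=> e /S2C; rewrite inE => /andP[/eqP].
Qed.

(** Both colours have a skeleton on the same [C], and [b] is the colour of the smaller one. Its
    edges cover [C], whence [l <= r * K]; this forces [r] to be of order [L]. *)
Lemma percolates_skeleton (L : nat) w : (1 < L)%N -> (L <= 'C(n, j))%N ->
  kset_coords k w -> j_percolates j (graph_of w) ->
  exists b l r s, [/\ (L <= l < 2 * L)%N, (r <= s < 2 * L)%N, (l <= r * K)%N &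
                      skeleton_event b l r s w].
Proof.
move=> L1 LJ /forall_inP kw perc.
have [|C [CJ LC CL /andP[gC1 gC2]]] := percolates_biconnected L1 _ perc.
  by rewrite card_draws card_ord.
have Cj x : x \in C -> #|x| = j by move=> /(subsetP CJ); rewrite inE => /eqP.
have C1 : (1 < #|C|)%N by apply: leq_trans LC.
have skel b (E : {set {set T}}) : (forall e, (e \in E) = ((b, e) \in w)) ->
    gconn (corel E) C -> exists S : {set {set T}},
    [/\ [/\ [forall e in S, #|e| == k], gconn (jrel k j) S & (#|S| < #|C|)%N],
        C \subset covered j S, S \subset pair_edges k C & col b S \subset w].
  move=> Ew gC.
  have Ek e : e \in E -> #|e| = k by rewrite Ew => /kw /eqP.
  have [||S [SE SC gS tS cS]] := gconn_skeleton (g := jrel k j) _ _ gC C1.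
  - exact: jrel_sym.
  - move=> e e' x eE e'E xC xe xe'; rewrite /jrel (Ek e) // (Ek e') // eqxx /=.
    apply: leq_trans (_ : #|x| <= _)%N; first by rewrite Cj.
    by apply: subset_leq_card; rewrite subsetI xe.
  have Sk e : e \in S -> #|e| == k by move=> /(subsetP SE)/Ek/eqP.
  exists S; split; [split=> //; exact/forall_inP| | |].
  - apply/subsetP => x xC; rewrite inE Cj // eqxx /=.
    by have [e eS xe] := cS x xC; apply/exists_inP; exists e.
  - apply/subsetP => e eS; rewrite inE Sk //=.
    have [x [y [xC yC xy xye]]] := tS e eS.
    by apply/exists_inP; exists x => //; apply/exists_inP; exists y; rewrite // xy.
  - apply/subsetP => _ /imsetP[e eS ->]; rewrite -Ew; exact: (subsetP SE).
have [|S1 [[S1k gS1 cS1] CS1 S1C S1w]] := skel true _ _ gC1; first by move=> e; rewrite inE.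
have [|S2 [[S2k gS2 cS2] CS2 S2C S2w]] := skel false _ _ gC2; first by move=> e; rewrite inE.
have ub (S : {set {set T}}) : [forall e in S, #|e| == k] -> C \subset covered j S ->
    (#|C| <= #|S| * K)%N.
  move=> /forall_inP Sk /subset_leq_card /leq_trans; apply; apply: card_covered.
  by move=> e /Sk/eqP.
case: (leqP #|S1| #|S2|) => le12.
  exists true, #|C|, #|S1|, #|S2|; split; rewrite ?LC ?CL ?le12 ?ub //=.
    exact: ltn_trans cS2 CL.
  apply/existsP; exists S1; rewrite S1k gS1 eqxx /=.
  apply/existsP; exists C; rewrite CS1 eqxx /=.
  by apply/existsP; exists S2; rewrite S2C eqxx S1w S2w.
exists false, #|C|, #|S2|, #|S1|; split; rewrite ?LC ?CL ?(ltnW le12) ?ub //=.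
  exact: ltn_trans cS1 CL.
apply/existsP; exists S2; rewrite S2k gS2 eqxx /=.
apply/existsP; exists C; rewrite CS2 eqxx /=.
by apply/existsP; exists S1; rewrite S1C eqxx S1w S2w.
Qed.

(** The first numerical hypothesis makes the factor per edge of [S2] at most 1, so that the exponent
    [s] may be lowered to [r]; the second bounds the product of the two factors, and [r * K >= L]
    ends the estimate. The prefactor counts the choices of [b], [l], [r] and [s]. *)
Lemma Pr_percolates_sparse (L : nat) (a : R) : (1 < L)%N -> (L <= 'C(n, j))%N ->
  (forall b, (8 * L * K)%:R * n%:R ^+ (k - j.+1) * pcol b <= 1) ->
  (32 * K ^ 2 * 2 ^ K * L)%:R * n%:R ^+ (2 * k - 2 * j - 1) * (p1 * p2)
     <= expR (- (K%:R * a)) ->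
  0 <= a ->
  Pr ep (fun w : {set X} => `[< j_percolates j (graph_of w) >]) <=
  (2 * (2 * L) ^ 3)%:R * (n%:R ^+ k * expR (- (a * L%:R))).
Proof.
move=> L1 LJ Y1 Z a0; have e01 := @edge_prob01 R n k p1 p2 p1_01 p2_01.
rewrite Pr_kset_coords.
pose I := (bool * ('I_(2 * L) * ('I_(2 * L) * 'I_(2 * L))))%type.
pose Pc (i : I) := [&& (L <= i.2.1)%N, (i.2.2.1 <= i.2.2.2)%N & (i.2.1 <= i.2.2.1 * K)%N].
pose A (i : I) := skeleton_event i.1 i.2.1 i.2.2.1 i.2.2.2.
apply: le_trans (_ : Pr ep (fun w => [exists i, Pc i && A i w]) <= _).
  apply: le_Pr => // w /andP[/asboolP perc kw].
  have [b [l [r [s [/andP[Ll lL] /andP[rs sL] lr ev]]]]] := percolates_skeleton L1 LJ kw perc.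
  apply/existsP; exists (b, (Ordinal lL, (Ordinal (leq_ltn_trans rs sL), Ordinal sL))).
  by rewrite /Pc /A /= Ll rs lr.
apply: le_trans (Pr_bigU e01 _ _) _.
have K0 : (0 < K)%N by rewrite bin_gt0 ltnW.
apply: le_trans (_ : \sum_(i | Pc i) (n%:R ^+ k * expR (- (a * L%:R))) <= _); last first.
  rewrite sumr_const -[X in X <= _]mulr_natl ler_wpM2r ?mulr_ge0 ?exprn_ge0 ?expR_ge0 //.
  rewrite ler_nat; apply: leq_trans (max_card _) _.
  by rewrite !card_prod card_bool !card_ord !expnS expn0 muln1.
apply: ler_sum => -[b [l [r s]]] /and3P[/= Ll rs lrK].
have r0 : (0 < r)%N.
  rewrite lt0n; apply/negP => /eqP r00; move: lrK; rewrite r00 mul0n leqNgt => /negP; apply.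
  by apply: leq_trans Ll; apply: ltnW.
apply: le_trans (Pr_skeleton_event b l s r0) _.
have s0 : (0 < s)%N := leq_trans r0 rs.
have pb0 : 0 <= pcol b by case/andP: (pcol01 b).
have pb0' : 0 <= pcol (~~ b) by case/andP: (pcol01 (~~ b)).
(* [x] collects all that is raised to the power [r], namely [S1] and [C]; [y] bounds what is raised
   to [s]. Its constant comes from [4 l ^ 2 / s] with [l < 2L] and [l <= s K]. *)
pose x := (4 * K * 2 ^ K)%:R * n%:R ^+ (k - j) * pcol b.
pose y := (8 * L * K)%:R * n%:R ^+ (k - j.+1) * pcol (~~ b).
have x0 : 0 <= x by rewrite !mulr_ge0 ?exprn_ge0 ?ler0n.
have y0 : 0 <= y by rewrite !mulr_ge0 ?exprn_ge0 ?ler0n.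
have y1 : y <= 1 by apply: Y1.
have xy : x * y <= expR (- (K%:R * a)).
  apply: le_trans Z; rewrite le_eqVlt; apply/orP; left; apply/eqP.
  have -> : (2 * k - 2 * j - 1)%N = ((k - j) + (k - j.+1))%N by apply: exponent_split.
  have -> : p1 * p2 = pcol b * pcol (~~ b) by case: b {pb0 pb0' x y x0 y0 y1} => //=; rewrite mulrC.
  by rewrite /x /y exprD !natrM !natrX; ring.
apply: le_trans (_ : n%:R ^+ k * (x ^+ r * y ^+ s) <= _).
  have hC : 'C(l ^ 2 * n ^ (k - j.+1), s)%:R * pcol (~~ b) ^+ s <= y ^+ s.
    apply: le_trans (_ : ((4%:R * (l ^ 2 * n ^ (k - j.+1))%:R / s%:R) * pcol (~~ b)) ^+ s <= _).
      by rewrite exprMn ler_wpM2r ?exprn_ge0 // bin_le_pow.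
    apply: lerXn2r; rewrite ?nnegrE ?mulr_ge0 ?invr_ge0 ?ler0n //.
    rewrite /y ler_wpM2r // ler_pdivrMr ?ltr0n // -natrX -!natrM ler_nat.
    have lsK : (l <= s * K)%N by apply: leq_trans lrK _; rewrite leq_mul2r rs orbT.
    have l2 : (l * l <= 2 * L * (s * K))%N by apply: leq_mul => //; apply: ltnW.
    rewrite mulnA [X in (_ <= X)%N](_ : _ = 4 * (2 * L * (s * K)) * n ^ (k - j.+1))%N; last by ring.
    by rewrite leq_mul2r leq_mul2l /= mulnn in l2 *; rewrite l2 orbT.
  rewrite [X in X <= _](_ : _ = n%:R ^+ k * x ^+ r *
     ('C(l ^ 2 * n ^ (k - j.+1), s)%:R * pcol (~~ b) ^+ s)); last first.
    rewrite /x !exprMn natrM !natrX !natrM !natrX [(r * K)%N]mulnC exprM.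
    by rewrite !exprMn; ring.
  by rewrite [X in _ <= X]mulrA ler_wpM2l // mulr_ge0 ?exprn_ge0 ?ler0n.
rewrite ler_wpM2l ?exprn_ge0 ?ler0n //.
apply: le_trans (_ : x ^+ r * y ^+ r <= _).
  by rewrite ler_wpM2l ?exprn_ge0 // ler_wiXn2l.
rewrite -exprMn; apply: le_trans (_ : expR (- (K%:R * a)) ^+ r <= _).
  by apply: lerXn2r; rewrite ?nnegrE ?mulr_ge0 ?expR_ge0.
rewrite -expRM_natl ler_expR mulrN lerN2 [K%:R * a]mulrC mulrCA ler_wpM2l //.
by rewrite -natrM ler_nat (leq_trans Ll).
Qed.

(** Percolation puts every [j]-set into an edge of colour [b], and an edge covers only [K] of them,
    so at least [M] edges of this colour are present. *)
Lemma Pr_percolates_few (b : bool) (M : nat) : (0 < M)%N -> (M * K <= 'C(n, j))%N -> (1 < 'C(n, j))%N ->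
  Pr ep (fun w : {set X} => `[< j_percolates j (graph_of w) >]) <=
  (4%:R * n%:R ^+ k / M%:R * pcol b) ^+ M.
Proof.
move=> M0 MK J1; have e01 := @edge_prob01 R n k p1 p2 p1_01 p2_01.
rewrite Pr_kset_coords.
pose B := col b (subsets_of_card T k).
apply: le_trans (_ : Pr ep (fun w => (M <= #|B :&: w|)%N) <= _).
  apply: le_Pr => // w /andP[/asboolP perc kw].
  pose S := [set e | (b, e) \in w].
  have Sk e : e \in S -> #|e| = k.
    by rewrite inE => ew; have /forall_inP/(_ _ ew)/eqP := kw.
  have BS : B :&: w = col b S.
    apply/setP => -[b' e]; rewrite inE !mem_col inE.
    apply/andP/andP => [[/andP[/eqP-> _] ew]|[/eqP-> ew]]; split=> //; first by rewrite inE.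
      by rewrite eqxx Sk ?eqxx.
    by rewrite inE in ew.
  rewrite BS card_col.
  have K0 : (0 < K)%N by rewrite bin_gt0 ltnW.
  rewrite -(leq_pmul2r K0); apply: (leq_trans MK).
  apply: leq_trans (card_covered j Sk).
  rewrite -[X in 'C(X, _)]card_ord -card_draws; apply: subset_leq_card; apply/subsetP => x xj.
  rewrite inE in xj; rewrite inE xj /=; apply/exists_inP.
  (* With [L] the number of all [j]-sets the biconnected family can only be the whole of them. *)
  have [|C [CJ cJ _ /andP[g1 g2]]] := percolates_biconnected (L := 'C(n, j)) J1 _ perc.
    by rewrite card_draws card_ord.
  have CE : C = subsets_of_card T j.
    by apply/eqP; rewrite eqEcard CJ card_draws card_ord.
  have xC : x \in C by rewrite CE inE.
  have /subsetPn[y yC] : ~~ (C \subset [set x]).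
    by apply/negP => /subset_leq_card; rewrite cards1 leqNgt (leq_trans J1 cJ).
  rewrite inE => yx.
  have gb : gconn (corel S) C by rewrite /S; case: (b); [exact: g1|exact: g2].
  have /gconnP/(_ x y xC yC) gxy := gb.
  have [a [c [/eqP ax _ /and3P[_ _ /exists_inP[e eS ace]]]]] :=
    connect_crossing gxy (D := pred1 x) (eqxx x) yx.
  exists e => //; rewrite -ax; apply: subset_trans ace; exact: subsetUl.
have pb0 : 0 <= pcol b by case/andP: (pcol01 b).
apply: le_trans (@Pr_many _ _ _ (pcol b) _ M e01 _) _.
  move=> [b' e]; rewrite mem_col => /andP[/eqP-> _]; rewrite /edge_prob /=.
  by case: ifP => // _; case: b.
rewrite exprMn ler_wpM2r ?exprn_ge0 //.
apply: le_trans (bin_le_pow R _ M0) _.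
apply: lerXn2r; rewrite ?nnegrE ?mulr_ge0 ?invr_ge0 ?exprn_ge0 ?ler0n //.
rewrite ler_wpM2r ?invr_ge0 ?ler0n // ler_wpM2l ?ler0n // card_col card_draws card_ord.
rewrite -natrX ler_nat; apply: leq_trans (bin_leq_exp _ _); exact/leq_pmulr/fact_gt0.
Qed.

End LowerBound.

(** * Growing a cluster by adaptive exploration *)

Section Chain.

Variables (R : realFieldType) (xi : nat -> R).
Hypothesis xi01 : forall i, 0 <= xi i <= 1.

(* Probability that a walk started at [i], which in each of [r] rounds moves from
   [i] to [i + 1] with probability [xi i], ends below [L]. *)
Fixpoint chain (L r i : nat) : R :=
  if (i < L)%N then
    if r is r'.+1 then xi i * chain L r' i.+1 + (1 - xi i) * chain L r' i else 1
  else 0.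

Lemma chain_ge L r i : (L <= i)%N -> chain L r i = 0.
Proof. by move=> Li; case: r => [|r] /=; rewrite ltnNge Li. Qed.

Lemma chain_bound L r i : 0 <= chain L r i <= 1.
Proof.
elim: r i => [|r IH] i /=; case: ifP => _; rewrite ?lexx ?ler01 //.
by have := IH i; have := IH i.+1; have := xi01 i; nra.
Qed.

(** After one round the walk from [i] is at most at [i + 1] and the walk from [i + 1] at least
    there, so both sides compare with the value at [i + 1] for one round less. *)
Lemma chain_mono L r i : chain L r i.+1 <= chain L r i.
Proof.
elim: r i => [|r IH] i /=.
  case: (ltnP i.+1 L) => iL; first by rewrite (ltnW iL).
  by case: ifP => _; rewrite ?ler01.
case: (ltnP i.+1 L) => iL.
  rewrite (ltnW iL).
  by have := IH i; have := IH i.+1; have := xi01 i; have := xi01 i.+1; nra.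
case: ifP => _ //.
by have := chain_bound L r i; have := chain_bound L r i.+1; have := xi01 i; nra.
Qed.

(** Reserve [s] rounds for each level: level [m] is left within its own rounds with probability
    [1 - (1 - xi m) ^ s], and these successes multiply. *)
Lemma chain_success L s r i :
  (i <= L)%N -> ((L - i) * s <= r)%N ->
  chain L r i <= 1 - \prod_(i <= m < L) (1 - (1 - xi m) ^+ s).
Proof.
move=> iL; have [d] := ubnP (L - i); elim: d i r iL => // d IHd i r iL dL.
case: (ltngtP i L) iL => // [iL _|-> _ _]; last first.
  by rewrite chain_ge // big_geq // subrr.
rewrite big_ltn //; set P := \prod_(_ <= _ < _) _.
have P01 : 0 <= P <= 1.
  apply/andP; split.
    apply: prodr_ge0 => m _; rewrite subr_ge0; apply: exprn_ile1; have := xi01 m; lra.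
  rewrite /P; apply: prodr_ile1 => m _.
  have h : 0 <= (1 - xi m) ^+ s <= 1.
    by rewrite exprn_ge0 ?exprn_ile1 //; have := xi01 m; lra.
  lra.
have main q : ((L - i.+1) * s + q <= r)%N -> chain L r i <= 1 - (1 - (1 - xi i) ^+ q) * P.
  elim: q r => [|q IHq] r hr.
    by rewrite expr0 subrr mul0r subr0; case/andP: (chain_bound L r i).
  case: r hr => [|r]; first by rewrite addnS.
  rewrite addnS ltnS => hr /=; rewrite iL.
  have h1 : chain L r i.+1 <= 1 - P.
    by apply: IHd => //; [lia|apply: leq_trans hr; apply: leq_addr].
  have h0 := IHq r hr.
  have := xi01 i; rewrite exprS; set z := (1 - xi i) ^+ q in h0 *.
  move=> x01; apply: le_trans (_ : xi i * (1 - P) + (1 - xi i) * (1 - (1 - z) * P) <= _).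
    by apply: lerD; apply: ler_wpM2l => //; lra.
  rewrite le_eqVlt; apply/orP; left; apply/eqP; ring.
move=> hr; apply: main; apply: leq_trans hr.
by rewrite -(subnSK iL) mulSn addnC.
Qed.

End Chain.

Section Growth.

Variables (R : realFieldType) (X V : finType) (p : X -> R).
Hypothesis p01 : forall x, 0 <= p x <= 1.
(** [Q x w] holds the coordinates owned by the pair of [x] and [w]. By [Q_inj] different pairs own
    disjoint sets, and by [joined_dep] the test of [w] against [C] reads only the pairs of [w] with
    members of [C]. *)
Variable Q : V -> V -> pred X.
Hypothesis Q_inj : forall x w y z c, Q x w c -> Q y z c ->
  (x = y /\ w = z) \/ (x = z /\ w = y).
Variable joined : {set X} -> seq V -> V -> bool.
Hypothesis joined_dep : forall C w,
  ignores (fun c => ~~ has (fun x => Q x w c) C) (fun o => joined o C w).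

Implicit Types (C U ws us Av : seq V) (E F : pred {set X}).

Lemma ignoresS (A B : pred X) E : (forall c, A c -> B c) -> ignores B E -> ignores A E.
Proof.
move=> AB iE w w' h; apply: iE => x Bx; apply: h; apply: contra Bx; exact: AB.
Qed.

Lemma ignoresI (A : pred X) E F : ignores A E -> ignores A F -> ignores A (fun o => E o && F o).
Proof. by move=> iE iF w w' h; rewrite (iE w w') // (iF w w'). Qed.

Lemma ignoresC (A : pred X) E : ignores A E -> ignores A (fun o => ~~ E o).
Proof. by move=> iE w w' h; rewrite (iE w w'). Qed.

(* The coordinates not yet revealed once the vertices in [U] are discarded, the
   current cluster is [C], and the vertices of [C] have only been compared with
   vertices outside [Av]. *)
Definition fresh U C Av : pred X := fun c =>
  [exists x, exists w, [&& Q x w c, x \notin U, w \notin U,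
     (x \in C) ==> (w \in Av) & (w \in C) ==> (x \in Av)]].

Lemma freshS U U' C C' Av Av' c : {subset U <= U'} ->
  (forall x, x \in C -> x \in C' \/ x \in U') ->
  {subset Av' <= Av} -> fresh U' C' Av' c -> fresh U C Av c.
Proof.
move=> UU' CC' AvAv' /existsP[x /existsP[w /and5P[q xU wU xC wC]]].
apply/existsP; exists x; apply/existsP; exists w; apply/and5P; split=> //.
- by apply: contra xU; apply: UU'.
- by apply: contra wU; apply: UU'.
- apply/implyP => xC0; apply: AvAv'; apply: (implyP xC).
  by case: (CC' x xC0) => // xU'; rewrite xU' in xU.
- apply/implyP => wC0; apply: AvAv'; apply: (implyP wC).
  by case: (CC' w wC0) => // wU'; rewrite wU' in wU.
Qed.

(** All pairs of [w] with members of [C] are fresh, so the history [E] says nothing about them. *)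
Lemma Pr_joined_indep U C Av E w : ignores (fresh U C Av) E ->
  w \in Av -> w \notin U -> w \notin C -> (forall x, x \in C -> x \notin U) ->
  Pr p (fun o => E o && joined o C w) = Pr p E * Pr p (fun o => joined o C w).
Proof.
move=> iE wAv wU wC CU; apply: (@Pr_indep _ _ _ (fun c => has (fun x => Q x w c) C)).
  apply: ignoresS iE => c /hasP[x xC q].
  apply/existsP; exists x; apply/existsP; exists w.
  by rewrite q CU // wU wAv (negbTE wC) implybT.
exact: joined_dep.
Qed.

(** Once [w] has left [Av], its pairs with [C] are no longer fresh, and the outcome of its test may
    be added to the history. *)
Lemma ignores_joined U C Av C' w :
  {subset C <= C'} -> w \notin Av -> ignores (fresh U C' Av) (fun o => joined o C w).
Proof.
move=> CC' wAv.
apply: (@ignoresS _ (fun c => ~~ has (fun x => Q x w c) C)); last exact: joined_dep.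
move=> c.
case/existsP => x /existsP[z /and5P[q _ _ xC zC]].
apply/hasPn => y yC; apply/negP => q'.
case: (Q_inj q q') => -[exy ezw]; subst.
  by have := implyP xC (CC' _ yC); rewrite (negbTE wAv).
by have := implyP zC (CC' _ yC); rewrite (negbTE wAv).
Qed.

Fixpoint run (L : nat) (o : {set X}) ws C : seq V :=
  if ws is w :: ws' then
    run L o ws' (if (size C < L)%N && joined o C w then w :: C else C)
  else C.

Variable xi : nat -> R.
Hypothesis xi01 : forall i, 0 <= xi i <= 1.
Variable all_vs : seq V.
Hypothesis joined_prob : forall C w, (0 < size C)%N -> uniq (w :: C) ->
  {subset w :: C <= all_vs} -> xi (size C) <= Pr p (fun o => joined o C w).

(** [E] is the history and [F] the failure still to come, whose conditional probability is at most
    [b1] if the scan reaches size [L] and [b0] if not; the chain weighs the two. [E] is arbitrary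
    because the induction moves each test into it. *)
Lemma Pr_run (L : nat) U (F : seq V -> pred {set X}) (b0 b1 : R) Rest ws C E :
  b1 <= b0 ->
  (0 < size C <= L)%N -> uniq (ws ++ C) -> {subset ws ++ C <= all_vs} ->
  (forall x, x \in ws ++ C -> x \notin U) -> (forall x, x \in ws -> x \notin Rest) ->
  ignores (fresh U C (ws ++ Rest)) E ->
  (forall C' E', (0 < size C' <= L)%N -> uniq C' -> {subset C' <= ws ++ C} ->
     ignores (fresh U C' Rest) E' ->
     Pr p (fun o => E' o && F C' o) <= Pr p E' * (if (size C' < L)%N then b0 else b1)) ->
  Pr p (fun o => E o && F (run L o ws C) o) <=
  Pr p E * (b1 + (b0 - b1) * chain xi L (size ws) (size C)).
Proof.
move=> b10; elim: ws C E => [|w ws IH] C E sC uC sub dU dR iE HF.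
  apply: le_trans (HF C E _ _ _ _) _ => //.
  rewrite ler_wpM2l ?Pr_ge0 //=; case: ifP => _; lra.
have [wC wsC] : w \notin C /\ w \notin ws.
  by move: uC; rewrite /= mem_cat negb_or => /andP[/andP[-> ->]].
have uC' : uniq (ws ++ C) by move: uC => /= /andP[].
have subws x : x \in ws ++ C -> x \in (w :: ws) ++ C by rewrite /= inE orbC => ->.
have fr C' : {subset C <= C'} -> forall c,
    fresh U C' (ws ++ Rest) c -> fresh U C ((w :: ws) ++ Rest) c.
  move=> CC' c; apply: freshS => // x; first by move/CC'; left.
  by rewrite /= inE orbC => ->.
case: (ltnP (size C) L) => CL; last first.
  rewrite chain_ge // mulr0 addr0.
  have := IH C E sC uC' _ _ _ _ _; rewrite chain_ge // mulr0 addr0 => IH'.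
  have -> : Pr p (fun o => E o && F (run L o (w :: ws) C) o) =
            Pr p (fun o => E o && F (run L o ws C) o).
    by apply: eq_Pr => o /=; rewrite ltnNge CL.
  apply: IH' => [x /subws /sub //|x /subws /dU //|x xws||C' E' h1 h2 h3 h4].
  - by apply: dR; rewrite inE xws orbT.
  - by apply: ignoresS iE; apply: fr.
  - by apply: HF => // x /h3 /subws.
rewrite (Pr_split _ _ (fun o => joined o C w)).
have wU : w \notin U by apply: dU; rewrite mem_head.
have CU x : x \in C -> x \notin U by move=> xC; apply: dU; rewrite mem_cat xC orbT.
have wAv : w \notin ws ++ Rest by rewrite mem_cat negb_or wsC dR ?mem_head.
have ind := Pr_joined_indep (w := w) iE _ wU wC CU.
have {ind} ind : Pr p (fun o => E o && joined o C w) = Pr p E * Pr p (fun o => joined o C w).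
  by apply: ind; rewrite mem_head.
have indN : Pr p (fun o => E o && ~~ joined o C w) =
            Pr p E * (1 - Pr p (fun o => joined o C w)).
  by have := Pr_split p E (fun o => joined o C w); rewrite ind; lra.
have xle : xi (size C) <= Pr p (fun o => joined o C w).
  apply: joined_prob; first by case/andP: sC.
    by rewrite /= wC; move: uC'; rewrite cat_uniq => /and3P[].
  move=> x; rewrite inE => /orP[/eqP->|xC]; apply: sub; first by rewrite mem_head.
  by rewrite mem_cat xC orbT.
set x := Pr p (fun o => joined o C w) in ind indN xle.
have x1 : x <= 1 by apply: Pr_le1.
set g1 := chain xi L (size ws) (size C).+1.
set g0 := chain xi L (size ws) (size C).
have g10 : g1 <= g0 by apply: chain_mono.
have H1 : Pr p (fun o => (E o && F (run L o (w :: ws) C) o) && joined o C w) <=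
          Pr p E * x * (b1 + (b0 - b1) * g1).
  rewrite -ind.
  rewrite (eq_Pr _ (B := fun o => (E o && joined o C w) && F (run L o ws (w :: C)) o)); last first.
    move=> o /=; rewrite CL /=; case: (joined o C w); rewrite ?andbT ?andbF //.
  apply: (IH (w :: C)) => [||y|y|y yws||C' E' h1 h2 h3 h4].
  - by rewrite /= CL.
  - rewrite -[w :: C]/([:: w] ++ C) uniq_catCA /=; exact: uC.
  - by rewrite mem_cat inE orbCA -mem_cat -in_cons => /sub.
  - by rewrite mem_cat inE orbCA -mem_cat -in_cons => /dU.
  - by apply: dR; rewrite inE yws orbT.
  - apply: ignoresI.
      by apply: ignoresS iE; apply: fr => y yC; rewrite inE yC orbT.
    by apply: ignores_joined => // y yC; rewrite inE yC orbT.
  - by apply: HF => // y /h3; rewrite mem_cat inE orbCA -mem_cat -in_cons.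
have H0 : Pr p (fun o => (E o && F (run L o (w :: ws) C) o) && ~~ joined o C w) <=
          Pr p E * (1 - x) * (b1 + (b0 - b1) * g0).
  rewrite -indN.
  rewrite (eq_Pr _ (B := fun o => (E o && ~~ joined o C w) && F (run L o ws C) o)); last first.
    by move=> o /=; rewrite CL /=; case: (joined o C w); rewrite ?andbT ?andbF.
  apply: (IH C) => [||y /subws /sub //|y /subws /dU //|y yws||C' E' h1 h2 h3 h4] //.
  - by apply: dR; rewrite inE yws orbT.
  - apply: ignoresI; first by apply: ignoresS iE; apply: fr.
    by apply: ignoresC; apply: ignores_joined.
  - by apply: HF => // y /h3 /subws.
apply: le_trans (lerD H1 H0) _.
rewrite /= CL -/g1 -/g0 -!mulrA -mulrDr ler_wpM2l ?Pr_ge0 //.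
(* The true probability [x] may exceed [xi]; as [g1 <= g0] and [b1 <= b0], this only lowers the
   average. *)
have : 0 <= (x - xi (size C)) * (b0 - b1) * (g0 - g1).
  by rewrite !mulr_ge0 // subr_ge0.
lra.
Qed.

Variables (v1 v2 : V) (ws1 ws2 : seq V) (L M : nat).
Variable eta : R.
Hypothesis joined_last : forall C w, size C = M -> uniq (w :: C) ->
  {subset w :: C <= all_vs} -> 1 - eta <= Pr p (fun o => joined o C w).
Hypothesis eta0 : 0 <= eta.

Definition fail3 C : pred {set X} := fun o => ~~ (joined o C v1 && joined o C v2).

Definition fail2 C : pred {set X} := fun o =>
  let C' := run M o ws2 C in (size C' < M)%N || fail3 C' o.

(* Trials from the successive starting vertices [us], each restricted to the vertices
   of [ws1] not yet used, until one cluster reaches size [L]; this cluster then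
   scans [ws2] up to size [M] and must finally absorb [v1] and [v2]. *)
Fixpoint fail1 us U (o : {set X}) : bool :=
  if us is u :: us' then
    let C := run L o [seq w <- ws1 | w \notin U] [:: u] in
    if (size C < L)%N then fail1 us' (C ++ U) o else fail2 C o
  else true.

Lemma Pr_fail3 U C E : size C = M -> uniq (v1 :: C) -> uniq (v2 :: C) ->
  {subset v1 :: v2 :: C <= all_vs} ->
  (forall x, x \in v1 :: v2 :: C -> x \notin U) ->
  ignores (fresh U C [:: v1; v2]) E ->
  Pr p (fun o => E o && fail3 C o) <= Pr p E * (2 * eta).
Proof.
move=> CM u1 u2 sub dU iE.
have one w : w \in [:: v1; v2] -> uniq (w :: C) ->
    Pr p (fun o => E o && ~~ joined o C w) <= Pr p E * eta.
  move=> wv uw.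
  have wall : w \in v1 :: v2 :: C.
    by move: wv; rewrite !inE => /orP[->|->]; rewrite ?orbT.
  have CU x : x \in C -> x \notin U by move=> xC; apply: dU; rewrite !inE xC !orbT.
  have /= /andP[wC _] := uw.
  have := Pr_split p E (fun o => joined o C w).
  rewrite (Pr_joined_indep iE wv (dU w wall) wC CU).
  have : 1 - eta <= Pr p (fun o => joined o C w).
    apply: joined_last => // x; rewrite inE => /orP[/eqP->|xC]; first exact: sub.
    by apply: sub; rewrite !inE xC !orbT.
  by have := Pr_ge0 p01 E; nra.
apply: le_trans (_ : Pr p (fun o => (E o && ~~ joined o C v1) || (E o && ~~ joined o C v2)) <= _).
  by apply: le_Pr => // o; rewrite /fail3 negb_and andb_orr.
apply: le_trans (PrU p01 _ _) _.
have := one v1 (mem_head _ _) u1; have := one v2 _ u2.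
rewrite !inE eqxx orbT => /(_ isT); lra.
Qed.

Lemma Pr_fail2 U C E : (0 < L <= M)%N -> size C = L -> uniq (ws2 ++ C) ->
  uniq (v1 :: ws2 ++ C) -> uniq (v2 :: ws2 ++ C) ->
  {subset v1 :: v2 :: ws2 ++ C <= all_vs} ->
  (forall x, x \in v1 :: v2 :: ws2 ++ C -> x \notin U) ->
  ignores (fresh U C (ws2 ++ [:: v1; v2])) E ->
  Pr p (fun o => E o && fail2 C o) <= Pr p E * (2 * eta + chain xi M (size ws2) L).
Proof.
move=> /andP[L0 LM] CL uws u1 u2 sub dU iE.
have inall x : x \in ws2 ++ C -> x \in v1 :: v2 :: ws2 ++ C by rewrite !inE => ->; rewrite !orbT.
(* Taking [1 + 2 * eta] instead of 1 makes [b0 - b1 = 1], so the chain enters with coefficient 1. *)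
apply: le_trans (Pr_run (F := fun C' o => (size C' < M)%N || fail3 C' o) (b0 := 1 + 2 * eta)
  (b1 := 2 * eta) (U := U) (L := M) (ws := ws2) (C := C) (Rest := [:: v1; v2]) (E := E)
  _ _ _ _ _ _ _ _) _ => //.
- lra.
- by rewrite CL L0.
- by move=> x /inall /sub.
- by move=> x /inall /dU.
- move=> x xws; rewrite !inE negb_or; apply/andP; split; apply/eqP => e; subst x.
    by move: u1; rewrite /= mem_cat xws.
  by move: u2; rewrite /= mem_cat xws.
- move=> C' E' /andP[_ C'M] uC' sC' iE'; case: (ltnP (size C') M) => C'M'.
    apply: le_trans (_ : Pr p E' <= _); first by apply: le_Pr => // o /andP[].
    by rewrite ler_peMr ?Pr_ge0 // lerDl mulr_ge0.
  have eC' : size C' = M by apply/eqP; rewrite eqn_leq C'M.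
  rewrite (eq_Pr _ (B := fun o => E' o && fail3 C' o)) //.
  apply: Pr_fail3 iE' => //.
  + by rewrite /= uC' andbT; apply/negP => /sC' h; move: u1; rewrite /= h.
  + by rewrite /= uC' andbT; apply/negP => /sC' h; move: u2; rewrite /= h.
  + move=> x; rewrite !inE => /or3P[/eqP->|/eqP->|/sC' h]; apply: sub; rewrite !inE ?eqxx ?orbT //.
    by rewrite h !orbT.
  + move=> x; rewrite !inE => /or3P[/eqP->|/eqP->|/sC' h]; apply: dU; rewrite !inE ?eqxx ?orbT //.
    by rewrite h !orbT.
rewrite ler_wpM2l ?Pr_ge0 // CL; lra.
Qed.

Variables (T : nat) (eps : R).
Hypothesis chain_trial : forall r, (size ws1 - T * L <= r)%N -> chain xi L r 1 <= eps.

(** A failed trial discards only its cluster: the vertices it rejected were compared with discarded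
    members alone and can be scanned again. The budget on [size U] keeps at least [size ws1 - T * L]
    vertices for every trial. *)
Lemma Pr_fail1 us U E : (0 < L <= M)%N -> 0 <= eps ->
  uniq (us ++ ws1 ++ ws2 ++ [:: v1; v2]) ->
  {subset us ++ ws1 ++ ws2 ++ [:: v1; v2] <= all_vs} ->
  (size U + size us * L <= T * L)%N ->
  (forall x, x \in us ++ ws2 ++ [:: v1; v2] -> x \notin U) -> uniq U ->
  ignores (fresh U [::] [::]) E ->
  Pr p (fun o => E o && fail1 us U o) <=
  Pr p E * (2 * eta + chain xi M (size ws2) L + eps ^+ size us).
Proof.
move=> LM eps0; elim: us U E => [|u us IH] U E uall sub sU dU uU iE.
  apply: le_trans (_ : Pr p E <= _); first by apply: le_Pr => // o /andP[].
  rewrite ler_peMr ?Pr_ge0 //= expr0.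
  by rewrite lerDr addr_ge0 ?mulr_ge0 //; case/andP: (chain_bound xi01 M (size ws2) L).
set B := 2 * eta + _; set ws := [seq w <- ws1 | w \notin U].
have usub x : x \in us ++ ws1 ++ ws2 ++ [:: v1; v2] ->
              x \in (u :: us) ++ ws1 ++ ws2 ++ [:: v1; v2].
  by rewrite /= inE orbC => ->.
have ws_sub x : x \in ws -> x \in ws1 by rewrite mem_filter => /andP[].
have mem1 x : x \in ws ++ [:: u] -> x \in (u :: us) ++ ws1 ++ ws2 ++ [:: v1; v2].
  rewrite mem_cat inE => /orP[/ws_sub h|/eqP->]; last by rewrite mem_head.
  by rewrite !mem_cat h !orbT.
have mem2 x : x \in ws2 ++ [:: v1; v2] -> x \in (u :: us) ++ ws1 ++ ws2 ++ [:: v1; v2].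
  by move=> h; rewrite mem_cat [x \in ws1 ++ _]mem_cat h !orbT.
have uu : u \notin us ++ ws1 ++ ws2 ++ [:: v1; v2] by move: uall => /= /andP[].
have uall' : uniq (us ++ ws1 ++ ws2 ++ [:: v1; v2]) by move: uall => /= /andP[].
have uR : uniq (ws1 ++ ws2 ++ [:: v1; v2]) by move: uall'; rewrite cat_uniq => /and3P[].
have uR2 : uniq (ws2 ++ [:: v1; v2]) by move: uR; rewrite cat_uniq => /and3P[].
have dis1 x : x \in ws1 -> x \notin ws2 ++ [:: v1; v2].
  move=> h; apply/negP => h2; move: uR; rewrite cat_uniq => /and3P[_ /hasPn/(_ x h2) /= + _].
  by rewrite h.
have dis2 x : x \in ws ++ [:: u] -> x \notin ws2 ++ [:: v1; v2].
  rewrite mem_cat inE => /orP[/ws_sub/dis1 //|/eqP->].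
  by move: uu; rewrite mem_cat [_ \in ws1 ++ _]mem_cat !negb_or => /and3P[].
have disus x : x \in us -> x \notin ws ++ [:: u].
  move=> h; apply/negP; rewrite mem_cat inE => /orP[/ws_sub h1|/eqP e].
    move: uall'; rewrite cat_uniq => /and3P[_ /hasPn/(_ x)].
    by rewrite mem_cat h1 => /(_ isT) /= + _; rewrite h.
  by subst x; move: uu; rewrite mem_cat h.
have dU1 x : x \in ws ++ [:: u] -> x \notin U.
  rewrite mem_cat inE => /orP[|/eqP->]; first by rewrite mem_filter => /andP[].
  by apply: dU; rewrite mem_head.
have uws : uniq (ws ++ [:: u]).
  rewrite cats1 rcons_uniq filter_uniq ?andbT; last by move: uR; rewrite cat_uniq => /and3P[].
  apply/negP => /ws_sub h; move: uu; rewrite mem_cat [_ \in ws1 ++ _]mem_cat h.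
  by rewrite orbT.
(* Failure of this trial leaves the inductive bound for [us]; thus [b0 - b1 = eps ^ size us], and
   the chain supplies one more factor [eps]. *)
apply: le_trans (Pr_run (F := fun C o => if (size C < L)%N then fail1 us (C ++ U) o else fail2 C o)
  (b0 := B + eps ^+ size us) (b1 := B) (U := U) (L := L) (ws := ws) (C := [:: u])
  (Rest := ws2 ++ [:: v1; v2]) (E := E) _ _ _ _ _ _ _ _) _ => //.
- by rewrite lerDl exprn_ge0.
- by case/andP: LM.
- by move=> x /mem1 /sub.
- by move=> x xws; apply: dis2; rewrite mem_cat xws.
- apply: ignoresS (iE : ignores (fresh U [::] (ws ++ ws2 ++ [:: v1; v2])) E) => c.
  exact: freshS.
- move=> C' E' /andP[C'0 C'L] uC' sC' iE'; case: ifPn => C'L'.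
    apply: IH => //.
    + by move=> x /usub /sub.
    + rewrite size_cat; move: sU => /=; rewrite mulSn addnCA addnA [(L + _)%N]addnC => sU.
      apply: leq_trans sU; rewrite leq_add2r addnC leq_add2l; exact: ltnW.
    + move=> x xin; rewrite mem_cat negb_or; apply/andP; split.
        apply/negP => /sC' h; move: xin; rewrite mem_cat => /orP[/disus|].
          by rewrite h.
        by apply/negP; apply: dis2.
      by apply: dU; rewrite /= inE xin orbT.
    + rewrite cat_uniq uC' uU andbT /=; apply/hasPn => x xU.
      by apply/negP => /sC'/dU1; rewrite xU.
    + apply: ignoresS iE' => c; apply: freshS => // x.
        by rewrite mem_cat => ->; rewrite orbT.
      by move=> xC'; right; rewrite mem_cat xC'.
  rewrite -leqNgt in C'L'.
  have eC' : size C' = L by apply/eqP; rewrite eqn_leq C'L.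
  have uw2 : uniq (ws2 ++ C').
    rewrite cat_uniq uC' andbT; apply/andP; split.
      by move: uR2; rewrite cat_uniq => /and3P[].
    by apply/hasPn => x /sC'/dis2; rewrite mem_cat negb_or => /andP[].
  have nv v : v \in [:: v1; v2] -> v \notin ws2 ++ C'.
    move=> vv; rewrite mem_cat negb_or; apply/andP; split.
      move: uR2; rewrite cat_uniq => /and3P[_ /hasPn h _]; exact: h.
    by apply/negP => /sC'/dis2; rewrite mem_cat vv orbT.
  have memf x : x \in v1 :: v2 :: ws2 ++ C' -> x \in ws2 ++ [:: v1; v2] \/ x \in ws ++ [:: u].
    rewrite in_cons in_cons => /or3P[/eqP->|/eqP->|].
    + by left; rewrite mem_cat !inE eqxx orbT.
    + by left; rewrite mem_cat !inE eqxx !orbT.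
    + by rewrite [x \in ws2 ++ C']mem_cat => /orP[h|/sC' h]; [left; rewrite mem_cat h|right].
  apply: Pr_fail2 iE' => //.
  + by rewrite cons_uniq uw2 nv // mem_head.
  + by rewrite cons_uniq uw2 nv // !inE eqxx orbT.
  + by move=> x /memf[/mem2 /sub //|/mem1 /sub].
  + move=> x /memf[h|/dU1 //]; apply: dU; rewrite /= inE mem_cat h !orbT; exact: erefl.
rewrite ler_wpM2l ?Pr_ge0 // lerD2l.
rewrite (_ : B + eps ^+ size us - B = eps ^+ size us); last by rewrite addrAC subrr add0r.
rewrite /= exprSr ler_wpM2l ?exprn_ge0 //.
apply: chain_trial.
have cf : (size [seq w <- ws1 | w \in U] <= size U)%N.
  apply: uniq_leq_size; first by rewrite filter_uniq //; move: uR; rewrite cat_uniq => /and3P[].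
  by move=> x; rewrite mem_filter => /andP[].
rewrite leq_subLR /ws !size_filter -(count_predC (mem U) ws1) leq_add2r.
rewrite size_filter in cf; apply: leq_trans cf _.
by apply: leq_trans sU; apply: leq_addr.
Qed.

(** The trace handed to the deterministic part: every member except the oldest was joined to the
    members before it, the list being ordered newest first. *)
Fixpoint grown (o : {set X}) C : bool :=
  if C is w :: C' then (C' == [::]) || (joined o C' w && grown o C') else false.

Lemma grown_run K o ws C : grown o C -> grown o (run K o ws C).
Proof.
elim: ws C => [|w ws IH] C gC //=; apply: IH; case: ifP => // /andP[_ jw].
by rewrite /= jw gC orbT.
Qed.

Lemma run_sub K o ws C : {subset run K o ws C <= ws ++ C}.
Proof.
elim: ws C => [|w ws IH] C x //= /IH; rewrite mem_cat; case: ifP => _.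
  by rewrite !inE mem_cat orbCA.
by rewrite !inE mem_cat => ->; rewrite orbT.
Qed.

Lemma fail1P us U o : ~~ fail1 us U o ->
  exists C, [/\ grown o C, joined o C v1, joined o C v2 & {subset C <= us ++ ws1 ++ ws2}].
Proof.
elim: us U => [|u us IH] U //=; case: ifP => _.
  move=> /IH[C [gC j1 j2 sC]]; exists C; split=> // x /sC h.
  by rewrite inE h orbT.
rewrite /fail2 negb_or => /andP[_]; rewrite /fail3 negbK => /andP[j1 j2].
eexists; split; [|exact: j1|exact: j2|].
  by do 2 apply: grown_run.
move=> x /run_sub; rewrite mem_cat => /orP[h|/run_sub].
  by rewrite inE !mem_cat h !orbT.
rewrite mem_cat mem_filter inE => /orP[/andP[_ h]|/eqP->]; last by rewrite mem_head.
by rewrite inE !mem_cat h !orbT.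
Qed.

End Growth.

(** * The link of a set of vertices *)

Section Link.

Variables (R : realType) (n k j : nat) (p1 p2 : R).
Local Notation T := 'I_n.
Local Notation X := (bool * {set T})%type.
Local Notation ep := (@edge_prob R n k p1 p2).
Hypotheses (jk : (j.+1 < k)%N).
Hypotheses (p1_01 : 0 <= p1 <= 1) (p2_01 : 0 <= p2 <= 1).

Variables (I : {set T}) (vs : seq T).
Hypotheses (cI : #|I| = j) (uvs : uniq vs) (dvs : forall x, x \in vs -> x \notin I).

(* Each such edge meets [vs] exactly in [x] and [w], so distinct pairs of vertices
   are examined through disjoint sets of coordinates. *)
Definition pair_coords (x w : T) : pred X := fun c =>
  [&& #|c.2| == k, I \subset c.2, c.2 :&: [set y in vs] == [set x; w] & x != w].

Lemma pair_coords_inj x w y z c : pair_coords x w c -> pair_coords y z c ->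
  (x = y /\ w = z) \/ (x = z /\ w = y).
Proof.
move=> /and4P[_ _ /eqP e1 xw] /and4P[_ _ /eqP e2 yz].
have e : [set x; w] = [set y; z] by rewrite -e1 -e2.
have := set21 x w; have := set22 x w; rewrite e => /set2P ew /set2P ex.
case: ex => ex; case: ew => ew; [|by left|by right|].
  by rewrite ex ew eqxx in xw.
by rewrite ex ew eqxx in xw.
Qed.

Definition joined_col (b : bool) (o : {set X}) (C : seq T) (w : T) : bool :=
  [exists c in o, (c.1 == b) && has (fun x => pair_coords x w c) C].

Definition joined (o : {set X}) (C : seq T) (w : T) : bool :=
  joined_col true o C w && joined_col false o C w.

Lemma joined_col_dep b C w (A : pred X) :
  (forall c, A c -> ~~ ((c.1 == b) && has (fun x => pair_coords x w c) C)) ->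
  ignores A (fun o => joined_col b o C w).
Proof.
move=> HA o o' h; apply/exists_inP/exists_inP => -[c co hc]; exists c => //.
  by rewrite -h //; apply/negP => /HA; rewrite hc.
by rewrite h //; apply/negP => /HA; rewrite hc.
Qed.

Lemma joined_dep C w :
  ignores (fun c => ~~ has (fun x => pair_coords x w c) C) (fun o => joined o C w).
Proof.
apply: ignoresI; apply: joined_col_dep => c /negbTE->; by rewrite andbF.
Qed.

(** Here [j] is the size of [I], and the percolating sets have [j + 1] elements. An edge for a given
    pair has [j + 2] vertices prescribed and takes the others outside [I] and [vs]. *)
Definition link_count : nat := 'C(n - j - size vs, k - j.+2).

Lemma card_pair_coords b C w : uniq (w :: C) -> {subset w :: C <= vs} ->
  (size C * link_count <= #|[set c : X | (c.1 == b) && has (fun x => pair_coords x w c) C]|)%N.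
Proof.
move=> /= /andP[wC uC] sub.
pose B := [set y in vs].
pose Ss := [set S : {set T} | S \subset ~: (I :|: B) & #|S| == (k - j.+2)%N].
have IB : I :&: B = set0.
  by apply/setP => y; rewrite !inE; apply/negP => /andP[yI /dvs]; rewrite yI.
have cSs : #|Ss| = link_count.
  rewrite cards_draws cardsCs setCK card_ord cardsU IB cards0 subn0 cI subnDA.
  by rewrite /link_count cardsE (card_uniqP uvs).
(* Injective: intersecting the edge with [vs] recovers [x], and removing [I] and [vs] recovers
   [S]. *)
pose f (u : T * {set T}) : X := (b, I :|: [set u.1; w] :|: u.2).
pose D := setX [set x in C] Ss.
have wB : w \in B by rewrite inE sub ?mem_head.
have CB x : x \in C -> x \in B by move=> xC; rewrite inE sub // inE xC orbT.
have fB u : u \in D -> (f u).2 :&: B = [set u.1; w].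
  case: u => x S; rewrite !inE /= => /andP[xC /andP[SC _]].
  apply/setP => y; rewrite !inE.
  case: (boolP (y \in vs)) => yB; last first.
    rewrite andbF; apply/esym/negP => /orP[/eqP e|/eqP e]; subst y.
      by have := CB x xC; rewrite inE (negbTE yB).
    by move: wB; rewrite inE (negbTE yB).
  rewrite andbT (negbTE (dvs yB)) /=.
  case: (boolP (y \in S)) => yS; last by rewrite orbF.
  by have := subsetP SC y yS; rewrite !inE yB orbT.
have fS u : u \in D -> (f u).2 :\: (I :|: B) = u.2.
  case: u => x S; rewrite !inE /= => /andP[xC /andP[SC _]].
  apply/setP => y; rewrite !inE negb_or.
  case: (boolP (y \in S)) => yS.
    by have := subsetP SC y yS; rewrite !inE negb_or => ->; rewrite orbT.
  rewrite orbF; apply/negP => /andP[/andP[yI yB] /orP[yI'|/orP[/eqP e|/eqP e]]].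
  - by rewrite yI' in yI.
  - by subst y; have := CB x xC; rewrite inE (negbTE yB).
  - by subst y; move: wB; rewrite inE (negbTE yB).
have finj : {in D &, injective f}.
  move=> u u' uD u'D e.
  have e2 : u.2 = u'.2 by rewrite -(fS u uD) -(fS u' u'D) e.
  have e1 : [set u.1; w] = [set u'.1; w] by rewrite -(fB u uD) -(fB u' u'D) e.
  have uC1 : u.1 != w.
    by apply: contraNneq wC => <-; move: uD; rewrite !inE => /andP[].
  have : u.1 \in [set u'.1; w] by rewrite -e1 set21.
  rewrite !inE (negbTE uC1) orbF => /eqP e1'.
  by case: u u' e2 e1' {uD u'D e e1 uC1} => [x S] [x' S'] /= -> ->.
have -> : (size C * link_count)%N = #|f @: D|.
  by rewrite card_in_imset // cardsX cardsE (card_uniqP uC) cSs.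
apply: subset_leq_card; apply/subsetP => _ /imsetP[u uD ->].
rewrite inE eqxx /=; apply/hasP; exists u.1.
  by move: uD; rewrite !inE => /andP[].
have xw : u.1 != w.
  by apply: contraNneq wC => <-; move: uD; rewrite !inE => /andP[].
rewrite /pair_coords (fB u uD) eqxx xw andbT /=.
rewrite -setUA subsetUl andbT.
case: u uD xw => x S /= uD xw.
have xC : x \in C by move: uD; rewrite !inE => /andP[].
have := uD; rewrite !inE /= => /andP[_ /andP[SC /eqP cS]].
have d1 : S :&: (I :|: B) = set0.
  by apply/eqP; rewrite setI_eq0 disjoints_subset.
have xI : x \notin I by apply: dvs; have := CB x xC; rewrite inE.
have wI : w \notin I by apply: dvs; move: wB; rewrite inE.
have xwB : [set x; w] \subset B by rewrite subUset !sub1set CB // wB.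
rewrite setUA cardsU [_ :&: S](_ : _ = set0) ?cards0 ?subn0; last first.
  apply/eqP; rewrite -subset0 -d1 setIC; apply: setIS; apply: setUS; exact: xwB.
rewrite cardsU [I :&: _](_ : _ = set0) ?cards0 ?subn0; last first.
  by apply/eqP; rewrite -subset0 -IB; apply: setIS.
by rewrite cI cards2 xw cS /= andbT addn2 subnKC.
Qed.

Lemma Pr_not_joined_col b C w : uniq (w :: C) -> {subset w :: C <= vs} ->
  Pr ep (fun o => ~~ joined_col b o C w) <= (1 - pcol p1 p2 b) ^+ (size C * link_count).
Proof.
move=> uC sub.
pose D := [set c : X | (c.1 == b) && has (fun x => pair_coords x w c) C].
rewrite (eq_Pr _ (B := fun o => [disjoint D & o])); last first.
  move=> o; rewrite -setI_eq0 -[RHS]negbK; congr (~~ _).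
  apply/exists_inP/set0Pn => [[c co hc]|[c /setIP[hc co]]]; exists c => //.
    by rewrite inE co inE hc.
  by move: hc; rewrite inE.
rewrite Pr_disjoint (eq_bigr (fun=> 1 - pcol p1 p2 b)); last first.
  move=> [b' e]; rewrite inE => /andP[/= /eqP-> /hasP[x _ /and4P[/= ek _ _ _]]].
  by rewrite /edge_prob /= ek.
rewrite prodr_const; have := pcol01 p1_01 p2_01 b => pb.
by apply: ler_wiXn2l; [lra|lra|apply: card_pair_coords].
Qed.

Lemma Pr_joined C w :
  Pr ep (fun o => joined o C w) =
  Pr ep (fun o => joined_col true o C w) * Pr ep (fun o => joined_col false o C w).
Proof.
apply: (@Pr_indep _ _ _ (fun c : X => ~~ c.1)); apply: joined_col_dep => -[[] e] //=.
Qed.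

(** Bernoulli for [(1 + q) ^ m], since [(1 - q) ^ m] times it is at most 1. The reciprocal form
    leads to success probabilities with simple inverses. *)
Lemma pow_inv_le (q : R) m : 0 <= q <= 1 -> (1 - q) ^+ m <= (1 + m%:R * q)^-1.
Proof.
move=> q01; have m0 : 0 <= m%:R :> R by rewrite ler0n.
have d0 : 0 < 1 + m%:R * q by have : 0 <= m%:R * q by [rewrite mulr_ge0 //; lra]; lra.
rewrite -[X in _ <= X]div1r ler_pdivlMr //.
have bern : 1 + m%:R * q <= (1 + q) ^+ m.
  elim: m {m0 d0} => [|m IH]; first by rewrite mul0r addr0.
  rewrite exprS -natr1.
  apply: le_trans (_ : (1 + q) * (1 + m%:R * q) <= _); last by apply: ler_wpM2l => //; lra.
  have : 0 <= m%:R * q * q by rewrite !mulr_ge0 ?ler0n //; lra.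
  lra.
apply: le_trans (_ : (1 - q) ^+ m * (1 + q) ^+ m <= _).
  by rewrite ler_wpM2l ?exprn_ge0 //; lra.
rewrite -exprMn exprn_ile1 //; nra.
Qed.

(* With [a / 2] bounding [1/P1] and [1/P2] and [b] bounding [1/(P1 P2)], the inverse
   of [xi_of a b i] bounds [(1 + 1/(i P1)) (1 + 1/(i P2))]. *)
Definition xi_of (a b : R) (i : nat) : R := (1 + a / i%:R + b / i%:R ^+ 2)^-1.

Lemma xi_of01 a b i : 0 <= a -> 0 <= b -> 0 <= xi_of a b i <= 1.
Proof.
move=> a0 b0; have h : 1 <= 1 + a / i%:R + b / i%:R ^+ 2.
  have : 0 <= a / i%:R by rewrite divr_ge0.
  have : 0 <= b / i%:R ^+ 2 by rewrite divr_ge0 ?exprn_ge0.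
  lra.
by rewrite invr_ge0 (le_trans ler01 h) invf_le1 // (lt_le_trans ltr01 h).
Qed.

(** With [P] the mean number of edges per pair, a colour joins with probability at least
    [1 - (1 + i P)^-1 = (1 + 1/(i P))^-1], and the colours are independent. *)
Lemma joined_prob_xi a b C w :
  (forall c, 0 < link_count%:R * pcol p1 p2 c) ->
  (forall c, 2 / (link_count%:R * pcol p1 p2 c) <= a) ->
  ((link_count%:R * p1) * (link_count%:R * p2))^-1 <= b ->
  (0 < size C)%N -> uniq (w :: C) -> {subset w :: C <= vs} ->
  xi_of a b (size C) <= Pr ep (fun o => joined o C w).
Proof.
move=> P0 Pa Pb C0 uC sub.
set i := size C; set N := link_count in P0 Pa Pb *.
have i0 : 0 < i%:R :> R by rewrite ltr0n.
have low c : (1 + (i%:R * (N%:R * pcol p1 p2 c))^-1)^-1 <=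
             Pr ep (fun o => joined_col c o C w).
  have := Pr_not_joined_col c uC sub; rewrite PrC -/i -/N => h.
  have := pow_inv_le (i * N) (pcol01 p1_01 p2_01 c); rewrite natrM => h2.
  set z := N%:R * pcol p1 p2 c in P0 Pa *.
  have z0 : 0 < i%:R * (N%:R * pcol p1 p2 c) by rewrite mulr_gt0.
  have -> : (1 + (i%:R * (N%:R * pcol p1 p2 c))^-1)^-1 =
            1 - (1 + i%:R * N%:R * pcol p1 p2 c)^-1.
    rewrite -mulrA; set y := i%:R * _ in z0 *.
    by field; apply/andP; split; apply: lt0r_neq0; lra.
  lra.
rewrite Pr_joined.
have inv0 c : 0 < (i%:R * (N%:R * pcol p1 p2 c))^-1 by rewrite invr_gt0 mulr_gt0.
apply: le_trans (_ : (1 + (i%:R * (N%:R * pcol p1 p2 true))^-1)^-1 *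
                     (1 + (i%:R * (N%:R * pcol p1 p2 false))^-1)^-1 <= _); last first.
  by apply: ler_pM => //; rewrite invr_ge0 addr_ge0 // ltW.
rewrite -invfM /xi_of lef_pV2; first last.
- by rewrite posrE mulr_gt0 // addr_gt0.
- rewrite posrE.
  have : 0 <= a / i%:R.
    rewrite divr_ge0 ?(ltW i0) //; apply: le_trans (Pa true); rewrite divr_ge0 //; exact: ltW.
  have : 0 <= b / i%:R ^+ 2.
    rewrite divr_ge0 ?exprn_ge0 //; apply: le_trans Pb; rewrite invr_ge0.
    by rewrite mulr_ge0 // ltW //; [apply: (P0 true)|apply: (P0 false)].
  lra.
have h1 : (N%:R * p1)^-1 <= a / 2 by have := Pa true; rewrite /pcol; lra.
have h2 : (N%:R * p2)^-1 <= a / 2 by have := Pa false; rewrite /pcol; lra.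
have iV : 0 <= i%:R^-1 :> R by rewrite invr_ge0 ltW.
rewrite /pcol (invfM i%:R (N%:R * p1)) (invfM i%:R (N%:R * p2)) -exprVn expr2.
set u := (N%:R * p1)^-1 in h1 *; set v := (N%:R * p2)^-1 in h2 *; set z := i%:R^-1 in iV *.
rewrite invfM -/u -/v in Pb.
have e1 := ler_wpM2l iV h1; have e2 := ler_wpM2l iV h2.
have e3 := ler_wpM2l (mulr_ge0 iV iV) Pb.
lra.
Qed.

Lemma joined_last_exp (M : nat) (eta : R) C w :
  (forall c, expR (- (M%:R * (link_count%:R * pcol p1 p2 c))) <= eta) ->
  size C = M -> uniq (w :: C) -> {subset w :: C <= vs} ->
  1 - 2 * eta <= Pr ep (fun o => joined o C w).
Proof.
move=> He CM uC sub.
have up c : Pr ep (fun o => ~~ joined_col c o C w) <= eta.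
  apply: le_trans (Pr_not_joined_col c uC sub) _; apply: le_trans (He c).
  rewrite CM mulrA -mulrN -natrM expRM_natl.
  have := pcol01 p1_01 p2_01 c => pb.
  by apply: lerXn2r; rewrite ?nnegrE ?expR_ge0 //; [lra|apply: expR_ge1Dx].
have e01 := @edge_prob01 R n k p1 p2 p1_01 p2_01.
have := PrC ep (fun o => joined o C w).
have : Pr ep (fun o => ~~ joined o C w) <= eta + eta.
  apply: le_trans (lerD (up true) (up false)).
  apply: le_trans (PrU e01 _ _); apply: le_Pr => // o.
  by rewrite /joined negb_and.
lra.
Qed.

(** An edge that joins [x] and [w] contains both [x |: I] and [w |: I]; so, from the oldest member
    on, a stopped partition must keep each new member in the class of the earlier ones. *)
Lemma grown_block o C P : {subset C <= vs} -> grown joined o C ->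
  partition P (subsets_of_card T j.+1) -> jigsaw_stopped (graph_of o) P ->
  exists2 A, A \in P & forall w, w \in vs -> (w \in C) || joined o C w -> w |: I \in A.
Proof.
move=> sub gC pP st.
have inJ w : w \in vs -> w |: I \in subsets_of_card T j.+1.
  by move=> /dvs wI; rewrite inE cardsU1 wI cI.
have absorb A C' w : A \in P -> w \in vs -> (forall x, x \in C' -> x |: I \in A) ->
    joined o C' w -> w |: I \in A.
  move=> AP wvs CA /andP[j1 j2]; apply: (stopped_absorb pP st AP (inJ w wvs)).
  - case/exists_inP: j1 => -[b e] co /andP[/= /eqP eb /hasP[x xC /and4P[_ /= Ie /eqP eB _]]].
    subst b; apply/linkedP; exists (x |: I), (w |: I); rewrite CA // set11; split=> //.
    apply/exists_inP; exists e; first by rewrite inE.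
    rewrite !subUset !sub1set Ie !andbT.
    have : [set x; w] \subset e by rewrite -eB subsetIl.
    by rewrite subUset !sub1set.
  - case/exists_inP: j2 => -[b e] co /andP[/= /eqP eb /hasP[x xC /and4P[_ /= Ie /eqP eB _]]].
    subst b; apply/linkedP; exists (x |: I), (w |: I); rewrite CA // set11; split=> //.
    apply/exists_inP; exists e; first by rewrite inE.
    rewrite !subUset !sub1set Ie !andbT.
    have : [set x; w] \subset e by rewrite -eB subsetIl.
    by rewrite subUset !sub1set.
suff [A AP CA] : exists2 A, A \in P & forall x, x \in C -> x |: I \in A.
  by exists A => // w wvs /orP[/CA //|]; apply: absorb.
elim: C sub gC => [|w C IH] // sub /= /orP[/eqP C0|/andP[jw gC]].
  have [A AP wA] := partition_block pP (inJ w (sub w (mem_head _ _))).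
  by exists A => // x; rewrite C0 inE => /eqP->.
have [|A AP CA] := IH _ gC; first by move=> x xC; apply: sub; rewrite inE xC orbT.
exists A => // x; rewrite inE => /orP[/eqP->|/CA //].
by apply: absorb jw => //; apply: sub; rewrite mem_head.
Qed.

End Link.

(** Replacing a vertex of [y] outside [x] by one of [x] outside [y] stays in the class and decreases
    [#|x :\: y|]. *)
Lemma exchange_percolates (n j : nat) (H : double_graph 'I_n) : (j < n)%N ->
  (forall (I : {set 'I_n}) v1 v2 P A, #|I| = j -> v1 \notin I -> v2 \notin I -> v1 != v2 ->
     partition P (subsets_of_card 'I_n j.+1) -> jigsaw_stopped H P -> A \in P ->
     v1 |: I \in A -> v2 |: I \in A) ->
  j_percolates j.+1 H.
Proof.
move=> jn HI; apply: percolatesI.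
  have : (0 < #|subsets_of_card 'I_n j.+1|)%N by rewrite card_draws card_ord bin_gt0.
  by case/card_gt0P => x; exists x.
move=> P A x pP st AP xJ.
have : A != set0 by apply: contraTneq AP => ->; case/and3P: pP.
case/set0Pn => y yA.
have [d] := ubnP #|x :\: y|; elim: d y yA => // d IH y yA yd.
have cx : #|x| = j.+1 by move: xJ; rewrite inE => /eqP.
have cy : #|y| = j.+1 by have := subsetP (partition_sub pP AP) y yA; rewrite inE => /eqP.
case: (eqVneq (x :\: y) set0) => [xy0|/set0Pn[v]].
  suff -> : x = y by [].
  by apply/eqP; rewrite eqEcard cx cy leqnn andbT -setD_eq0 xy0.
rewrite inE => /andP[vy vx].
have /subsetPn[u uy ux] : ~~ (y \subset x).
  apply/negP => yx; have : y = x by apply/eqP; rewrite eqEcard yx cx cy leqnn.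
  by move=> e; rewrite e vx in vy.
apply: (IH (v |: (y :\ u))).
  apply: (HI (y :\ u) u v P) => //.
  - by apply/eqP; rewrite -(eqn_add2l 1) -{1}(_ : (u \in y) = 1%N :> nat) -?cardsD1 ?cy ?add1n // uy.
  - by rewrite !inE eqxx.
  - by rewrite !inE negb_and vy orbT.
  - by apply: contraNneq ux => ->.
  - by rewrite setD1K.
rewrite -ltnS; apply: leq_trans yd; rewrite ltnS.
apply: proper_card; apply/properP; split.
  apply/subsetP => z; rewrite !inE negb_or negb_and negbK => /andP[/andP[_ /orP[/eqP->|->]] zx] //.
  by rewrite zx in ux.
by exists v; rewrite !inE ?vy ?vx // eqxx.
Qed.

(** * Bounds on the growth chain *)

Section ChainBounds.

Variable R : realType.

Lemma expRN_le (z : R) : 0 <= z <= 1 -> expR (- z) <= 1 - z / 2.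
Proof.
move=> z01; rewrite expRN -[X in X <= _]div1r ler_pdivrMr ?expR_gt0 //.
have := expR_ge1Dx z => h.
apply: le_trans (_ : (1 - z / 2) * (1 + z) <= _); first by nra.
by rewrite ler_wpM2l //; lra.
Qed.

(* With [Z = exp (lam (2 (psi M - psi i) - r))], one round multiplies the
   bound by [1 - x + x exp (-2 lam / x) <= exp (- lam)], where [x = xi i]. *)
Lemma chain_potential (xi psi : nat -> R) (lam : R) (L M r i : nat) :
  (forall i, 0 < xi i <= 1) ->
  (forall i, (L <= i < M)%N -> (xi i)^-1 <= psi i.+1 - psi i) ->
  0 <= lam -> (forall i, (L <= i < M)%N -> 2 * lam <= xi i) ->
  (L <= i <= M)%N ->
  chain xi M r i <= expR (lam * (2 * (psi M - psi i) - r%:R)).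
Proof.
move=> xi01 dpsi lam0 lamxi.
have mono d q : (L <= q)%N -> (q + d <= M)%N -> psi q <= psi (q + d)%N.
  elim: d => [|d IH] Lq qM; first by rewrite addn0.
  rewrite addnS in qM *; apply: le_trans (IH Lq (ltnW qM)) _.
  have := dpsi (q + d)%N; rewrite qM (leq_trans Lq (leq_addr _ _)) => /(_ isT).
  have /andP[x0 _] := xi01 (q + d)%N.
  have : 0 < (xi (q + d)%N)^-1 by rewrite invr_gt0.
  lra.
elim: r i => [|r IH] i /andP[Li iM].
  rewrite /=; case: ifP => _; last exact: expR_ge0.
  rewrite -expR0 ler_expR mulr_ge0 // subr0 mulr_ge0 // subr_ge0.
  by have := mono (M - i)%N i Li; rewrite subnKC //; apply.
rewrite /=; case: ifPn => iM'; last exact: expR_ge0.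
have /andP[x0 x1] := xi01 i.
have h1 := IH i.+1; rewrite iM' (leq_trans Li) // in h1; have {}h1 := h1 isT.
have h0 := IH i; rewrite iM Li in h0; have {}h0 := h0 isT.
have dp := dpsi i; rewrite Li iM' in dp; have {}dp := dp isT.
have lx := lamxi i; rewrite Li iM' in lx; have {}lx := lx isT.
set Z := expR (lam * (2 * (psi M - psi i) - r%:R)) in h0.
have Z0 : 0 < Z by apply: expR_gt0.
pose z := 2 * lam / xi i.
have z01 : 0 <= z <= 1 by rewrite divr_ge0 ?mulr_ge0 ?(ltW x0) //= ler_pdivrMr // mul1r.
have h1' : expR (lam * (2 * (psi M - psi i.+1) - r%:R)) <= Z * (1 - z / 2).
  apply: le_trans (_ : Z * expR (- z) <= _); last by rewrite ler_pM2l // expRN_le.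
  rewrite /Z -expRD ler_expR.
  have : 2 * lam * (xi i)^-1 <= 2 * lam * (psi i.+1 - psi i).
    by rewrite ler_wpM2l // mulr_ge0.
  rewrite /z; lra.
have e : expR (lam * (2 * (psi M - psi i) - r.+1%:R)) = Z * expR (- lam).
  by rewrite /Z -expRD; congr expR; rewrite -natr1; ring.
rewrite e.
apply: le_trans (_ : Z * (1 - lam) <= _); last first.
  by rewrite ler_pM2l // expR_ge1Dx.
have -> : Z * (1 - lam) = xi i * (Z * (1 - z / 2)) + (1 - xi i) * Z.
  by rewrite /z; field; apply: lt0r_neq0.
apply: lerD; apply: ler_wpM2l => //; lra.
Qed.

(* The increments of [psi_of] dominate [1 / xi_of], since
   [1/i <= ln i - ln (i-1)] and [1/i^2 <= 1/(i-1) - 1/i]. *)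
Definition psi_of (a b : R) (i : nat) : R :=
  i%:R + a * ln (i.-1)%:R - b / (i.-1)%:R.

Lemma psi_of_step (a b : R) i : 0 <= a -> 0 <= b -> (1 < i)%N ->
  (xi_of a b i)^-1 <= psi_of a b i.+1 - psi_of a b i.
Proof.
move=> a0 b0 i1; rewrite /xi_of invrK /psi_of /=.
case: i i1 => // i i1; rewrite /= -[i.+2]addn2 natrD -[i.+1]addn1 natrD.
have i0 : 0 < i%:R :> R by rewrite ltr0n.
set x := i%:R in i0 *.
have l1 : (x + 1)^-1 <= ln (x + 1) - ln x.
  rewrite -lerN2 opprB -ln_div ?posrE //; last lra.
  have -> : x / (x + 1) = 1 + (- (x + 1)^-1) by field; lra.
  apply: le_ln1Dx; rewrite ltrN2 invf_lt1 //; lra.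
have l2 : (x + 1) ^- 2 <= x^-1 - (x + 1)^-1.
  have -> : x^-1 - (x + 1)^-1 = (x * (x + 1))^-1 by field; apply/andP; split; lra.
  rewrite lef_pV2 ?posrE ?exprn_gt0 ?mulr_gt0 //; [|lra|lra].
  by rewrite expr2 ler_wpM2r //; lra.
have := ler_wpM2l a0 l1; have := ler_wpM2l b0 l2; lra.
Qed.

Lemma psi_of_diff (a b : R) (L M : nat) : 0 <= a -> 0 <= b -> (1 < L <= M)%N ->
  psi_of a b M - psi_of a b L <= M%:R + a * ln M%:R + b / (L.-1)%:R.
Proof.
move=> a0 b0 /andP[L1 LM]; rewrite /psi_of.
have h1 : 0 <= ln (L.-1)%:R :> R by rewrite ln_ge0 // ler1n; case: L L1 {LM} => // -[].
have h2 : ln (M.-1)%:R <= ln M%:R :> R.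
  rewrite ler_ln ?posrE ?ltr0n ?ler_nat ?leq_pred //; last by apply: leq_trans LM; apply: ltnW.
  by rewrite -subn1 subn_gt0 (leq_trans L1).
have h3 : 0 <= b / (M.-1)%:R by rewrite divr_ge0.
have h4 : 0 <= L%:R :> R by rewrite ler0n.
have := ler_wpM2l a0 h2; have := mulr_ge0 a0 h1; lra.
Qed.

(** The last hypothesis says that [s] times [xi_of a b L] is at least 1. Level [m], given [s]
    rounds, is then passed with probability at least [m^2 / (2 L^2)]; the product of these is
    [L!^2 / (2 L^2)^L], and [L^L <= 4^L L!]. *)
Lemma chain_trial_bound (a b : R) (s L r : nat) : 0 <= a -> 0 <= b -> (0 < L)%N ->
  ((L - 1) * s <= r)%N ->
  L%:R ^+ 2 + a * L%:R + b <= s%:R * L%:R ^+ 2 ->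
  chain (xi_of a b) L r 1 <= 1 - 32%:R ^- L.
Proof.
move=> a0 b0 L0 hr hs.
have xi01 i : 0 <= xi_of a b i <= 1 by apply: xi_of01.
apply: le_trans (chain_success xi01 L0 hr) _; rewrite lerD2l lerN2.
have LR : 0 < L%:R :> R by rewrite ltr0n.
have s0 : 0 < s%:R :> R.
  rewrite ltr0n lt0n; apply/eqP => s0; move: hs; rewrite s0 mul0r.
  have : 0 < L%:R ^+ 2 :> R by rewrite exprn_gt0.
  have : 0 <= a * L%:R by rewrite mulr_ge0 // ltW.
  lra.
apply: le_trans (_ : \prod_(1 <= m < L.+1) (m%:R ^+ 2 / (2 * L%:R ^+ 2)) <= _).
  rewrite big_split /= prodrXl -natr_prod -fact_prod prodr_const_nat subSS subn0 exprVn.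
  have c0 : 0 < (2 * L%:R ^+ 2) ^+ L :> R by rewrite exprn_gt0 // mulr_gt0 ?exprn_gt0.
  rewrite ler_pdivlMr // mulrC ler_pdivrMr ?exprn_gt0 //.
  have -> : (2 * L%:R ^+ 2) ^+ L = ((2 * L ^ 2) ^ L)%:R :> R by rewrite natrX natrM natrX.
  have -> : L`!%:R ^+ 2 * 32%:R ^+ L = (L`! ^ 2 * 32 ^ L)%:R :> R by rewrite natrM !natrX.
  rewrite ler_nat.
  have h := exp_leq_fact L.
  apply: leq_trans (_ : 2 ^ L * (4 ^ L * L`!) ^ 2 <= _)%N.
    by rewrite expnMn leq_mul2l -expnM mulnC expnM leq_sqr h orbT.
  by rewrite expnMn mulnA -expnM [(L * 2)%N]mulnC expnM -expnMn mulnC.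
(* The factor with [m = L], added to complete the factorial, is at most 1. *)
rewrite big_nat_recr //=.
apply: le_trans (_ : \prod_(1 <= m < L) (m%:R ^+ 2 / (2 * L%:R ^+ 2)) * 1 <= _).
  apply: ler_wpM2l; first by apply: prodr_ge0 => m _; rewrite divr_ge0 ?mulr_ge0 ?exprn_ge0.
  rewrite ler_pdivrMr ?mulr_gt0 ?exprn_gt0 //.
  have : 0 < L%:R ^+ 2 :> R by rewrite exprn_gt0.
  lra.
rewrite mulr1 !big_nat; apply: ler_prod => m /andP[m1 mL].
have m0 : 0 < m%:R :> R by rewrite ltr0n.
rewrite divr_ge0 ?mulr_ge0 ?exprn_ge0 //=.
apply: le_trans (_ : 1 - (1 + s%:R * xi_of a b m)^-1 <= _); last first.
  by rewrite lerD2l lerN2 pow_inv_le.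
have x0 : 0 < xi_of a b m.
  rewrite invr_gt0; have : 0 <= a / m%:R by rewrite divr_ge0.
  have : 0 <= b / m%:R ^+ 2 by rewrite divr_ge0 ?exprn_ge0.
  lra.
have mL' : m%:R <= L%:R :> R by rewrite ler_nat ltnW.
have q0 : 0 < m%:R ^+ 2 :> R by rewrite exprn_gt0.
have sx : m%:R ^+ 2 / L%:R ^+ 2 <= s%:R * xi_of a b m.
  rewrite /xi_of ler_pdivlMr; last by move: x0; rewrite /xi_of invr_gt0.
  rewrite mulrAC ler_pdivrMr ?exprn_gt0 //.
  have -> : m%:R ^+ 2 * (1 + a / m%:R + b / m%:R ^+ 2) = m%:R ^+ 2 + a * m%:R + b.
    by field; apply: lt0r_neq0.
  apply: le_trans hs; rewrite lerD2r; apply: lerD; last by rewrite ler_wpM2l.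
  by rewrite lerXn2r ?nnegrE ?(ltW m0) ?(ltW LR).
set u := m%:R ^+ 2 / L%:R ^+ 2 in sx.
have u01 : 0 < u <= 1.
  rewrite divr_gt0 ?exprn_gt0 //= ler_pdivrMr ?exprn_gt0 // mul1r.
  by rewrite lerXn2r ?nnegrE ?(ltW m0) ?(ltW LR).
have -> : m%:R ^+ 2 / (2 * L%:R ^+ 2) = u / 2.
  by rewrite /u invfM; field; apply: lt0r_neq0.
set v := s%:R * _ in sx *.
have -> : 1 - (1 + v)^-1 = v / (1 + v) by field; lra.
rewrite ler_pdivlMr; last lra.
nra.
Qed.

End ChainBounds.

(** * Failure probability of the whole exploration *)

Section UpperBound.

Variables (R : realType) (n k j : nat) (p1 p2 : R).
Local Notation V := 'I_n.
Local Notation X := (bool * {set V})%type.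
Local Notation ep := (@edge_prob R n k p1 p2).
Hypotheses (jk : (j.+1 < k)%N).
Hypotheses (p1_01 : 0 <= p1 <= 1) (p2_01 : 0 <= p2 <= 1).

Variables (T m L M : nat) (a b eta eps : R).
Hypothesis size_ok : (T + (m + m) + 2 + j <= n)%N.
Let N : nat := 'C(n - j - (T + (m + m) + 2), k - j.+2).
Hypotheses (P0 : forall c, 0 < N%:R * pcol p1 p2 c).
Hypotheses (Pa : forall c, 2 / (N%:R * pcol p1 p2 c) <= a).
Hypotheses (Pb : ((N%:R * p1) * (N%:R * p2))^-1 <= b).
Hypotheses (LM : (0 < L <= M)%N).
Hypotheses (He : forall c, expR (- (M%:R * (N%:R * pcol p1 p2 c))) <= eta).
Hypotheses (eps0 : 0 <= eps).
Hypotheses (Ht : forall r, (m - T * L <= r)%N -> chain (xi_of a b) L r 1 <= eps).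

(** The working vertices are [T] starting points, two pools of size [m] and the targets [v1], [v2].
    The term [4 * eta] stands for two targets times two colours; the others are failure of the
    second scan and of all [T] trials. *)
Lemma Pr_not_together (I : {set V}) (v1 v2 : V) : #|I| = j -> v1 \notin I -> v2 \notin I ->
  v1 != v2 ->
  Pr ep (fun o => `[< ~ forall P A, partition P (subsets_of_card V j.+1) ->
     jigsaw_stopped (graph_of o) P -> A \in P -> v1 |: I \in A -> v2 |: I \in A >]) <=
  4 * eta + chain (xi_of a b) M m L + eps ^+ T.
Proof.
move=> cI v1I v2I v12; have e01 := @edge_prob01 R n k p1 p2 p1_01 p2_01.
pose D := ~: (v1 |: (v2 |: I)).
pose rest := take (T + (m + m)) (enum D).
have cD : #|D| = (n - j.+2)%N.
  by rewrite cardsCs setCK card_ord !cardsU1 v2I cI !inE negb_or v12 v1I !add1n.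
have sr : size rest = (T + (m + m))%N.
  rewrite size_takel // -cardE cD leq_subRL; last by apply: leq_trans size_ok; rewrite addn2 addSn addSn !ltnS leq_addl.
  by apply: leq_trans size_ok; rewrite -addnA addnC [(2 + j)%N]addnC addn2.
pose us := take T rest; pose ws1 := take m (drop T rest); pose ws2 := drop m (drop T rest).
have su : size us = T by rewrite size_takel // sr leq_addr.
have s1 : size ws1 = m by rewrite size_takel // size_drop sr addKn leq_addr.
have s2 : size ws2 = m by rewrite !size_drop sr addKn addKn.
pose vs := us ++ ws1 ++ ws2 ++ [:: v1; v2].
have vsE : vs = rest ++ [:: v1; v2] by rewrite /vs catA catA -[_ ++ ws2]catA cat_take_drop cat_take_drop.
have restD x : x \in rest -> [/\ x != v1, x != v2 & x \notin I].
  by move=> /mem_take; rewrite mem_enum !inE !negb_or => /and3P[].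
have uvs : uniq vs.
  rewrite vsE cat_uniq take_uniq ?enum_uniq //= !inE v12 !andbT orbF negb_or.
  by apply/andP; split; apply/negP => /restD[]; rewrite eqxx.
have dvs x : x \in vs -> x \notin I.
  by rewrite vsE mem_cat !inE => /or3P[/restD[]//|/eqP->|/eqP->].
have svs : size vs = (T + (m + m) + 2)%N by rewrite vsE size_cat sr.
have NE : link_count k j vs = N by rewrite /link_count svs.
have a0 : 0 <= a by apply: le_trans (Pa true); rewrite divr_ge0 // ltW.
have b0 : 0 <= b.
  apply: le_trans Pb; rewrite invr_ge0 mulr_ge0 // ltW //; [exact: (P0 true)|exact: (P0 false)].
have eta0 : 0 <= eta by apply: le_trans (He true); apply: expR_ge0.
pose jn := joined k I vs.
have v1vs : v1 \in vs by rewrite vsE mem_cat !inE eqxx orbT.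
have v2vs : v2 \in vs by rewrite vsE mem_cat !inE eqxx !orbT.
apply: le_trans (_ : Pr ep (fun o => predT o && fail1 jn v1 v2 ws1 ws2 L M us [::] o) <= _).
  apply: le_Pr => // o /asboolP nb /=; apply/negPn/negP => /fail1P[C [gC j1 j2 sC]].
  apply: nb => P A pP st AP v1A.
  have sC' : {subset C <= vs}.
    by move=> x /sC h; rewrite /vs !catA mem_cat -catA h.
  have [A' A'P hA'] := grown_block cI dvs sC' gC pP st.
  have v1A' : v1 |: I \in A' by apply: hA' => //; apply/orP; right.
  rewrite (partition_eq pP AP A'P v1A v1A').
  by apply: hA' => //; apply/orP; right.
have := @Pr_fail1 R X V ep e01 (pair_coords k I vs) (@pair_coords_inj n k I vs) jn
  (@joined_dep n k I vs) (xi_of a b) (fun i => xi_of01 i a0 b0) vs _ v1 v2 ws1 ws2 L M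
  (2 * eta) _ _ T eps _ us [::] predT LM eps0 _ _ _ _ _ _.
rewrite PrT mul1r su s2 mulrA -natrM; apply=> //.
- move=> C w C0 uC sub; apply: (joined_prob_xi jk p1_01 p2_01 cI uvs dvs) => //; by rewrite NE.
- move=> C w CM uC sub; apply: (joined_last_exp jk p1_01 p2_01 cI uvs dvs _ CM) => //; by rewrite NE.
- by rewrite mulr_ge0.
- by move=> r; rewrite s1; apply: Ht.
Qed.

Lemma Pr_not_percolates :
  Pr ep (fun o => `[< ~ j_percolates j.+1 (graph_of o) >]) <=
  n%:R ^+ j.+2 * (4 * eta + chain (xi_of a b) M m L + eps ^+ T).
Proof.
have e01 := @edge_prob01 R n k p1 p2 p1_01 p2_01.
pose Idx := ({set V} * (V * V))%type.
pose Pi (i : Idx) := [&& #|i.1| == j, i.2.1 \notin i.1, i.2.2 \notin i.1 & i.2.1 != i.2.2].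
pose B (i : Idx) (o : {set X}) := `[< ~ forall P A, partition P (subsets_of_card V j.+1) ->
     jigsaw_stopped (graph_of o) P -> A \in P -> i.2.1 |: i.1 \in A -> i.2.2 |: i.1 \in A >].
set beta := 4 * eta + _ + _.
have beta0 : 0 <= beta.
  have a0 : 0 <= a by apply: le_trans (Pa true); rewrite divr_ge0 // ltW.
  have b0 : 0 <= b.
    apply: le_trans Pb; rewrite invr_ge0 mulr_ge0 // ltW //; [exact: (P0 true)|exact: (P0 false)].
  have eta0 : 0 <= eta by apply: le_trans (He true); apply: expR_ge0.
  rewrite !addr_ge0 ?mulr_ge0 ?exprn_ge0 //.
  by case/andP: (chain_bound (fun i => xi_of01 i a0 b0) M m L).
apply: le_trans (_ : Pr ep (fun o => [exists i, Pi i && B i o]) <= _).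
  apply: le_Pr => // o /asboolP np; apply: contraT => /existsPn nob; case: np.
  apply: exchange_percolates.
    by apply: leq_trans size_ok; rewrite addn2 addSn addSn !ltnS leqW // leq_addl.
  move=> I v1 v2 P A cI v1I v2I v12 pP st AP v1A.
  have := nob (I, (v1, v2)); rewrite /Pi /= cI eqxx v1I v2I v12 /= => /asboolPn/contrapT.
  by move/(_ P A pP st AP v1A).
apply: le_trans (Pr_bigU e01 _ _) _.
apply: le_trans (_ : \sum_(i | Pi i) beta <= _).
  apply: ler_sum => -[I [v1 v2]] /and4P[/= /eqP cI v1I v2I v12]; exact: Pr_not_together.
rewrite sumr_const -[X in X <= _]mulr_natl ler_wpM2r // -natrX ler_nat.
apply: leq_trans (_ : #|setX [set I : {set V} | #|I| == j] [set: V * V]| <= _)%N.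
  by apply: subset_leq_card; apply/subsetP => -[I [v1 v2]] /and4P[/= cI _ _ _]; rewrite !inE cI.
rewrite cardsX card_draws cardsT card_prod !card_ord -addn2 expnD expnS expn1 leq_mul2r.
apply/orP; right; apply: leq_trans (bin_leq_exp _ _); exact/leq_pmulr/fact_gt0.
Qed.

End UpperBound.

(** * The subcritical regime *)

Section Asymptotics.

Variable R : realType.
Implicit Types (c : R) (n k j : nat).

Lemma nat_floor (x : R) : 0 <= x -> exists m : nat, m%:R <= x < m%:R + 1.
Proof.
by move=> x0; exists (Num.truncn x); rewrite natr1 truncn_itv.
Qed.

(** One term of the exponential series at [ln n] has a power to spare, and this spare factor [ln n]
    absorbs the constant. *)
Lemma pow_ln_le n d (K : R) : (0 < n)%N -> 0 <= K -> (d.+1)`!%:R * K <= ln n%:R ->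
  1 <= ln n%:R :> R -> K * ln n%:R ^+ d <= n%:R.
Proof.
move=> n0 K0 hK l1; set l := ln n%:R in hK l1 *.
have l0 : 0 <= l by apply: le_trans l1.
have -> : n%:R = expR l by rewrite lnK // posrE ltr0n.
have := expR_ge1Dxn d l0; set F := (d.+1)`!%:R in hK *.
have F0 : 0 < F by rewrite ltr0n fact_gt0.
move=> h; apply: le_trans (_ : l ^+ d.+1 / F <= _); last lra.
rewrite ler_pdivlMr // exprS mulrAC [K * F]mulrC.
by apply: ler_wpM2r => //; apply: exprn_ge0.
Qed.

Lemma expR_ln_pow n q : (0 < n)%N -> expR (- (q%:R * ln n%:R)) = (n%:R ^+ q)^-1 :> R.
Proof. by move=> n0; rewrite expRN expRM_natl lnK // posrE ltr0n. Qed.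

(** Chosen so that [n ^ j] is at most this constant times ['C(n, j) %/ 'C(k, j)]: the binomial loses
    [2 ^ j * j!], the division ['C(k, j)], and its rounding 2. *)
Definition cover_const k j : nat := (2 ^ j.+1 * j`! * 'C(k, j))%N.

(** The summands serve the two hypotheses of [Pr_percolates_sparse]. In the exponent, [k] cancels
    the [n ^ k] starting edges and 4 pays for the cube of [L] with [1/n] to spare. *)
Definition c_sub k j : R :=
  (128 * 'C(k, j) * cover_const k j)%:R +
  (64 * 'C(k, j) ^ 2 * 2 ^ 'C(k, j))%:R * expR ('C(k, j)%:R * (k + 4)%:R).

Lemma Pr_percolates_subcritical n k j (p1 p2 c : R) :
  (0 < j < k)%N -> 0 <= p1 <= 1 -> 0 <= p2 <= 1 -> c_sub k j <= c ->
  (0 < n)%N -> 2 * (cover_const k j)%:R <= ln n%:R :> R ->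
  p1 * p2 <= 1 / (c * n%:R ^+ (2 * k - 2 * j - 1) * ln n%:R) ->
  Pr (@edge_prob R n k p1 p2) (fun w => `[< j_percolates j (graph_of w) >]) <=
  (128 + cover_const k j)%:R / n%:R.
Proof.
move=> /andP[j0 jk] h1 h2 hc n0 hl hp.
set K := 'C(k, j); set D := cover_const k j in hl *.
have K0 : (0 < K)%N by rewrite bin_gt0 ltnW.
have D2 : (2 * (2 ^ j * j`!) <= D)%N.
  by rewrite /D /cover_const expnS -!mulnA !leq_mul2l /= leq_pmulr ?orbT.
have D2' : (2 <= D)%N by apply: leq_trans D2; rewrite leq_pmulr // muln_gt0 expn_gt0 fact_gt0.
have nR : 0 < n%:R :> R by rewrite ltr0n.
have l1 : 1 <= ln n%:R :> R.
  have : 2 <= D%:R :> R by rewrite ler_nat.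
  lra.
set l := ln n%:R in hl hp l1 *.
have Dl : D%:R * l <= n%:R.
  have := @pow_ln_le n 1 D%:R n0 (ler0n _ _); rewrite expr1; apply=> //.
have Dn : (D <= n)%N.
  by rewrite -(ler_nat R); apply: le_trans Dl; rewrite ler_peMr.
have n1 : (1 < n)%N := leq_trans D2' Dn.
have jn : (2 * j <= n)%N.
  apply: leq_trans Dn; apply: leq_trans D2; rewrite leq_mul2l /=.
  by apply: leq_trans (ltnW (ltn_expl j (isT : 1 < 2)%N)) _; rewrite leq_pmulr // fact_gt0.
have binlow := bin_geq_exp jn.
have nnj : (n <= n ^ j)%N by rewrite -{1}(expn1 n) leq_pexp2l.
have Dn' : (2 * (K * (2 ^ j * j`!)) <= n ^ j)%N.
  apply: leq_trans nnj; apply: leq_trans Dn.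
  by rewrite /D /cover_const expnS -/K; apply/eq_leq; ring.
(* This value makes [4 * delta * D] equal to [1/2], the base used in [half]. *)
pose delta : R := (8 * D)%:R^-1.
have D0 : 0 < (8 * D)%:R :> R by rewrite ltr0n muln_gt0 /=; apply: leq_trans D2'.
have d0 : 0 < delta by rewrite invr_gt0.
have nk : n%:R ^+ k = n%:R ^+ (k - j) * n%:R ^+ j :> R by rewrite -exprD subnK // ltnW.
have few b : pcol p1 p2 b <= delta / n%:R ^+ (k - j) ->
    Pr (@edge_prob R n k p1 p2) (fun w => `[< j_percolates j (graph_of w) >]) <=
    (128 + D)%:R / n%:R.
  move=> pb; pose M := ('C(n, j) %/ K)%N.
  have MK : (M * K <= 'C(n, j))%N by apply: leq_trunc_div.
  have bK : (2 * K <= 'C(n, j))%N.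
    have h := leq_trans Dn' binlow; rewrite mulnA leq_pmul2r // in h.
    by rewrite muln_gt0 expn_gt0 fact_gt0.
  have M0 : (0 < M)%N by rewrite divn_gt0 //; apply: leq_trans bK; rewrite leq_pmull.
  have bM : ('C(n, j) <= 2 * (M * K))%N.
    have := ltn_ceil 'C(n, j) K0; rewrite -/M mulSn => /ltnW h; apply: leq_trans h _.
    by rewrite mul2n -addnn leq_add2r leq_pmull.
  have MD : (n ^ j <= M * D)%N.
    apply: leq_trans binlow _.
    apply: leq_trans (_ : 2 * (M * K) * (2 ^ j * j`!) <= _)%N; first by rewrite leq_mul2r bM orbT.
    by rewrite /D /cover_const expnS -/K; apply/eq_leq; ring.
  have J1 : (1 < 'C(n, j))%N by apply: leq_trans bK; rewrite leq_pmulr.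
  apply: le_trans (Pr_percolates_few jk h1 h2 b M0 MK J1) _.
  have MR : 0 < M%:R :> R by rewrite ltr0n.
  have pb0 : 0 <= pcol p1 p2 b by case/andP: (pcol01 h1 h2 b).
  have half : 4%:R * n%:R ^+ k / M%:R * pcol p1 p2 b <= 2^-1.
    apply: le_trans (_ : 4%:R * n%:R ^+ k / M%:R * (delta / n%:R ^+ (k - j)) <= _).
      by rewrite ler_wpM2l // !mulr_ge0 ?exprn_ge0 ?invr_ge0.
    have -> : 4%:R * n%:R ^+ k / M%:R * (delta / n%:R ^+ (k - j)) =
              4%:R * delta * (n%:R ^+ j / M%:R).
      by rewrite nk; field; rewrite !lt0r_neq0 // exprn_gt0.
    have : n%:R ^+ j / M%:R <= D%:R :> R.
      by rewrite ler_pdivrMr // -natrX -natrM ler_nat mulnC.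
    move=> h; apply: le_trans (_ : 4%:R * delta * D%:R <= _).
      by rewrite ler_wpM2l // mulr_ge0 // ltW.
    rewrite /delta natrM le_eqVlt; apply/orP; left; apply/eqP.
    by field; rewrite lt0r_neq0 // ltr0n; apply: leq_trans D2'.
  apply: le_trans (_ : 2^-1 ^+ M <= _).
    apply: lerXn2r; rewrite ?nnegrE ?invr_ge0 //.
    by rewrite !mulr_ge0 ?exprn_ge0 ?invr_ge0.
  rewrite exprVn -natrX.
  apply: le_trans (_ : M%:R^-1 <= _).
    rewrite lef_pV2 ?posrE ?ltr0n ?expn_gt0 // ler_nat; exact/ltnW/ltn_expl.
  rewrite ler_pdivlMr // mulrC ler_pdivrMr // -natrM ler_nat.
  by apply: leq_trans nnj _; apply: leq_trans MD _; rewrite mulnC leq_mul2r leq_addl orbT.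
(* If neither colour is rare, the bound on [p1 * p2] caps each probability from above; this is what
   [Y] needs. *)
case: (lerP p1 (delta / n%:R ^+ (k - j))) => [hp1|hp1]; first exact: (few true).
case: (lerP p2 (delta / n%:R ^+ (k - j))) => [hp2|hp2]; first exact: (few false).
have [L0 /andP[L0l lL0]] := nat_floor (le_trans ler01 l1).
pose L := L0.+1.
have LR : L%:R = L0%:R + 1 :> R by rewrite natr1.
have lL : l <= L%:R by rewrite LR ltW.
have L2l : L%:R <= 2 * l by rewrite LR; lra.
have L1 : (1 < L)%N.
  by rewrite ltnS -(ltr_nat R); lra.
have nn : (n <= 'C(n, j) * (2 ^ j * j`!))%N by apply: leq_trans nnj binlow.
have D2R : 2 * (2 ^ j * j`!)%:R <= D%:R :> R by rewrite -natrM ler_nat.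
have f0 : 0 < (2 ^ j * j`!)%:R :> R by rewrite ltr0n muln_gt0 expn_gt0 fact_gt0.
have l0 : 0 < l by lra.
have Lbin : (L <= 'C(n, j))%N.
  rewrite -(ler_nat R) -(ler_pM2r f0) -[X in _ <= X]natrM.
  apply: le_trans (_ : n%:R <= _); last by rewrite ler_nat.
  apply: le_trans Dl; apply: le_trans (_ : 2 * l * (2 ^ j * j`!)%:R <= _).
    by rewrite ler_wpM2r // ltW.
  by rewrite mulrAC ler_wpM2r // ltW.
have Ln : L%:R <= n%:R :> R.
  apply: le_trans L2l _; apply: le_trans Dl; apply: ler_wpM2r; first exact: ltW.
  by rewrite ler_nat.
have KR : 0 < K%:R :> R by rewrite ltr0n.
have DR : 0 < D%:R :> R by rewrite ltr0n; apply: leq_trans D2'.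
have cA : (128 * K * D)%:R <= c.
  apply: le_trans hc; rewrite /c_sub lerDl mulr_ge0 ?expR_ge0 //.
have cB : (64 * K ^ 2 * 2 ^ K)%:R * expR (K%:R * (k + 4)%:R) <= c.
  by apply: le_trans hc; rewrite /c_sub lerDr.
have c0 : 0 < c.
  by apply: lt_le_trans cA; rewrite !natrM !mulr_gt0.
have expo := exponent_split jk.
have nkj : 0 < n%:R ^+ (k - j) :> R by rewrite exprn_gt0.
have nkj1 : 0 < n%:R ^+ (k - j.+1) :> R by rewrite exprn_gt0.
rewrite expo exprD in hp.
set A := n%:R ^+ (k - j) in hp hp1 hp2 nkj *; set B := n%:R ^+ (k - j.+1) in hp nkj1 *.
have hpp : p1 * p2 * (c * (A * B) * l) <= 1.
  by rewrite -ler_pdivlMr // !mulr_gt0.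
have Y b : (8 * L * K)%:R * B * pcol p1 p2 b <= 1.
  have hq : delta < A * pcol p1 p2 (~~ b).
    by case: b => /=; rewrite mulrC -ltr_pdivrMr.
  have pb0 : 0 <= pcol p1 p2 b by case/andP: (pcol01 h1 h2 b).
  have e : p1 * p2 = pcol p1 p2 b * pcol p1 p2 (~~ b) by case: b {hq pb0} => //=; rewrite mulrC.
  have hb : delta * (pcol p1 p2 b * (c * B * l)) <= 1.
    apply: le_trans hpp; rewrite e.
    have -> : pcol p1 p2 b * pcol p1 p2 (~~ b) * (c * (A * B) * l) =
      A * pcol p1 p2 (~~ b) * (pcol p1 p2 b * (c * B * l)) by ring.
    apply: ler_wpM2r; last exact: ltW.
    by apply: mulr_ge0 => //; apply: ltW; rewrite !mulr_gt0.
  apply: le_trans hb.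
  have -> : delta * (pcol p1 p2 b * (c * B * l)) = (delta * c * l) * (B * pcol p1 p2 b) by ring.
  rewrite -mulrA; apply: ler_wpM2r; first by rewrite mulr_ge0 // ltW.
  apply: le_trans (_ : (16 * K)%:R * l <= _).
    rewrite -mulnA [(L * K)%N]mulnC mulnA natrM.
    apply: le_trans (_ : (8 * K)%:R * (2 * l) <= _); first by rewrite ler_wpM2l.
    by rewrite !natrM; lra.
  apply: ler_wpM2r; first exact: ltW.
  rewrite /delta mulrC ler_pdivlMr //; apply: le_trans cA.
  by rewrite -natrM ler_nat; apply/eq_leq; ring.
have Z : (32 * K ^ 2 * 2 ^ K * L)%:R * n%:R ^+ (2 * k - 2 * j - 1) * (p1 * p2) <=
         expR (- (K%:R * (k + 4)%:R)).
  rewrite expo exprD -/A -/B.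
  set W := expR (K%:R * (k + 4)%:R) in cB *.
  have W0 : 0 < W by apply: expR_gt0.
  rewrite expRN -/W -[X in _ <= X]div1r ler_pdivlMr //.
  apply: le_trans hpp.
  have p0 : 0 <= p1 * p2 by rewrite mulr_ge0 //; case/andP: h1; case/andP: h2.
  have -> : p1 * p2 * (c * (A * B) * l) = (c * l) * (A * B * (p1 * p2)) by ring.
  have -> : (32 * K ^ 2 * 2 ^ K * L)%:R * (A * B) * (p1 * p2) * W =
     ((32 * K ^ 2 * 2 ^ K)%:R * W * L%:R) * (A * B * (p1 * p2)).
    by rewrite (natrM _ (32 * K ^ 2 * 2 ^ K)); ring.
  apply: ler_wpM2r; first by apply: mulr_ge0 => //; apply: ltW; rewrite mulr_gt0.
  apply: le_trans (_ : (32 * K ^ 2 * 2 ^ K)%:R * W * (2 * l) <= _).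
    by rewrite ler_wpM2l // mulr_ge0 // ltW.
  have -> : (32 * K ^ 2 * 2 ^ K)%:R * W * (2 * l) = (64 * K ^ 2 * 2 ^ K)%:R * W * l.
    by rewrite !natrM; ring.
  by apply: ler_wpM2r => //; apply: ltW.
apply: le_trans (Pr_percolates_sparse n0 jk h1 h2 L1 Lbin Y Z (ler0n _ _)) _.
apply: le_trans (_ : (2 * (2 * L) ^ 3)%:R * (n%:R ^+ k * (n%:R ^+ (k + 4))^-1) <= _).
  rewrite ler_wpM2l // ler_wpM2l ?exprn_ge0 //.
  by rewrite -expR_ln_pow // ler_expR lerN2 ler_wpM2l.
have -> : n%:R ^+ k * (n%:R ^+ (k + 4))^-1 = n%:R ^- 4 :> R.
  by rewrite exprD; field; rewrite !lt0r_neq0 // exprn_gt0.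
rewrite ler_pdivrMr ?exprn_gt0 //.
have -> : (128 + D)%:R / n%:R * n%:R ^+ 4 = (128 + D)%:R * n%:R ^+ 3 :> R.
  by field; rewrite lt0r_neq0.
rewrite -natrX -natrM ler_nat.
have Ln' : (L <= n)%N by rewrite -(ler_nat R).
apply: leq_trans (_ : 16 * n ^ 3 <= _)%N.
  by rewrite expnMn mulnA leq_mul2l leq_exp2r.
by rewrite leq_mul2r; apply/orP; right; apply: leq_trans (leq_addr _ _).
Qed.

End Asymptotics.

(** * The supercritical regime *)

Section Numerics.

(** [x], [l] and [J] stand for [n], [ln n] and [j + 3]. All quantities are real, and rounding enters
    only through the hypotheses on [L], [M], [m] and [T]. *)
Variables (R : realType) (x l C J L M T m : R).
Hypotheses (J3 : 3 <= J) (CE : C = 8 * (8 * 64) * (8 * 64) * J) (lC : 2 * C <= l) (xC : C * l <= x).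
Hypotheses (L1 : l / (4 * 64) <= L) (L2 : L <= l / (2 * 64)) (L3 : l / (8 * 64) <= L - 1).
Hypotheses (m1 : x <= 4 * m + 4) (M1 : M * 64 <= x) (M2 : x <= 64 * M + 64).
Hypotheses (mT : m <= (T + 1) * (2 * L)) (T0 : 0 <= T).

(** The parameters of [xi_of] when [C l / x] bounds the mean number of edges per pair in each
    colour, and [C / (x l)] the product of the two means, from below. *)
Let a : R := 2 * x / (C * l).
Let b : R := x * l / C.

Lemma num_C : 3 * (8 * (8 * 64) * (8 * 64)) <= C.
Proof. by have := J3; rewrite CE; lra. Qed.

Lemma num_l : 6 * (8 * (8 * 64) * (8 * 64)) <= l.
Proof. by have := num_C; have := lC; lra. Qed.

Lemma num_x : 3 * (8 * (8 * 64) * (8 * 64)) * l <= x.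
Proof.
apply: le_trans xC; apply: ler_wpM2r; first by have := num_l; lra.
exact: num_C.
Qed.

Lemma num_C0 : 0 < C. Proof. have := num_C; lra. Qed.
Lemma num_l0 : 0 < l. Proof. have := num_l; lra. Qed.
Lemma num_x0 : 0 < x. Proof. have := num_x; have := num_l; lra. Qed.
Lemma num_L0 : 0 < L. Proof. by have := num_l; have := L1; lra. Qed.
Lemma num_a0 : 0 <= a.
Proof. by rewrite divr_ge0 // mulr_ge0 // ltW // ?num_x0 ?num_C0 ?num_l0. Qed.
Lemma num_b0 : 0 <= b.
Proof. by rewrite divr_ge0 // ?mulr_ge0 // ltW // ?num_x0 ?num_C0 ?num_l0. Qed.

Lemma num_neq0 : [/\ C != 0, l != 0, x != 0 & L != 0].
Proof. by split; apply: lt0r_neq0; rewrite ?num_C0 ?num_l0 ?num_x0 ?num_L0. Qed.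

Lemma num_TL : x / 16 <= T * L.
Proof.
by have := num_x; have := num_l; have := mT; have := m1; have := L2; lra.
Qed.

Lemma num_trials : x <= T * l.
Proof.
have := num_x0; have := num_TL.
have : T * L <= T * (l / (2 * 64)) by rewrite ler_wpM2l.
lra.
Qed.

(** The condition of [chain_trial_bound] with [s = T]: each term on the left is at most
    [x l / 2^14], and [T L^2] is at least [x l / 2^12]. *)
Lemma num_trial : L ^+ 2 + a * L + b <= T * L ^+ 2.
Proof.
have [C0 l0 x0 _] := num_neq0; have x1 := num_x0; have l1 := num_l0; have C1 := num_C0.
have hC := num_C; have hl := num_l; have hx := num_x.
have aL : a * L <= x * l / ((2 * 64) * (2 * 64)).
  apply: le_trans (_ : a * (l / (2 * 64)) <= _); first by rewrite ler_wpM2l ?num_a0.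
  have -> : a * (l / (2 * 64)) = x / 64 / C by rewrite /a; field; rewrite C0 l0.
  rewrite ler_pdivrMr //.
  have : x * (2 * (2 * 64)) <= x * (l * C).
    rewrite ler_pM2l //; nra.
  lra.
have bb : b <= x * l / ((2 * 64) * (2 * 64)).
  rewrite /b ler_pdivrMr //.
  have : x * l * ((2 * 64) * (2 * 64)) <= x * l * C by rewrite ler_pM2l ?mulr_gt0 //; lra.
  lra.
have L1' := L1.
have LL : L ^+ 2 <= x * l / ((2 * 64) * (2 * 64)).
  have : L * L <= (l / (2 * 64)) * (l / (2 * 64)) by apply: ler_pM => //; apply/ltW/num_L0.
  have : l * l <= x * l by rewrite ler_pM2r //; lra.
  rewrite expr2; lra.
have : x / 16 * L <= T * L * L by rewrite ler_wpM2r ?num_TL // ltW // num_L0.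
have : x * (l / (4 * 64)) <= x * L by rewrite ler_pM2l.
have -> : T * L ^+ 2 = T * L * L by rewrite expr2 mulrA.
have : 0 < x * l by rewrite mulr_gt0.
lra.
Qed.

Lemma num_last : J * l <= M * (C * l / x).
Proof.
have [C0 l0 x0 _] := num_neq0; have x1 := num_x0; have l1 := num_l0; have C1 := num_C0.
have hl := num_l; have hx := num_x.
apply: le_trans (_ : (x / (2 * 64)) * (C * l / x) <= _); last first.
  have M2' := M2; rewrite ler_wpM2r //; last by lra.
  by rewrite divr_ge0 ?mulr_ge0 // ltW.
have -> : (x / (2 * 64)) * (C * l / x) = C / (2 * 64) * l by field.
have J3' := J3; rewrite ler_wpM2r ?(ltW l1) // CE; lra.
Qed.

Lemma num_a : a * (C * l / x) = 2.
Proof. by have [C0 l0 x0 _] := num_neq0; rewrite /a; field; rewrite C0 l0 x0. Qed.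

Lemma num_b : b = (C / (x * l))^-1.
Proof. by have [C0 l0 x0 _] := num_neq0; rewrite /b; field; rewrite C0 l0 x0. Qed.

(** [D] will be the increase of [psi_of] from [L] to [M], a bound for the mean time of this growth;
    even twice it leaves [x / 8] of the [m] rounds. *)
Lemma num_gap (lM D : R) : lM <= l -> D <= M + a * lM + b / (L - 1) -> x / 8 <= m - 2 * D.
Proof.
move=> lMl hD; have L3' := L3; have M1' := M1; have m1' := m1.
have [C0 l0 x0 _] := num_neq0; have x1 := num_x0; have l1 := num_l0; have C1 := num_C0.
have hC := num_C; have hl := num_l; have hx := num_x.
have e1 : a * lM <= x / (4 * (8 * 64) * (8 * 64)).
  apply: le_trans (_ : a * l <= _); first by rewrite ler_wpM2l ?num_a0.
  have -> : a * l = 2 * x / C by rewrite /a; field; rewrite C0 l0.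
  rewrite ler_pdivrMr //.
  have : x * (3 * (8 * (8 * 64) * (8 * 64))) <= x * C by rewrite ler_pM2l.
  lra.
have e2 : b / (L - 1) <= x / (16 * (8 * 64)).
  rewrite ler_pdivrMr; last by lra.
  apply: le_trans (_ : x / (16 * (8 * 64)) * (l / (8 * 64)) <= _); last first.
    by rewrite ler_wpM2l // divr_ge0 // ltW.
  rewrite /b ler_pdivrMr //.
  have : x * l * (3 * (8 * (8 * 64) * (8 * 64))) <= x * l * C by rewrite ler_pM2l ?mulr_gt0.
  have : 0 < x * l by rewrite mulr_gt0.
  lra.
lra.
Qed.

(** This fixes [C]: bounding the inverse of [xi_of] at [L] by [(8 * 64) * (4 * 64)] times
    [x / (C l)] turns the right side into exactly [J l]. *)
Lemma num_xi : J * l <= (1 + a / L + b / L ^+ 2)^-1 / 2 * (x / 8).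
Proof.
have [C0 l0 x0 L0] := num_neq0; have x1 := num_x0; have l1 := num_l0; have C1 := num_C0.
have LP := num_L0; have hl := num_l; have L1' := L1; have J3' := J3.
set u := x / (C * l).
have u1 : 1 <= u by rewrite /u ler_pdivlMr ?mulr_gt0 // mul1r.
have LV : L^-1 <= (4 * 64) / l.
  by rewrite -[X in X <= _]div1r ler_pdivrMr // mulrAC ler_pdivlMr // mul1r; lra.
have lV : l^-1 <= 1 by rewrite invf_le1 //; lra.
have LV0 : 0 < L^-1 by rewrite invr_gt0.
have t1 : a / L <= (8 * 64) * u.
  have -> : a = 2 * u by rewrite /a /u mulrA.
  have : 2 * u * L^-1 <= 2 * u * ((4 * 64) * 1).
    rewrite ler_pM2l; last by lra.
    by apply: le_trans LV _; rewrite ler_pM2l.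
  lra.
have t2 : b / L ^+ 2 <= (4 * 64) * (4 * 64) * u.
  have -> : b / L ^+ 2 = u * (l * l) * (L^-1 * L^-1).
    by rewrite /b /u; field; rewrite C0 l0 L0.
  apply: le_trans (_ : u * (l * l) * ((4 * 64) / l * ((4 * 64) / l)) <= _).
    apply: ler_wpM2l; last by apply: ler_pM => //; apply: ltW.
    by apply: mulr_ge0; [lra|apply: mulr_ge0; apply: ltW].
  have -> : u * (l * l) * ((4 * 64) / l * ((4 * 64) / l)) = (4 * 64) * (4 * 64) * u by field.
  exact: lexx.
have dl : 1 + a / L + b / L ^+ 2 <= (8 * 64) * (4 * 64) * u by lra.
have d0 : 0 < 1 + a / L + b / L ^+ 2.
  have : 0 <= a / L by rewrite divr_ge0 ?num_a0 // ltW.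
  have : 0 <= b / L ^+ 2 by rewrite divr_ge0 ?num_b0 // exprn_ge0 // ltW.
  lra.
apply: le_trans (_ : ((8 * 64) * (4 * 64) * u)^-1 / 2 * (x / 8) <= _); last first.
  have x8 : 0 < x / 8 by lra.
  have uP : 0 < (8 * 64) * (4 * 64) * u by lra.
  rewrite (ler_pM2r x8) ler_pM2r; last by rewrite invr_gt0; lra.
  by rewrite lef_pV2; [exact: dl|rewrite posrE|rewrite posrE].
have -> : ((8 * 64) * (4 * 64) * u)^-1 / 2 * (x / 8) = C / (8 * (8 * 64) * (8 * 64)) * l.
  by rewrite /u; field; rewrite C0 l0 x0.
rewrite ler_wpM2r ?(ltW l1) // CE; lra.
Qed.

End Numerics.

Section Supercritical.

Variable R : realType.
Implicit Types (c : R) (n k j : nat).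

Definition c_link j : R := 8 * (8 * 64) * (8 * 64) * (j + 3)%:R.

(** The loss of [link_count] against [n ^ (k - j - 2)]: a factor 16 per vertex since at least
    [n / 16] vertices are free, and [2 ^ h * h!] from the binomial with [h = k - j - 2]. *)
Definition link_const k j : nat := (32 ^ (k - j.+2) * (k - j.+2)`!)%N.

(** Squared because the product of the two colours suffers the loss twice. *)
Definition c_sup k j : R := c_link j * (link_const k j)%:R ^+ 2.

(** The first term yields [C * ln n <= n] for [C = c_link j]; the second yields
    [16 (j + 3) <= ln n], used for the trials, and [32 k <= n]. *)
Definition ln_threshold k j : R := 2 * c_link j + 64 * k%:R.

Lemma c_link_gt0 j : 0 < c_link j.
Proof. by rewrite /c_link; have : 0 < (j + 3)%:R :> R by [rewrite ltr0n addn3]; lra. Qed.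

Lemma link_bin n k j w : (n <= 16 * w)%N -> (2 * (k - j.+2) <= w)%N ->
  n%:R ^+ (k - j.+2) <= 'C(w, k - j.+2)%:R * (link_const k j)%:R :> R.
Proof.
rewrite /link_const; move: (k - j.+2)%N => h nw hw; rewrite -natrX -natrM ler_nat.
apply: leq_trans (_ : (16 * w) ^ h <= _)%N.
  by case: h hw => // h hw; rewrite leq_exp2r.
rewrite expnMn; apply: leq_trans (_ : 16 ^ h * ('C(w, h) * (2 ^ h * h`!)) <= _)%N.
  by rewrite leq_mul2l bin_geq_exp ?orbT.
rewrite (expnMn 16 2 h : (32 ^ h)%N = _) mulnCA leq_mul2l mulnA leqnn orbT //.
Qed.

(** Passes from edge probabilities to mean numbers of edges at one pair: [N] is the number of edges
    available and [F] its loss against [x ^ h]. *)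
Lemma link_scaling (x l c C N F p1 p2 : R) (h : nat) :
  0 < x -> 0 < l -> 0 < C -> 1 <= F -> 0 <= N -> x ^+ h <= N * F -> C * F ^+ 2 <= c ->
  c / (x ^+ (h + h.+1) * l) <= p1 * p2 ->
  (forall b, c * l / x ^+ h.+1 <= pcol p1 p2 b) ->
  (forall b, C * l / x <= N * pcol p1 p2 b) /\ C / (x * l) <= (N * p1) * (N * p2).
Proof.
move=> x0 l0 C0 F1 N0 NF cC hpp hb.
have F0 : 0 < F by apply: lt_le_trans F1.
have xh : 0 < x ^+ h by rewrite exprn_gt0.
have c0 : 0 < c by apply: lt_le_trans cC; rewrite mulr_gt0 // exprn_gt0.
have CF : C * F <= c.
  by apply: le_trans cC; rewrite ler_pM2l // expr2 ler_peMr // ltW.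
have xn := lt0r_neq0 x0; have ln0 := lt0r_neq0 l0; have xhn := lt0r_neq0 xh.
split.
  move=> b; apply: le_trans (_ : N * (c * l / x ^+ h.+1) <= _); last by rewrite ler_wpM2l.
  have -> : N * (c * l / x ^+ h.+1) = (N * c / x ^+ h) * (l / x).
    by rewrite exprS; field; rewrite xn xhn.
  rewrite -mulrA; apply: ler_wpM2r; first by rewrite divr_ge0 ?ltW.
  rewrite ler_pdivlMr //; apply: le_trans (_ : C * (N * F) <= _).
    by rewrite ler_pM2l.
  by rewrite mulrCA ler_wpM2l.
rewrite mulrACA.
apply: le_trans (_ : N * N * (c / (x ^+ (h + h.+1) * l)) <= _); last first.
  by rewrite ler_wpM2l // mulr_ge0.
have -> : N * N * (c / (x ^+ (h + h.+1) * l)) =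
   (N * N * c / (x ^+ h * x ^+ h)) / (x * l).
  by rewrite exprD exprS; field; rewrite xn xhn ln0.
rewrite ler_pM2r ?invr_gt0 ?mulr_gt0 // ler_pdivlMr ?mulr_gt0 //.
apply: le_trans (_ : C * ((N * F) * (N * F)) <= _).
  by rewrite ler_pM2l //; apply: ler_pM => //; apply: ltW.
have -> : C * ((N * F) * (N * F)) = N * N * (C * F ^+ 2) by ring.
by rewrite ler_wpM2l // mulr_ge0.
Qed.

Lemma exp_32_le L : 32 ^+ L <= expR (31 * L%:R) :> R.
Proof.
rewrite mulrC expRM_natl; apply: lerXn2r; rewrite ?nnegrE ?expR_ge0 //.
by have := expR_ge1Dx (31 : R); lra.
Qed.

(** With [n = expR l], [32 ^ L <= expR (31 L) <= n ^ (1/4)] and [T >= n / l], so the mean number of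
    successful trials is at least [n ^ (3/4) / l]. The cubic term of the exponential series already
    puts this above [q l]. *)
Lemma trials_bound (l q : R) (L T : nat) : 16 * q <= l -> 1 <= l ->
  31 * L%:R <= l / 4 -> expR l <= T%:R * l ->
  (1 - 32 ^- L) ^+ T <= expR (- (q * l)).
Proof.
move=> ql l1 Ll Tl.
have h32 : expR (- (l / 4)) <= 32 ^- L.
  rewrite expRN lef_pV2 ?posrE ?expR_gt0 ?exprn_gt0 //.
  by apply: le_trans (exp_32_le L) _; rewrite ler_expR.
apply: le_trans (_ : expR (- (32 ^- L)) ^+ T <= _).
  apply: lerXn2r; rewrite ?nnegrE ?expR_ge0 ?expR_ge1Dx //.
  by rewrite subr_ge0 invf_le1 ?exprn_gt0 // exprn_ege1 // ler1n.
rewrite -expRM_natl ler_expR mulrN lerN2.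
apply: le_trans (_ : T%:R * expR (- (l / 4)) <= _); last by rewrite ler_wpM2l.
have l0 : 0 < l by lra.
rewrite -(ler_pM2r l0) [X in _ <= X]mulrAC.
apply: le_trans (_ : expR l * expR (- (l / 4)) <= _); last first.
  by rewrite ler_wpM2r ?expR_ge0.
rewrite -expRD.
have -> : l - l / 4 = 3 * l / 4 by lra.
have y0 : 0 <= 3 * l / 4 by lra.
have := expR_ge1Dxn 2 y0; move: (expR _) => E hE.
have f3 : (3`!)%:R = 6 :> R by [].
rewrite f3 in hE.
have e3 : (3 * l / 4) ^+ 3 = 27 / 64 * (l * (l * l)) by field.
rewrite e3 in hE.
have ll : 0 <= l * l by rewrite mulr_ge0 // ltW.
have l3 : 0 <= l * (l * l) by rewrite mulr_ge0 // ltW.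
have hq : 16 * q * (l * l) <= l * (l * l) by rewrite ler_wpM2r.
rewrite -mulrA; lra.
Qed.

(** The factor 2 in [T] lets the trials discard at most half of the pool of size [m]; the other half
    still gives [T] rounds to each of [L] levels. *)
Lemma nat_params n k j L m T M : (j.+1 < k)%N -> (32 * k <= n)%N -> (0 < L)%N ->
  m = (n %/ 4)%N -> T = (m %/ (2 * L))%N -> M = (n %/ 64)%N ->
  [/\ (T + (m + m) + 2 + j <= n)%N, (n <= 16 * (n - j - (T + (m + m) + 2)))%N,
      (2 * (k - j.+2) <= n - j - (T + (m + m) + 2))%N, (T * L <= m - T * L)%N &
      [/\ (n <= 4 * m + 4)%N, (M * 64 <= n)%N, (n <= 64 * M + 64)%N &
      (m <= T.+1 * (2 * L))%N]].
Proof.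
move=> jk kn L0 mE TE ME.
have m1 : (m * 4 <= n)%N by rewrite mE leq_trunc_div.
have m2 : (n < m.+1 * 4)%N by rewrite mE ltn_ceil.
have M1 : (M * 64 <= n)%N by rewrite ME leq_trunc_div.
have M2 : (n < M.+1 * 64)%N by rewrite ME ltn_ceil.
have T1 : (T * (2 * L) <= m)%N by rewrite TE leq_trunc_div.
have T2 : (m < T.+1 * (2 * L))%N by rewrite TE ltn_ceil // muln_gt0.
have T3 : (T * L + T * L <= m)%N by rewrite addnn -mul2n mulnCA.
have Tm : (T <= m)%N by apply: leq_trans T1; rewrite leq_pmulr // muln_gt0.
clear T1 mE TE ME; split; [lia|lia|lia|lia|split; lia].
Qed.

Lemma xi_of_gt0 (a b : R) i : 0 <= a -> 0 <= b -> 0 < xi_of a b i.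
Proof.
move=> a0 b0; rewrite invr_gt0.
have : 0 <= a / i%:R by rewrite divr_ge0.
have : 0 <= b / i%:R ^+ 2 by rewrite divr_ge0 ?exprn_ge0.
lra.
Qed.

Lemma xi_of_mono (a b : R) i L : 0 <= a -> 0 <= b -> (0 < L <= i)%N ->
  xi_of a b L <= xi_of a b i.
Proof.
move=> a0 b0 /andP[L0 Li].
have pos q : 0 < 1 + a / q%:R + b / q%:R ^+ 2.
  by have := @xi_of_gt0 a b q a0 b0; rewrite invr_gt0.
have LR0 : 0 < L%:R :> R by rewrite ltr0n.
have iR0 : 0 < i%:R :> R by rewrite ltr0n (leq_trans L0).
rewrite /xi_of lef_pV2 ?posrE // -!addrA lerD2l; apply: lerD; rewrite ler_wpM2l //.
  by rewrite lef_pV2 ?posrE // ler_nat.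
by rewrite lef_pV2 ?posrE ?exprn_gt0 //; apply: lerXn2r; rewrite ?nnegrE // ler_nat.
Qed.

Lemma Pr_not_percolates_supercritical n k j (p1 p2 c : R) :
  (j.+1 < k)%N -> 0 <= p1 <= 1 -> 0 <= p2 <= 1 -> c_sup k j <= c ->
  (0 < n)%N -> ln_threshold k j <= ln n%:R ->
  c / (n%:R ^+ (2 * k - 2 * j.+1 - 1) * ln n%:R) <= p1 * p2 ->
  c * ln n%:R / n%:R ^+ (k - j.+1) <= Num.min p1 p2 ->
  Pr (@edge_prob R n k p1 p2) (fun o => `[< ~ j_percolates j.+1 (graph_of o) >]) <=
  6 / n%:R.
Proof.
move=> jk h1 h2 hc n0 hl hpp hmin.
have jk4 : (j + 3 <= 4 * k)%N by lia.
have nE : expR (ln n%:R) = n%:R :> R by rewrite lnK // posrE ltr0n.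
have hpow := @pow_ln_le R n 1 (c_link j) n0 (ltW (c_link_gt0 j)).
have heta := @expR_ln_pow R n (j + 3) n0.
have hlnM M : (0 < M <= n)%N -> ln M%:R <= ln n%:R :> R.
  by move=> /andP[M0 Mn]; rewrite ler_ln ?posrE ?ltr0n ?ler_nat.
move: (ln n%:R) hl hpp hmin nE hpow heta hlnM => l hl hpp hmin nE hpow heta hlnM.
have j3 : 3 <= (j + 3)%:R :> R by rewrite ler_nat leq_addl.
have CE : c_link j = 8 * (8 * 64) * (8 * 64) * (j + 3)%:R by [].
have kR : 0 <= k%:R :> R by [].
have lC : 2 * c_link j <= l by move: hl; rewrite /ln_threshold; lra.
have kl : 64 * k%:R <= l by move: hl (ltW (c_link_gt0 j)); rewrite /ln_threshold; lra.
have l1 : 1 <= l by move: lC; rewrite CE; lra.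
have Cl : c_link j * l <= n%:R.
  by move: hpow; rewrite expr1; apply.
have C0 := c_link_gt0 j.
set C := c_link j in CE lC Cl C0.
have hl6 := num_l j3 CE lC; have hx := num_x j3 CE lC Cl.
(* The divisor 128 keeps [31 * L] below [l / 4], as [trials_bound] demands. *)
have [L /andP[Ll lL]] : exists L : nat, L%:R <= l / (2 * 64) < L%:R + 1 by apply: nat_floor; lra.
have L256 : l / (4 * 64) <= L%:R by move: lL hl6; clear; lra.
have L512 : l / (8 * 64) <= L%:R - 1 by move: lL hl6; clear; lra.
have L2 : (1 < L)%N by rewrite -(ltr_nat R); move: L512 hl6; clear; lra.
have L0 : (0 < L)%N by apply: ltnW.
have nk : (32 * k <= n)%N by rewrite -(ler_nat R) natrM; move: kl hx l1; clear; lra.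
have [m [T [M [mE TE ME]]]] : exists m T M,
  [/\ m = (n %/ 4)%N, T = (m %/ (2 * L))%N & M = (n %/ 64)%N] by do 3 eexists.
have [size_ok nw hw TL [m1 M1 M2 mT]] := nat_params jk nk L0 mE TE ME.
have Mn : (M <= n)%N by apply: leq_trans M1; rewrite leq_pmulr.
clear mE TE ME.
have m1' : n%:R <= 4 * m%:R + 4 :> R by rewrite -natrM -natrD ler_nat.
have M1' : M%:R * 64 <= n%:R :> R by rewrite -natrM ler_nat.
have M2' : n%:R <= 64 * M%:R + 64 :> R by rewrite -natrM -natrD ler_nat.
have mT' : m%:R <= (T%:R + 1) * (2 * L%:R) :> R by rewrite natr1 -!natrM ler_nat.
have T0 : 0 <= T%:R :> R by [].
have x0 := num_x0 j3 CE lC Cl; have l0 := num_l0 j3 CE lC.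
have kh : (k - j.+1)%N = (k - j.+2).+1 by rewrite subnSK.
have kh2 : (2 * k - 2 * j.+1 - 1)%N = ((k - j.+2) + (k - j.+2).+1)%N.
  by rewrite exponent_split // kh addnC.
rewrite kh in hmin; rewrite kh2 in hpp.
have F1 : 1 <= (link_const k j)%:R :> R.
  by rewrite ler1n muln_gt0 expn_gt0 fact_gt0.
have hb d : c * l / n%:R ^+ (k - j.+2).+1 <= pcol p1 p2 d.
  by apply: le_trans hmin _; case: d; rewrite /= ge_min lexx ?orbT.
have [hPb hPP] := link_scaling x0 l0 C0 F1 (ler0n _ _) (link_bin nw hw) hc hpp hb.
pose a : R := 2 * n%:R / (C * l); pose b : R := n%:R * l / C.
have a0 : 0 <= a := num_a0 j3 CE lC Cl.
have b0 : 0 <= b := num_b0 j3 CE lC Cl.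
have P0 d : 0 < 'C(n - j - (T + (m + m) + 2), k - j.+2)%:R * pcol p1 p2 d.
  by apply: lt_le_trans (hPb d); rewrite divr_gt0 // mulr_gt0.
have Pa d : 2 / ('C(n - j - (T + (m + m) + 2), k - j.+2)%:R * pcol p1 p2 d) <= a.
  rewrite ler_pdivrMr //; apply: le_trans (ler_wpM2l a0 (hPb d)).
  by rewrite (num_a j3 CE lC Cl L256).
have Pb : ('C(n - j - (T + (m + m) + 2), k - j.+2)%:R * p1 *
           ('C(n - j - (T + (m + m) + 2), k - j.+2)%:R * p2))^-1 <= b.
  rewrite /b (num_b j3 CE lC Cl L256) lef_pV2 ?posrE //; last by rewrite divr_gt0 // mulr_gt0.
  by rewrite mulr_gt0 //; [apply: (P0 true)|apply: (P0 false)].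
have LM' : (L <= M)%N by rewrite -(ler_nat R); move: M2' hx hl6 Ll; clear; lra.
have LM : (0 < L <= M)%N by rewrite L0.
pose eta := expR (- ((j + 3)%:R * l)).
have He d : expR (- (M%:R * ('C(n - j - (T + (m + m) + 2), k - j.+2)%:R * pcol p1 p2 d))) <= eta.
  rewrite ler_expR lerN2; apply: le_trans (ler_wpM2l (ler0n _ M) (hPb d)).
  exact: (num_last j3 CE lC Cl L256 M2').
have eps0 : 0 <= 1 - 32 ^- L :> R.
  by rewrite subr_ge0 invf_le1 ?exprn_gt0 // exprn_ege1 // ler1n.
have Ht r : (m - T * L <= r)%N -> chain (xi_of a b) L r 1 <= 1 - 32 ^- L.
  move=> hr; apply: (chain_trial_bound a0 b0 L0 (s := T)).
    apply: leq_trans hr; apply: leq_trans TL; rewrite mulnC leq_mul2l leq_subr orbT //.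
  exact: (num_trial j3 CE lC Cl L256 Ll m1' mT').
apply: le_trans (Pr_not_percolates jk h1 h2 size_ok P0 Pa Pb LM He eps0 Ht) _.
have trials : (1 - 32 ^- L) ^+ T <= eta.
  apply: trials_bound => //.
  - have : (j + 3)%:R <= 4 * k%:R :> R by rewrite -natrM ler_nat.
    by move: kl; clear; lra.
  - by move: Ll l1; clear; lra.
  - rewrite nE; exact: (num_trials j3 CE lC Cl Ll m1' mT' T0).
have stage2 : chain (xi_of a b) M m L <= eta.
  have xi01 i : 0 < xi_of a b i <= 1.
    by rewrite xi_of_gt0 //; case/andP: (xi_of01 i a0 b0).
  have xL0 : 0 < xi_of a b L by apply: xi_of_gt0.
  have h0 : 0 <= xi_of a b L / 2 by rewrite divr_ge0 // ltW.
  (* [xi_of] does not decrease with the size, so half its value at [L] is an admissible [lam] for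
     the whole second scan. *)
  apply: le_trans (chain_potential (psi := psi_of a b) (lam := xi_of a b L / 2)
    (L := L) m xi01 _ h0 _ _) _.
  - move=> i /andP[Li _]; apply: psi_of_step => //; exact: leq_trans Li.
  - move=> i /andP[Li _]; rewrite mulrCA divff ?mulr1 //.
    by apply: xi_of_mono; rewrite ?L0.
  - by rewrite leqnn.
  rewrite ler_expR.
  have hD : psi_of a b M - psi_of a b L <= M%:R + a * ln M%:R + b / (L%:R - 1).
    have := psi_of_diff a0 b0 (_ : 1 < L <= M)%N; rewrite L2 LM' => /(_ isT).
    by rewrite -subn1 natrB.
  have lnM : ln M%:R <= l by apply: hlnM; rewrite Mn andbT (leq_trans L0).
  have gap := num_gap j3 CE lC Cl L256 L512 m1' M1' lnM hD.
  have key : (j + 3)%:R * l <= xi_of a b L / 2 * (n%:R / 8) := num_xi j3 CE lC Cl L256.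
  by have := ler_wpM2l h0 gap; move: key; clear; lra.
apply: le_trans (_ : n%:R ^+ j.+2 * (6 * eta) <= _).
  by rewrite ler_wpM2l ?exprn_ge0 //; move: trials stage2; clear; lra.
rewrite /eta heta addn3 [n%:R ^+ j.+3]exprS.
have nj : 0 < n%:R ^+ j.+2 :> R by rewrite exprn_gt0.
rewrite le_eqVlt; apply/orP; left; apply/eqP; field.
by rewrite !lt0r_neq0.
Qed.

End Supercritical.

(** * Passage to the limit *)

Lemma Pr_HN (R : realType) (n k : nat) (p1 p2 : R) (A : double_graph 'I_n -> Prop) :
  Pr_H k p1 p2 (fun H => ~ A H) = 1 - Pr_H k p1 p2 A.
Proof.
rewrite !Pr_HE -PrC; apply: eq_Pr => w; exact: asbool_neg.
Qed.

Lemma Pr_H_le1 (R : realType) (n k : nat) (p1 p2 : R) (A : double_graph 'I_n -> Prop) :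
  0 <= p1 <= 1 -> 0 <= p2 <= 1 -> Pr_H k p1 p2 A <= 1.
Proof. by move=> h1 h2; rewrite Pr_HE; apply: Pr_le1; apply: edge_prob01. Qed.

Local Open Scope classical_set_scope.

Lemma cvg_to_one (R : realType) (f : nat -> R) (K : R) :
  (\forall n \near \oo, 1 - K / n%:R <= f n <= 1) -> f n @[n --> \oo] --> (1 : R).
Proof.
move=> hf; apply/cvgrPdist_le => e e0; near=> n.
have n0 : 0 < n%:R :> R.
  by rewrite ltr0n; near: n; exact: nbhs_infty_gt.
have h : 1 - K / n%:R <= f n <= 1 by near: n.
have Ke : K / n%:R <= e.
  rewrite ler_pdivrMr // mulrC -ler_pdivrMr //.
  by near: n; exact: nbhs_infty_ger.
rewrite ger0_norm; lra.
Unshelve. all: by end_near.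
Qed.

Lemma ln_large (R : realType) (K : R) : \forall n \near \oo, K <= ln n%:R :> R.
Proof.
near=> n.
have hn : expR K <= n%:R by near: n; exact: nbhs_infty_ger.
by rewrite -[K]expRK ler_ln // posrE ?expR_gt0 // (lt_le_trans _ hn) ?expR_gt0.
Unshelve. all: by end_near.
Qed.

Theorem theorem1p2 (R : realType) (k j : nat) (hj : (1 <= j <= k - 1)%N) :
  exists c : R, 0 < c /\
    forall p1 p2 : nat -> R,
      (forall n : nat, 0 <= p1 n <= 1) ->
      (forall n : nat, 0 <= p2 n <= 1) ->
      ((\forall n \near \oo,
          p1 n * p2 n <= 1 / (c * n%:R ^+ (2 * k - 2 * j - 1) * ln n%:R)) ->
        Pr_H k (p1 n) (p2 n) (fun H : double_graph 'I_n => ~ j_percolates j H)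
          @[n --> \oo] --> (1 : R))
      /\
      ((\forall n \near \oo,
          c / (n%:R ^+ (2 * k - 2 * j - 1) * ln n%:R) <= p1 n * p2 n) ->
       (\forall n \near \oo,
          c * ln n%:R / n%:R ^+ (k - j) <= Num.min (p1 n) (p2 n)) ->
        Pr_H k (p1 n) (p2 n) (fun H : double_graph 'I_n => j_percolates j H)
          @[n --> \oo] --> (1 : R)).
Proof.
case: j hj => [//|j] /= hj.
have jk : (j.+1 < k)%N by move: hj; case: k => // k; rewrite subn1.
have csup : 0 < c_sup R k j.
  rewrite mulr_gt0 ?c_link_gt0 // exprn_gt0 // ltr0n /link_const.
  by rewrite muln_gt0 expn_gt0 fact_gt0.
have csub : 0 <= c_sub R k j.+1 by rewrite addr_ge0 // mulr_ge0 ?expR_ge0.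
(* Each regime only asks that [c] be at least its own constant, so the sum serves both. *)
exists (c_sub R k j.+1 + c_sup R k j); split; first by rewrite ltr_wpDl.
move=> p1 p2 h1 h2; split=> [hp|hpp hmin].
  apply: (@cvg_to_one _ _ (128 + cover_const k j.+1)%:R); near=> n.
  rewrite Pr_HN lerD2l lerN2 gerBl; apply/andP; split; last first.
    by rewrite Pr_HE; apply: Pr_ge0; apply: edge_prob01.
  rewrite Pr_HE; apply: (@Pr_percolates_subcritical _ _ _ _ _ _ (c_sub R k j.+1 + c_sup R k j)) => //.
  - by rewrite lerDl ltW.
  - by near: n; exact: nbhs_infty_gt.
  - by near: n; exact: ln_large.
  - by near: n.
apply: (@cvg_to_one _ _ 6); near=> n.
rewrite Pr_H_le1 // andbT lerBlDr addrC -lerBlDr -Pr_HN Pr_HE.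
apply: (@Pr_not_percolates_supercritical _ _ _ _ _ _ (c_sub R k j.+1 + c_sup R k j)) => //.
- by rewrite lerDr.
- by near: n; exact: nbhs_infty_gt.
- by near: n; exact: ln_large.
- by near: n.
- by near: n.
Unshelve. all: by end_near.
Qed.
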